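(* Let $G$ be a $4.5$-tough $(P_4\cup P_1)$-free graph on at least three vertices, and let $Z\subseteq V(G)$ be such that the induced subgraph $G[Z]$ is $P_4$-free. Then $G$ has a cycle containing every vertex of $Z$.
   Context: All graphs are finite and simple. $P_4$ is the path on four vertices, and $P_4\cup P_1$ denotes the disjoint union of a path on four vertices and a single isolated vertex; a graph is $H$-free if it contains no induced subgraph isomorphic to $H$. For a graph $G$ and $X\subseteq V(G)$, $c(G-X)$ denotes the number of connected components of $G-X$. The toughness of $G$ is $\tau(G)=\min\{|X|/c(G-X): X\subseteq V(G),\ c(G-X)\ge 2\}$, with $\tau(G)=\infty$ if $G$ is complete; for real $t\ge0$, $G$ is $t$-tough if $\tau(G)\ge t$. *)

(* Defs.v *)
From HB Require Import structures.
From mathcomp Require Import all_boot all_order all_algebra.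
From mathcomp Require Import reals constructive_ereal.

Set Implicit Arguments.
Unset Strict Implicit.
Unset Printing Implicit Defensive.

Import Order.TTheory GRing.Theory Num.Theory.

Record sgraph := SGraph {
  vertex :> finType;
  adj : rel vertex;
  adj_sym : symmetric adj;
  adj_irr : irreflexive adj
}.

Definition isomorphic (G H : sgraph) : Prop :=
  exists2 f : G -> H, bijective f & forall x y : G, adj (f x) (f y) = adj x y.

Section Induced.
Variables (G : sgraph) (S : {set G}).

Definition induced_adj : rel {x : G | x \in S} :=
  fun u v => adj (val u) (val v).

Lemma induced_adj_sym : symmetric induced_adj.
Proof. by move=> u v; apply: adj_sym. Qed.

Lemma induced_adj_irr : irreflexive induced_adj.
Proof. by move=> u; apply: adj_irr. Qed.

Definition induced : sgraph := SGraph induced_adj_sym induced_adj_irr.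

End Induced.

Section Path.
Variable n : nat.

Definition path_adj : rel 'I_n := fun i j => (i.+1 == j) || (j.+1 == i).

Lemma path_adj_sym : symmetric path_adj.
Proof. by move=> i j; rewrite /path_adj orbC. Qed.

Lemma path_adj_irr : irreflexive path_adj.
Proof. by move=> i; rewrite /path_adj orbb gtn_eqF. Qed.

Definition path_graph : sgraph := SGraph path_adj_sym path_adj_irr.

End Path.

Section DisjointUnion.
Variables G H : sgraph.

Definition union_adj : rel (G + H)%type := fun u v =>
  match u, v with
  | inl x, inl y => adj x y
  | inr x, inr y => adj x y
  | _, _ => false
  end.

Lemma union_adj_sym : symmetric union_adj.
Proof. by case=> x [] y //=; apply: adj_sym. Qed.

Lemma union_adj_irr : irreflexive union_adj.
Proof. by case=> x /=; apply: adj_irr. Qed.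

Definition disjoint_union : sgraph := SGraph union_adj_sym union_adj_irr.

End DisjointUnion.

Definition P4 : sgraph := path_graph 4.
Definition P4_P1 : sgraph := disjoint_union P4 (path_graph 1).

Definition graph_free (H G : sgraph) : Prop :=
  forall S : {set G}, ~ isomorphic (induced S) H.

Definition ncomponents (G : sgraph) : nat := n_comp (@adj G) predT.

Definition delete (G : sgraph) (X : {set G}) : sgraph := induced (~: X).

(* The minimum over the empty family is +oo; a graph has no X with
   c(G - X) >= 2 exactly when it is complete. *)
Definition toughness (R : realType) (G : sgraph) : \bar R :=
  \big[Order.min/+oo%E]_(X : {set G} | 2 <= ncomponents (delete X))
     ((#|X|%:R / (ncomponents (delete X))%:R)%R)%:E.

Definition tough (R : realType) (t : R) (G : sgraph) : Prop :=
  (t%:E <= toughness R G)%E.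

Definition has_cycle_through (G : sgraph) (Z : {set G}) : Prop :=
  exists c : seq G, [/\ 2 < size c, ucycle (@adj G) c & {subset Z <= c}].

(* Main.v *)
Require Import Defs.
From mathcomp Require Import all_boot all_order all_algebra.
From mathcomp Require Import reals constructive_ereal.
From mathcomp Require Import zify.

Set Implicit Arguments.
Unset Strict Implicit.
Unset Printing Implicit Defensive.

Import Order.TTheory GRing.Theory Num.Theory.

(* The path cover number k(D) of a P_4-free graph D (k(A u B) = k(A) + k(B) for a disjoint union, and for a join
   max(1, k(A) - |B|, k(B) - |A|)) equals the maximum of c(D - X) - |X|, so toughness supplies many neighbours
   outside D. In a (P_4 u P_1)-free graph every induced P_4 is dominating; hence a set Z inducing a disconnected
   graph is P_4-free, and we may take Z maximal with this property. Write Z as an anticomplete union of D1 and D2;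
   every y outside Z then meets both D1 and D2, and by domination it is complete to one of them whenever one of
   them is disconnected, or at least to the relevant part of one of them.
   If D1 and D2 are each complete to enough outside vertices, they extend to disjoint sets in which suitable pairs
   of vertices are joined by paths through D1 (resp. D2), and two disjoint links between these sets close a cycle.
   If D1 lacks such vertices, then most of its neighbours are complete to D2: a linear forest covering D1, whose
   ends have private neighbours there, is closed up through D2, or D1 is split further.
   A connected Z is a join of A and B with |A| >= |B|; it has a Hamiltonian cycle if |A| = |B|, and otherwise the
   vertices of B can be inserted one by one into a cycle through A. *)

(** A cover by k paths consumes 2k private links. An obstruction showing that k paths are needed,
    taken as a cut, has at least 4.5(k+1) outside neighbours by toughness; the extra 1 is a
    component on the other side of the cut. Most case distinctions compare such demands with the
    supply: where a resource is scarce for one part, the count makes it plentiful for the other.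
    Hence toughness is applied to the obstruction dual to path covers, and always in the integer
    form 9c <= 2|X|. *)

Lemma mem_split (T : eqType) (x : T) s : x \in s -> exists s1 s2, s = s1 ++ x :: s2.
Proof. by case/path.splitPr=> s1 s2; exists s1, s2. Qed.

Lemma disjointP (T : finType) (A B : {set T}) : reflect (forall x, x \in A -> x \in B -> False) [disjoint A & B].
Proof.
apply: (iffP pred0P) => [h x xA xB|h x /=]; first by move: (h x); rewrite /= xA xB.
by apply/negP => /andP[]; apply: h.
Qed.

Lemma cardsUd (T : finType) (A B : {set T}) : [disjoint A & B] -> #|A :|: B| = #|A| + #|B|.
Proof. by move=> d; rewrite cardsU disjoint_setI0 // cards0 subn0. Qed.

Lemma cardsU_le (T : finType) (A B : {set T}) : #|A :|: B| <= #|A| + #|B|.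
Proof. by rewrite cardsU leq_subr. Qed.

Lemma flatten_cons (T : Type) (p : seq T) ps : flatten (p :: ps) = p ++ flatten ps.
Proof. by []. Qed.

Lemma count_cons (T : Type) a (x : T) s : count a (x :: s) = a x + count a s.
Proof. by []. Qed.

Lemma rev_cons1 (T : Type) (x : T) s : rev (x :: s) = rev s ++ [:: x].
Proof. by rewrite rev_cons cats1. Qed.

Ltac nat_lia := clear; repeat match goal with
  | |- context [nat_of_bool ?b] => generalize (nat_of_bool b); intro
  | |- context [@count ?T ?a ?s] => generalize (@count T a s); intro
  end; lia.

(* Flattening has to be pushed in first: otherwise [count_cat] unfolds [flatten]. *)
Ltac count_lia := apply/permP => ?;
  rewrite -?cats1 ?(map_cat, map_cons) ?(flatten_cat, flatten_cons) ?cat_cons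
    ?(rev_cat, rev_cons1) ?(count_cat, count_rev, count_cons) /=; nat_lia.

(** * Systems of disjoint paths *)

Section PathSystems.
Variable G : sgraph.
Implicit Types (A B C D E L M S T X Y Z : {set G}) (x y z w : G).
Implicit Types (p q s : seq G) (ps qs : seq (seq G)).

Definition nbr x : {set G} := [set y | adj x y].
Definition anti A B := {in A & B, forall x y, ~~ adj x y}.
Definition full A B := {in A & B, forall x y, adj x y}.

Lemma antiC A B : anti A B -> anti B A.
Proof. by move=> h x y xB yA; rewrite adj_sym h. Qed.

Lemma fullC A B : full A B -> full B A.
Proof. by move=> h x y xB yA; rewrite adj_sym h. Qed.

Definition ends A p :=
  if p is x :: p' then (x \in A) && (last x p' \in A) else false.

Lemma ends_rev A p : ends A (rev p) = ends A p.
Proof.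
case: p => // x p; case: (lastP p) => [//|q y].
rewrite -rcons_cons rev_rcons rev_cons /= last_rcons andbC.
by rewrite last_rcons.
Qed.

Lemma ends_sub A p : p != [::] -> {subset p <= A} -> ends A p.
Proof.
case: p => // x p _ h /=; rewrite h ?mem_head //= h //.
exact: mem_last.
Qed.

Lemma sorted_rev_adj p : sorted (@adj G) (rev p) = sorted (@adj G) p.
Proof.
by rewrite rev_sorted; apply: eq_sorted => x y; rewrite adj_sym.
Qed.

Definition pathsys ps :=
  all (fun p => (p != [::]) && sorted (@adj G) p) ps && uniq (flatten ps).

Lemma perm_pathsys ps qs : perm_eq ps qs -> pathsys ps = pathsys qs.
Proof.
move=> h; rewrite /pathsys (perm_all _ h); congr (_ && _).
exact/perm_uniq/perm_flatten.
Qed.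

Lemma size_flatten_ge ps :
  all (fun p => p != [::]) ps -> size ps <= size (flatten ps).
Proof.
elim: ps => //= p ps IH /andP[pn /IH h]; rewrite size_cat.
by case: p pn => //= x p _; lia.
Qed.

Lemma pathsys_size ps A :
  pathsys ps -> {subset flatten ps <= A} -> size ps <= #|A|.
Proof.
move=> /andP[h u] s; apply: leq_trans (size_flatten_ge _) _.
  by apply: sub_all h => p /andP[].
rewrite -(card_uniqP u); apply: subset_leq_card; exact/subsetP.
Qed.

(* [k] disjoint paths inside [A] that together pass through all of [C]. *)
Definition cov A C k := exists ps,
  [/\ size ps = k, pathsys ps, {subset flatten ps <= A} & {subset C <= flatten ps}].

Lemma cov_sub A A' C C' k : A \subset A' -> C' \subset C -> cov A C k -> cov A' C' k.
Proof.
move=> /subsetP hA /subsetP hC [ps [h1 h2 h3 h4]]; exists ps; split=> // x.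
  by move/h3/hA.
by move/hC/h4.
Qed.

Lemma cov_size A C k : cov A C k -> k <= #|A|.
Proof. by case=> ps [<- h s _]; apply: pathsys_size. Qed.

Lemma cov_set0 A : cov A set0 0.
Proof. by exists [::]; split=> // x; rewrite inE. Qed.

Lemma all_singletons ps :
  all (fun p => (p != [::]) && sorted (@adj G) p) ps ->
  ~~ has (fun p => 1 < size p) ps -> size (flatten ps) = size ps.
Proof.
elim: ps => //= p ps IH /andP[/andP[pn _] h]; rewrite negb_or -leqNgt => /andP[s1 s2].
rewrite size_cat IH //; case: p pn s1 => // x [] //.
Qed.

(* A split in place leaves [flatten ps], hence both extreme vertices, unchanged. *)
Lemma grow1 A ps x0 : pathsys ps -> {subset flatten ps <= A} -> size ps < #|A| ->
  exists qs, [/\ size qs = (size ps).+1, pathsys qs, {subset flatten qs <= A},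
    {subset flatten ps <= flatten qs} &
    (0 < size ps -> head x0 (flatten qs) = head x0 (flatten ps)) /\
    (1 < size ps -> last x0 (flatten qs) = last x0 (flatten ps))].
Proof.
move=> psP sA lt; have /andP[aP uP] := psP.
case: (boolP (has (fun p => 1 < size p) ps)) => [/hasP[p pin sp] | nh].
  case: p sp pin => // a [] // b p _ /mem_split[ps1 [ps2 E]].
  exists (ps1 ++ [:: a] :: (b :: p) :: ps2).
  have Ef : flatten (ps1 ++ [:: a] :: (b :: p) :: ps2) = flatten ps.
    by rewrite E !flatten_cat.
  split; rewrite ?Ef //.
  - by rewrite E !size_cat /= !addnS.
  - rewrite /pathsys Ef uP andbT; move: aP; rewrite E !all_cat /=.
    by case/and3P=> -> /andP[_ ->] ->.
have [v vA vn] : exists2 v, v \in A & v \notin flatten ps.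
  have: ~~ (A \subset flatten ps).
    apply: contraL lt => /subset_leq_card; rewrite (card_uniqP uP).
    by rewrite all_singletons // -leqNgt.
  by case/subsetPn => v; exists v.
have [E|[p [ps' E]]] : ps = [::] \/ exists p ps', ps = p :: ps'.
  by case: (ps) => [|p ps']; [left | right; exists p, ps'].
  exists [:: [:: v]]; rewrite E; split=> // x.
  by rewrite inE => /eqP->.
(* In second position the new path changes neither the first vertex nor, once another path follows,
   the last one. *)
exists (p :: [:: v] :: ps').
have pe : perm_eq (p :: [:: v] :: ps') ([:: v] :: ps).
  by rewrite E (perm_catCA [:: p] [:: [:: v]] ps').
split.
- by rewrite E.
- by rewrite (perm_pathsys pe) /pathsys /= vn aP uP.
- by move=> x; rewrite (perm_mem (perm_flatten pe)) inE => /orP[/eqP->|/sA].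
- by move=> x; rewrite (perm_mem (perm_flatten pe)) inE => ->; rewrite orbT.
have pn : p != [::] by move: aP; rewrite E /= => /andP[/andP[]].
rewrite E; split=> /=.
  by case: (p) pn.
case: ps' E pe => // q ps' E _ _.
have qn : q != [::] by move: aP; rewrite E /= => /and3P[_ /andP[]].
by rewrite !last_cat /= !last_cat; case: (q) qn.
Qed.

Lemma grow A ps x0 m : pathsys ps -> {subset flatten ps <= A} ->
  size ps <= m <= #|A| ->
  exists qs, [/\ size qs = m, pathsys qs, {subset flatten qs <= A},
    {subset flatten ps <= flatten qs} &
    (0 < size ps -> head x0 (flatten qs) = head x0 (flatten ps)) /\
    (1 < size ps -> last x0 (flatten qs) = last x0 (flatten ps))].
Proof.
move=> psP sA /andP[l1 l2].
elim: m l1 l2 => [|m IH] l1 l2.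
  by exists ps; split=> //; lia.
case: (ltngtP (size ps) m.+1) l1 => // [l1|E] _; last by exists ps; split.
have [qs [h1 h2 h3 h4 [h5 h6]]] := IH l1 (ltnW l2).
have lt : size qs < #|A| by rewrite h1.
have [rs [k1 k2 k3 k4 [k5 k6]]] := grow1 x0 h2 h3 lt.
exists rs; split=> //.
- by rewrite k1 h1.
- by move=> x /h4 /k4.
split=> l; first by rewrite k5 ?h5 //; lia.
by rewrite k6 ?h6 //; lia.
Qed.

Lemma cov_mono A C k m : cov A C k -> k <= m <= #|A| -> cov A C m.
Proof.
move=> [ps [<- h2 h3 h4]] lm.
case: (posnP #|A|) lm => [A0|Ap].
  rewrite A0 => lm; have -> : m = size ps by lia.
  by exists ps; split.
have [a _] : exists a, a \in A by apply/card_gt0P.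
move=> lm; have [qs [k1 k2 k3 k4 _]] := grow a h2 h3 lm.
by exists qs; split=> // x /h4 /k4.
Qed.

Lemma cov_singles A C : C \subset A -> cov A C #|C|.
Proof.
move=> /subsetP sC; exists [seq [:: x] | x <- enum C].
have E : flatten [seq [:: x] | x <- enum C] = enum C.
  by elim: (enum C) => //= x l ->.
split.
- by rewrite size_map cardE.
- rewrite /pathsys E enum_uniq andbT all_map; exact/allP.
- by rewrite E => x; rewrite mem_enum => /sC.
- by rewrite E => x; rewrite mem_enum.
Qed.

(* The heads and lasts below single out the two extreme ends of the system: the start of its first path and
   the end of its last one. *)
Definition ecov1 A C w k := exists ps, [/\ size ps = k, pathsys ps,
  {subset flatten ps <= A}, {subset C <= flatten ps} & head w (flatten ps) = w /\ 0 < k].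

Definition ecov2 A C w1 w2 k := exists ps, [/\ size ps = k, pathsys ps,
  {subset flatten ps <= A}, {subset C <= flatten ps} &
  [/\ 1 < k, head w2 (flatten ps) = w1 & last w1 (flatten ps) = w2]].

Lemma head_default x0 x1 s : s != [::] -> head x0 s = head x1 s.
Proof. by case: s. Qed.

Lemma flatten_neq0 ps : pathsys ps -> 0 < size ps -> flatten ps != [::].
Proof. by case: ps => // [[|x p] ps]. Qed.

Lemma ecov1_mono A C w k m : ecov1 A C w k -> k <= m <= #|A| -> ecov1 A C w m.
Proof.
move=> [ps [<- h2 h3 h4 [h5 h6]]] lm.
have [qs [k1 k2 k3 k4 [k5 _]]] := grow w h2 h3 lm.
exists qs; split=> //; first by move=> x /h4 /k4.
by rewrite k5 //; split=> //; lia.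
Qed.

Lemma ecov2_mono A C w1 w2 k m :
  ecov2 A C w1 w2 k -> k <= m <= #|A| -> ecov2 A C w1 w2 m.
Proof.
move=> [ps [<- h2 h3 h4 [h5 h6 h7]]] lm.
have [qs [k1 k2 k3 k4 [k5 k6]]] := grow w1 h2 h3 lm.
exists qs; split=> //; first by move=> x /h4 /k4.
have n1 := flatten_neq0 h2 (ltnW h5).
have n2 : flatten qs != [::] by apply: flatten_neq0 => //; lia.
split; first lia.
  by rewrite (head_default _ w1) // k5 ?(head_default _ w2) //; lia.
by rewrite k6.
Qed.

(** Making [w] the first vertex costs at most one path: its path is cut in front of [w], or [w]
    becomes a path of its own. *)
Lemma ecov1_pred A C w k : cov A C k -> w \in A ->
  exists k', [/\ k' <= k.+1, k' <= #|A| & ecov1 A C w k'].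
Proof.
move=> [ps [<- h2 h3 h4]] wA.
suff [k' lk e] : exists2 k', k' <= (size ps).+1 & ecov1 A C w k'.
  exists k'; split=> //; case: e => qs [<- q2 q3 _ _]; exact: pathsys_size.
have /andP[aP uP] := h2.
case: (boolP (w \in flatten ps)) => [/flattenP[p pin wp] | wn]; last first.
  exists (size ps).+1 => //; exists ([:: w] :: ps); split=> //.
  - by rewrite /pathsys /= aP wn uP.
  - by move=> x; rewrite inE => /orP[/eqP->|/h3].
  - by move=> x /h4; rewrite inE => ->; rewrite orbT.
have [p1 [p2 Ep]] := mem_split wp; have [ps1 [ps2 Eps]] := mem_split pin.
rewrite {}Eps {}Ep {p ps pin wp} in h2 h3 h4 aP uP *.
move: aP; rewrite all_cat /= => /and3P[a1 /andP[_ a2] a3].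
case: p1 => [|y p1] in h2 h3 h4 uP a2 *.
  exists (size (ps1 ++ (w :: p2) :: ps2)) => //.
  exists ((w :: p2) :: ps1 ++ ps2).
  have pe : perm_eq ((w :: p2) :: ps1 ++ ps2) (ps1 ++ (w :: p2) :: ps2).
    by rewrite -cat_rcons -[_ :: _]/([:: w :: p2] ++ ps1 ++ ps2) perm_catCA cat_rcons.
  split=> //.
  - exact: perm_size.
  - by rewrite (perm_pathsys pe).
  - by move=> x; rewrite (perm_mem (perm_flatten pe)) => /h3.
  - by move=> x /h4; rewrite (perm_mem (perm_flatten pe)).
  - by rewrite /= size_cat addnS.
exists (size (ps1 ++ ((y :: p1) ++ w :: p2) :: ps2)).+1 => //.
exists ((w :: p2) :: (y :: p1) :: ps1 ++ ps2).
have pe : perm_eq (flatten ((w :: p2) :: (y :: p1) :: ps1 ++ ps2))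
                  (flatten (ps1 ++ ((y :: p1) ++ w :: p2) :: ps2)).
  by count_lia.
split=> //.
- by rewrite /= !size_cat /= addnS.
- rewrite /pathsys (perm_uniq pe) uP andbT /= all_cat a1 a3 !andbT.
  by move: a2; rewrite /= cat_path /= => /and3P[-> _ ->].
- by move=> x; rewrite (perm_mem pe) => /h3.
- by move=> x /h4; rewrite (perm_mem pe).
Qed.

Lemma last_flatten x0 w rs q : last x0 (flatten (rs ++ [:: q ++ [:: w]])) = w.
Proof. by rewrite flatten_cat /= !last_cat. Qed.

(** As for the first vertex, one cut makes [w2] the last one; the path starting at [w1] stays in
    front and remains a separate path, whence at least two paths. *)
Lemma ecov2_pred A C w1 w2 k : ecov1 A C w1 k -> w1 != w2 -> w2 \in A ->
  exists k', [/\ k' <= k.+1, k' <= #|A| & ecov2 A C w1 w2 k'].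
Proof.
move=> [ps [<- h2 h3 h4 [h5 h0]]] n12 wA.
suff [k' lk e] : exists2 k', k' <= (size ps).+1 & ecov2 A C w1 w2 k'.
  exists k'; split=> //; case: e => qs [<- q2 q3 _ _]; exact: pathsys_size.
have /andP[aP uP] := h2.
case: ps h0 => // -[|u p] ps _ in h2 h3 h4 h5 aP uP *; first by case/andP: aP.
rewrite /= in h5; rewrite {u}h5 in h2 h3 h4 aP uP *.
pose P qs := all (fun p => (p != [::]) && sorted (@adj G) p) qs.
have fin qs : size qs <= (size ps).+2 -> P qs -> 1 < size qs ->
    head w2 (flatten qs) = w1 -> last w1 (flatten qs) = w2 ->
    perm_eq (flatten qs) (flatten ((w1 :: p) :: ps)) ->
    exists2 k', k' <= (size ((w1 :: p) :: ps)).+1 & ecov2 A C w1 w2 k'.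
  move=> s1 s2 s3 s4 s5 pe; exists (size qs) => //; exists qs; split=> //.
  - by rewrite /pathsys (perm_uniq pe) uP andbT.
  - by move=> x; rewrite (perm_mem pe) => /h3.
  - by move=> x /h4; rewrite (perm_mem pe).
move: aP => /= /andP[pP aP].
case: (boolP (w2 \in w1 :: p ++ flatten ps)) => [|wn]; last first.
  exists (size ps).+2 => //; exists (rcons ((w1 :: p) :: ps) [:: w2]).
  have pe : perm_eq (flatten (rcons ((w1 :: p) :: ps) [:: w2])) (w2 :: w1 :: p ++ flatten ps).
    by count_lia.
  split; rewrite ?size_rcons //.
  - by rewrite /pathsys (perm_uniq pe) all_rcons /= wn pP aP.
  - by move=> x; rewrite (perm_mem pe) in_cons => /orP[/eqP->|/h3].
  - by move=> x /h4 xin; rewrite (perm_mem pe) in_cons; apply/orP; right.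
  - by split=> //; rewrite -cats1 flatten_cat /= last_cat.
rewrite inE eq_sym (negbTE n12) /= mem_cat => /orP[wp|/flattenP[q qin wq]].
  have [p1 [p2 Ep]] := mem_split wp; rewrite {}Ep {p wp h2 h3 h4 uP} in fin pP *.
  (* The path of [w1] is cut in front of [w2], and its tail is reversed and moved to the end. *)
  apply: (fin ((w1 :: p1) :: rcons ps (rev (w2 :: p2)))) => /=.
  - by rewrite size_rcons.
  - move: pP; rewrite /P /= cat_path /= all_rcons aP => /and3P[-> _ h] /=.
    by rewrite sorted_rev_adj /= h -size_eq0 size_rev.
  - by rewrite size_rcons.
  - by [].
  - by rewrite -cats1 flatten_cat /= cats0 !last_cat rev_cons last_rcons.
  - by count_lia.
have [q1 [q2 Eq]] := mem_split wq; have [ps1 [ps2 Eps]] := mem_split qin.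
rewrite {}Eps {}Eq {q ps qin wq h2 h3 h4 uP} in fin aP *.
move: aP; rewrite all_cat /= => /and3P[a1 /andP[_ a2] a3].
case: q2 => [|z q2] in fin a2 *.
  apply: (fin ((w1 :: p) :: ps1 ++ ps2 ++ [:: q1 ++ [:: w2]])).
  - by rewrite /= !size_cat /=; lia.
  - rewrite /P /= pP !all_cat /= a1 a3 a2 !andbT /=.
    by case: (q1).
  - by rewrite /= !size_cat /=; lia.
  - by [].
  - rewrite catA -cat_cons; exact: last_flatten.
  - by count_lia.
apply: (fin ((w1 :: p) :: (z :: q2) :: ps1 ++ ps2 ++ [:: q1 ++ [:: w2]])).
- by rewrite /= !size_cat /=; lia.
- rewrite /P /= pP !all_cat /= a1 a3 /= andbT.
  have nq : q1 ++ [:: w2] != [::] by case: (q1).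
  rewrite nq /=; move: a2; rewrite -[[:: w2, z & q2]]/([:: w2] ++ z :: q2) catA.
  by case/cat_sorted2=> -> /= ->.
- by rewrite /= !size_cat /=; lia.
- by [].
- rewrite catA -!cat_cons; exact: last_flatten.
- by count_lia.
Qed.

(** Leftover paths are simply appended, so that [perm_alt] holds for all lengths; adjacency is
    claimed only when the lengths differ by at most one. *)
Fixpoint alt ps qs :=
  match ps, qs with
  | p :: ps', q :: qs' => p ++ q ++ alt ps' qs'
  | _, _ => flatten ps ++ flatten qs
  end.

Lemma perm_alt ps qs : perm_eq (alt ps qs) (flatten ps ++ flatten qs).
Proof.
elim: ps qs => [|p ps IH] [|q qs] //=.
apply: (@perm_trans _ (p ++ q ++ flatten ps ++ flatten qs)).
  by rewrite !perm_cat2l.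
by count_lia.
Qed.

(** Every junction leads from an end in [A] to an end in [B] or back, and [full A B] supplies the
    edge. For equal lengths the last vertex lies in [B], which allows the sequence to be closed to a
    cycle. *)
Lemma alt_sorted A B ps qs x0 : full A B ->
  all (fun p => ends A p && sorted (@adj G) p) ps ->
  all (fun p => ends B p && sorted (@adj G) p) qs ->
  0 < size ps -> size qs <= size ps <= (size qs).+1 ->
  exists x s, [/\ alt ps qs = x :: s, path (@adj G) x s, x = head x0 (flatten ps), x \in A &
    last x s = (if size qs < size ps then last x0 (flatten ps) else last x0 (flatten qs))
    /\ (size qs = size ps -> last x s \in B)].
Proof.
move=> fAB; elim: ps qs => // p ps IH qs /= /andP[/andP[ep sp] aps].
case: p ep sp => // a p /= /andP[aA lA] pa.
case: qs => [|q qs] /=.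
  move=> _ _; case: ps {IH} aps => // _ _.
  by exists a, (p ++ [::] ++ [::]); rewrite !cats0.
case/andP=> /andP[eq sq] aqs _ /andP[l1 l2].
case: q eq sq => // b q /= /andP[bB lB] pb.
case: (posnP (size ps)) => [E|ps0].
  case: ps E {IH} aps l1 l2 => // _ _; case: qs aqs => // _ _ _.
  exists a, (p ++ b :: q); rewrite /= !cats0; split=> //.
    by rewrite cat_path /= pa fAB.
  by rewrite last_cat /=; split.
have [|x [s [E1 E2 E3 E4 [E5 E6]]]] := IH qs aps aqs ps0; first by apply/andP; split; lia.
exists a, (p ++ b :: q ++ alt ps qs); split=> //=.
  rewrite cat_path /= cat_path E1 /= pa pb E2 fAB //=.
  by rewrite adj_sym fAB.
rewrite E1 last_cat /= last_cat /= E5.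
have n1 : flatten ps != [::] by case: (ps) ps0 aps => // -[|? ?].
split; last by move=> [E]; rewrite -E5 E6.
rewrite !ltnS; case: ifP => l; first by rewrite last_cat; case: (flatten ps) n1.
rewrite last_cat; have n2 : flatten qs != [::].
  have: 0 < size qs by apply: contraFT l; rewrite -eqn0Ngt => /eqP->.
  by case: (qs) aqs => // -[|? ?].
by case: (flatten qs) n2.
Qed.

End PathSystems.

(** * Spanning paths in joins *)

Section Ham.
Variable G : sgraph.
Implicit Types (A B C D E L M S T W X Y Z : {set G}) (x y z w : G).
Implicit Types (p q : seq G) (ps qs : seq (seq G)).

(* Paths may leave [C] as long as they stay in [W]. *)
Definition hpath W C x y := exists t,
  [/\ path (@adj G) x t, uniq (x :: t), {subset x :: t <= W}, {subset C <= x :: t} & last x t = y].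

Lemma pathsys_all A ps : pathsys ps -> {subset flatten ps <= A} ->
  all (fun p => ends A p && sorted (@adj G) p) ps.
Proof.
move=> /andP[h _] sA; apply/allP => p pin; have /andP[p0 ->] := allP h _ pin.
by rewrite andbT ends_sub // => x xp; apply: sA; apply/flattenP; exists p.
Qed.

Lemma uniq_alt A B ps qs : [disjoint A & B] -> pathsys ps -> pathsys qs ->
  {subset flatten ps <= A} -> {subset flatten qs <= B} -> uniq (alt ps qs).
Proof.
move=> d /andP[_ u1] /andP[_ u2] s1 s2; rewrite (perm_uniq (perm_alt _ _)) cat_uniq u1 u2 andbT /=.
rewrite -all_predC; apply/allP => x /s2 xB; apply/negP => /s1 xA.
by move/pred0P/(_ x): d; rewrite /= xA xB.
Qed.

Lemma mem_alt ps qs x : (x \in alt ps qs) = (x \in flatten ps) || (x \in flatten qs).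
Proof. by rewrite (perm_mem (perm_alt _ _)) mem_cat. Qed.

Lemma hpath_alt A B C1 C2 ps qs x y : full A B -> [disjoint A & B] ->
  pathsys ps -> pathsys qs -> {subset flatten ps <= A} -> {subset flatten qs <= B} ->
  {subset C1 <= flatten ps} -> {subset C2 <= flatten qs} ->
  0 < size ps -> size qs <= size ps <= (size qs).+1 -> head y (flatten ps) = x ->
  (if size qs < size ps then last x (flatten ps) else last x (flatten qs)) = y ->
  hpath (A :|: B) (C1 :|: C2) x y.
Proof.
move=> fAB dAB P1 P2 s1 s2 c1 c2 l0 l1 hx ly.
have [x' [t [E1 E2 E3 E4 [E5 E6]]]] :=
  alt_sorted x fAB (pathsys_all P1 s1) (pathsys_all P2 s2) l0 l1.
have E : x' = x.
  by rewrite E3 -hx; apply: head_default; apply: flatten_neq0.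
rewrite {x' E3}E in E1 E2 E4 E5 E6; exists t; rewrite -E1; split=> //.
- exact: uniq_alt dAB P1 P2 s1 s2.
- move=> z; rewrite mem_alt inE => /orP[/s1->//|/s2->]; exact: orbT.
- by move=> z; rewrite mem_alt inE => /orP[/c1->//|/c2->]; rewrite orbT.
- by rewrite E5.
Qed.

Lemma hpath_AA A S CA CS x y k : full A S -> [disjoint A & S] ->
  ecov2 A CA x y k -> cov S CS k.-1 -> hpath (A :|: S) (CA :|: CS) x y.
Proof.
move=> f d [ps [<- a2 a3 a4 [a5 a6 a7]]] [qs [b1 b2 b3 b4]].
apply: (hpath_alt f d a2 b2) => //; first lia.
  by rewrite b1; lia.
by rewrite b1 ifT //; lia.
Qed.

Lemma pathsys_rev ps : pathsys ps -> pathsys (rev (map rev ps)).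
Proof.
move=> /andP[h u]; apply/andP; split.
  rewrite all_rev all_map; apply: sub_all h => p /andP[p0 sp] /=.
  by rewrite sorted_rev_adj sp -size_eq0 size_rev size_eq0 p0.
suff -> : flatten (rev (map rev ps)) = rev (flatten ps) by rewrite rev_uniq.
by elim: (ps) => //= p l IH; rewrite rev_cons flatten_rcons IH rev_cat.
Qed.

Lemma flatten_rev ps : flatten (rev (map rev ps)) = rev (flatten ps).
Proof. by elim: ps => //= p l IH; rewrite rev_cons flatten_rcons IH rev_cat. Qed.

Lemma hpath_AS A S CA CS x y k : full A S -> [disjoint A & S] ->
  ecov1 A CA x k -> ecov1 S CS y k -> hpath (A :|: S) (CA :|: CS) x y.
Proof.
move=> f d [ps [<- a2 a3 a4 [a5 a6]]] [qs [b1 b2 b3 b4 [b5 b6]]].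
(* [ecov1] puts [y] at the start of its system, so the whole system is reversed to make [y] the
   final vertex. *)
apply: (hpath_alt (ps := ps) (qs := rev (map rev qs)) f d a2 (pathsys_rev b2)) => //.
- by move=> z; rewrite flatten_rev mem_rev => /b3.
- by move=> z; rewrite flatten_rev mem_rev => /b4.
- by rewrite size_rev size_map b1 leqnn /=.
- by rewrite (head_default _ x) // flatten_neq0.
- rewrite size_rev size_map b1 ltnn flatten_rev -b5.
  have : flatten qs != [::] by apply: flatten_neq0 => //; rewrite b1.
  by case: (flatten qs) => //= z l _; rewrite rev_cons last_rcons.
Qed.

Lemma hpath_sym W C x y : hpath W C x y -> hpath W C y x.
Proof.
move=> [t [t1 t2 t3 t4 <-]]; exists (rev (belast x t)).
have E : last x t :: rev (belast x t) = rev (x :: t) by rewrite [in RHS]lastI rev_rcons.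
rewrite E; split.
- by rewrite rev_path; apply: sub_path t1 => u v; rewrite adj_sym.
- by rewrite rev_uniq.
- by move=> z; rewrite mem_rev => /t3.
- by move=> z /t4; rewrite mem_rev.
- by case: (t) => //= u l; rewrite rev_cons last_rcons.
Qed.

Definition hconn W C := forall x y, x \in W -> y \in W -> x != y -> hpath W C x y.

(** Prescribing an end may cost one more path, but there are never more paths than vertices; hence
    the [minn]. *)
Lemma ecov1_card A C w a k : cov A C a -> w \in A -> minn a.+1 #|A| <= k <= #|A| -> ecov1 A C w k.
Proof.
move=> c wA lk; have [k' [l1 l2 e]] := ecov1_pred c wA.
by apply: ecov1_mono e _; lia.
Qed.

Lemma ecov2_card A C x y a k : cov A C a -> x \in A -> y \in A -> x != y ->
  minn a.+2 #|A| <= k <= #|A| -> ecov2 A C x y k.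
Proof.
move=> c xA yA nxy lk; have [k' [l1 l2 e]] := ecov1_pred c xA.
have [k'' [l3 l4 e']] := ecov2_pred e nxy yA.
by apply: ecov2_mono e' _; lia.
Qed.

Lemma card2 x y A : x \in A -> y \in A -> x != y -> 1 < #|A|.
Proof. by move=> xA yA n; apply/card_gt1P; exists x, y. Qed.

(** The two strict inequalities pay for the additional paths caused by prescribing both ends. *)
Lemma hconn_join A S CA CS a s : full A S -> [disjoint A & S] ->
  cov A CA a -> cov S CS s -> a < #|S| -> s < #|A| -> hconn (A :|: S) (CA :|: CS).
Proof.
have AA A' S' CA' CS' a' s' x y : full A' S' -> [disjoint A' & S'] ->
  cov A' CA' a' -> cov S' CS' s' -> a' < #|S'| -> s' < #|A'| ->
  x \in A' -> y \in A' -> x != y -> hpath (A' :|: S') (CA' :|: CS') x y.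
  move=> f d cA cS la ls xA yA nxy; have := card2 xA yA nxy; have := cov_size cS => l1 l2.
  (* This is the largest number of paths in [A'] that can be interleaved with one path fewer in
     [S']. *)
  apply: (hpath_AA f d (ecov2_card (k := minn #|S'|.+1 #|A'|) cA xA yA nxy _)); first lia.
  by apply: cov_mono cS _; lia.
have AS A' S' CA' CS' a' s' x y : full A' S' -> [disjoint A' & S'] ->
  cov A' CA' a' -> cov S' CS' s' -> a' < #|S'| -> s' < #|A'| ->
  x \in A' -> y \in S' -> hpath (A' :|: S') (CA' :|: CS') x y.
  move=> f d cA cS la ls xA yA.
  apply: (hpath_AS f d (ecov1_card (k := minn #|S'| #|A'|) cA xA _) (ecov1_card cS yA _)); lia.
move=> f d cA cS la ls x y; rewrite !inE => /orP[xA|xS] /orP[yA|yS] nxy.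
- exact: AA f d cA cS la ls xA yA nxy.
- exact: AS f d cA cS la ls xA yS.
- exact/hpath_sym/(AS _ _ _ _ _ _ _ _ f d cA cS la ls yA xS).
- rewrite setUC (setUC CA); apply: AA (fullC f) _ cS cA ls la xS yS nxy.
  by rewrite disjoint_sym.
Qed.

Lemma hpath_cov W x y : hpath W W x y -> cov W W 1.
Proof.
move=> [t [t1 t2 t3 t4 _]]; exists [:: x :: t]; split=> //.
- by rewrite /pathsys /= t1 cats0.
- by rewrite /= cats0.
- by rewrite /= cats0.
Qed.

(* The vertices of [J] are inserted one by one between the first [#|J| + 1] paths. *)
Lemma chain A J a : full A J -> [disjoint A & J] -> cov A A a -> #|J| < a ->
  exists qs, [/\ size qs = a - #|J|, pathsys qs, all (ends A) qs &
    flatten qs =i A :|: J].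
Proof.
move=> f d [ps [<- h2 h3 h4]] lj.
have /andP[aP uP] := h2.
pose j := #|J|; pose js := [seq [:: x] | x <- enum J].
have Ej : flatten js = enum J by rewrite /js; elim: (enum J) => //= x l ->.
have sj : size js = j by rewrite size_map -cardE.
have P1 : pathsys (take j.+1 ps).
  move: h2; rewrite -{1}(cat_take_drop j.+1 ps) /pathsys all_cat flatten_cat cat_uniq.
  by case/andP=> /andP[-> _] /and3P[->].
have s1 : {subset flatten (take j.+1 ps) <= A}.
  by move=> x xin; apply: h3; rewrite -(cat_take_drop j.+1 ps) flatten_cat mem_cat xin.
have P2 : pathsys js.
  by rewrite /pathsys Ej enum_uniq andbT all_map; apply/allP.
have s2 : {subset flatten js <= J} by move=> x; rewrite Ej mem_enum.
have st : size (take j.+1 ps) = j.+1 by rewrite size_takel.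
have [x0 _] : exists x0, x0 \in A.
  case: (ps) lj h3 aP => // -[|x p] l _ h _ //; exists x; apply: h; exact: mem_head.
have [||x [t [E1 E2 E3 E4 [E5 E6]]]] :=
  alt_sorted x0 f (pathsys_all P1 s1) (pathsys_all P2 s2); first by rewrite st.
  by rewrite st sj leqnSn leqnn.
have lA : last x t \in A.
  rewrite E5 st sj ltnSn; apply: s1.
  have n : flatten (take j.+1 ps) != [::] by apply: flatten_neq0 => //; rewrite st.
  by case: (flatten _) n => //= u l _; exact: mem_last.
have pe : perm_eq (flatten ((x :: t) :: drop j.+1 ps)) (flatten ps ++ enum J).
  rewrite -E1 /= -{3}(cat_take_drop j.+1 ps) flatten_cat.
  apply: (@perm_trans _ ((flatten (take j.+1 ps) ++ enum J) ++ flatten (drop j.+1 ps))).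
    by rewrite perm_cat2r -Ej perm_alt.
  by rewrite -!catA perm_cat2l perm_catC.
exists ((x :: t) :: drop j.+1 ps); split.
- by rewrite /= size_drop subnSK.
- rewrite /pathsys (perm_uniq pe) cat_uniq uP enum_uniq andbT /= E2 /=.
  apply/andP; split; last first.
    rewrite -all_predC; apply/allP => y; rewrite mem_enum /= => yJ; apply/negP => /h3 yA.
    exact: (disjointP _ _ d) yA yJ.
  by apply/allP => p pin; apply: (allP aP); apply: mem_drop pin.
- rewrite /= E4 lA; apply/allP => p pin.
  by have /andP[] := allP (pathsys_all h2 h3) p (mem_drop pin).
- move=> y; rewrite (perm_mem pe) mem_cat mem_enum inE; congr (_ || _).
  by apply/idP/idP => [/h3|/h4].
Qed.

Lemma cov_union A B CA CB a b : [disjoint A & B] -> cov A CA a -> cov B CB b ->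
  cov (A :|: B) (CA :|: CB) (a + b).
Proof.
move=> d [ps [<- p2 p3 p4]] [qs [<- q2 q3 q4]]; exists (ps ++ qs).
have /andP[a1 u1] := p2; have /andP[a2 u2] := q2.
rewrite size_cat flatten_cat; split=> //.
- rewrite /pathsys all_cat a1 a2 flatten_cat cat_uniq u1 u2 /= !andbT.
  rewrite -all_predC; apply/allP => x /q3 xB; apply/negP => /p3 xA; exact: (disjointP _ _ d) xA xB.
- by move=> x; rewrite mem_cat inE => /orP[/p3->|/q3->]; rewrite ?orbT.
- by move=> x; rewrite mem_cat inE => /orP[/p4->|/q4->]; rewrite ?orbT.
Qed.

End Ham.

Lemma connect_cross (T : finType) (e : rel T) (P : pred T) u x :
  connect e u x -> P u -> ~~ P x -> exists a b, [/\ connect e u a, e a b, P a & ~~ P b].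
Proof.
case/connectP=> p; elim: p u => [|y p IH] u /=; first by move=> _ -> ->.
move=> /andP[uy yp] E Pu nPx; case: (boolP (P y)) => [Py|nPy]; last by exists u, y.
have [a [b [h1 h2 h3 h4]]] := IH y yp E Py nPx.
by exists a, b; split=> //; apply: connect_trans (connect1 uy) h1.
Qed.

(** * P_4-free graphs *)

Section Seinsche.
Variable T : finType.
Implicit Types (r : rel T) (A B D K : {set T}).

Definition p4 r a b c d := [&& r a b, r b c, r c d, ~~ r a c, ~~ r b d & ~~ r a d].

Definition p4_free r D :=
  forall a b c d, a \in D -> b \in D -> c \in D -> d \in D -> ~~ p4 r a b c d.

Definition parts D A B := [/\ A != set0, B != set0, [disjoint A & B] & A :|: B = D].

Definition rsplit r D := exists A B, parts D A B /\ {in A & B, forall x y, ~~ r x y}.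

Definition compl r : rel T := fun x y => (x != y) && ~~ r x y.

Lemma compl_sym r : symmetric r -> symmetric (compl r).
Proof. by move=> h x y; rewrite /compl h eq_sym. Qed.

Lemma complK r : irreflexive r -> compl (compl r) =2 r.
Proof.
by move=> h x y; rewrite /compl; case: eqVneq => [->|] //=; rewrite ?h ?negbK.
Qed.

(** [P_4] is self-complementary: a path [a b c d] of the complement is the path [b d a c] of [r]. *)
Lemma p4_compl r D : symmetric r -> irreflexive r -> p4_free r D -> p4_free (compl r) D.
Proof.
move=> sr ir h a b c d aD bD cD dD; apply/negP; rewrite /p4 /compl.
case/and5P=> /andP[nab ab] /andP[nbc bc] /andP[ncd cd] ac /andP[bd ad].
have Eac : r a c.
  move: ac; rewrite negb_and !negbK => /orP[/eqP E|//].
  by move: ad; rewrite E ncd cd.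
have Ebd : r b d.
  move: bd; rewrite negb_and !negbK => /orP[/eqP E|//].
  by move: ad; rewrite -E nab ab.
have Ead : r a d.
  move: ad; rewrite negb_and !negbK => /orP[/eqP E|//].
  by move: Ebd; rewrite -E sr (negbTE ab).
have := h b d a c bD dD aD cD; rewrite /p4 Ebd (sr d a) Ead Eac (sr b a) ab (sr d c) cd.
by rewrite bc.
Qed.

(** If [v] is complete to [D], the complement splits. Otherwise let [K] be the component of a
    non-neighbour [u] of [v]. If [v] has no neighbour in [K], then [K] splits off. If it has one,
    [K] contains an edge [b a] with only [a] adjacent to [v], and a neighbour [c] of [v] outside [K]
    would give the induced path [c v a b]; so [v |: K] splits off. *)
Lemma rsplit_add r D v : symmetric r -> v \notin D -> p4_free r (v |: D) ->
  rsplit r D -> rsplit r (v |: D) \/ rsplit (compl r) (v |: D).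
Proof.
move=> sr vD pf [A [B [[A0 B0 dAB EAB] nAB]]].
case: (boolP [forall x in D, r v x]) => [/forall_inP fv|].
  right; exists [set v], D; split.
    split=> //; first by apply/set0Pn; exists v; rewrite inE.
      by case/set0Pn: A0 => x xA; apply/set0Pn; exists x; rewrite -EAB inE xA.
    by rewrite disjoints1.
  by move=> x y; rewrite inE => /eqP-> yD; rewrite /compl fv // andbF.
rewrite negb_forall => /existsP[u]; rewrite negb_imply => /andP[uD nvu]; left.
pose e : rel T := fun x y => [&& r x y, x \in D & y \in D].
pose K := [set x | connect e u x].
have uK : u \in K by rewrite inE connect0.
have stay C C' : C :|: C' = D -> {in C & C', forall x y, ~~ r x y} -> u \in C -> K \subset C.
  move=> E n uC; apply/subsetP => x; rewrite inE => cx; apply/negPn/negP => nx.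
  have [a [b [_ /and3P[rab aD bD] aC bC]]] := connect_cross (P := mem C) cx uC nx.
  have bC' : b \in C' by move: bD; rewrite -E inE => /orP[h|//]; case/negP: bC.
  by move: (n a b aC bC'); rewrite rab.
have KD : K \subset D.
  by apply: (stay D set0); rewrite ?setU0 // => x y; rewrite inE.
have DK : D :\: K != set0.
  have [uA|uB] : u \in A \/ u \in B by apply/orP; rewrite -in_setU EAB.
    have KA := stay A B EAB nAB uA; case/set0Pn: B0 => x xB; apply/set0Pn; exists x.
    have xD : x \in D by rewrite -EAB inE xB orbT.
    rewrite in_setD xD andbT; apply/negP => /(subsetP KA) xA.
    exact: (disjointP _ _ dAB) xA xB.
  have KB : K \subset B.
    by apply: (stay B A); rewrite ?(setUC B) // => x y xB yA; rewrite sr nAB.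
  case/set0Pn: A0 => x xA; apply/set0Pn; exists x.
  have xD : x \in D by rewrite -EAB inE xA.
  rewrite in_setD xD andbT; apply/negP => /(subsetP KB) xB.
  exact: (disjointP _ _ dAB) xA xB.
have nK : {in K & D :\: K, forall x y, ~~ r x y}.
  move=> x y xK; rewrite in_setD => /andP[yK yD]; apply: contra yK => rxy.
  have := xK; rewrite !inE => cx; apply: connect_trans cx (connect1 _).
  by rewrite /e rxy yD (subsetP KD).
case: (boolP [exists x in K, r v x]) => [/exists_inP[x xK rvx]|]; last first.
  rewrite negb_exists => /forallP nv.
  exists K, (v |: (D :\: K)); split.
    split; first by apply/set0Pn; exists u.
    - by apply/set0Pn; exists v; rewrite !inE eqxx.
    - apply/disjointP => z zK; rewrite !inE => /orP[/eqP E|/andP[/negP]]; last by rewrite inE in zK.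
      by move: vD; rewrite -E (subsetP KD).
    - by rewrite setUCA; congr (_ :|: _); rewrite setDE setUIr setUCr setIT; apply/setUidPr.
  move=> z w zK; rewrite inE => /orP[|wD]; last by apply: nK.
  by rewrite inE => /eqP->; rewrite sr; move: (nv z); rewrite zK.
have [b [a [cb /and3P[rba bD aD] nvb]]] : exists b a, [/\ connect e u b, e b a, ~~ r v b & r v a].
  have cx : connect e u x by rewrite inE in xK.
  have [|b [a [h1 h2 h3 h4]]] := connect_cross (P := fun z => ~~ r v z) cx nvu.
    by rewrite rvx.
  by exists b, a; split=> //; apply: negbNE.
move=> va.
have aK : a \in K by rewrite inE; apply: connect_trans cb (connect1 _); apply/and3P.
have bK : b \in K by rewrite inE.
exists (v |: K), (D :\: K); split.
  split=> //; first by apply/set0Pn; exists u; rewrite !inE connect0 orbT.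
  - apply/disjointP => z; rewrite !inE => /orP[/eqP->|->//].
    by rewrite (negbTE vD) andbF.
  - by rewrite -setUA; congr (_ :|: _); rewrite setDE setUIr setUCr setIT; apply/setUidPr.
move=> z c; rewrite inE => /orP[|zK]; last by apply: nK.
rewrite inE => /eqP-> cD; apply/negP => vc.
have cD' : c \in D by move: cD; rewrite inE => /andP[].
have := pf c v a b; rewrite !inE eqxx cD' aD bD !orbT => /(_ isT isT isT isT).
rewrite /p4 (sr c v) vc va (sr a b) rba nvb.
by rewrite (sr c a) (negbTE (nK a c aK cD)) (sr c b) (negbTE (nK b c bK cD)).
Qed.

Lemma rsplit_ext r r' D : r =2 r' -> rsplit r D -> rsplit r' D.
Proof. by move=> h [A [B [p n]]]; exists A, B; split=> // x y xA yB; rewrite -h n. Qed.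

Lemma p4_sub r A D : A \subset D -> p4_free r D -> p4_free r A.
Proof. by move=> /subsetP s h a b c d *; apply: h; apply: s. Qed.

(** Seinsche's theorem. A vertex is removed; when the rest splits in the complement, [rsplit_add] is
    applied to the complement. *)
Lemma seinsche r D : symmetric r -> irreflexive r -> p4_free r D -> 1 < #|D| ->
  rsplit r D \/ rsplit (compl r) D.
Proof.
move=> sr ir; have [n] := ubnP #|D|; elim: n D => // n IH D ltn pf D1.
have [v vD] : exists v, v \in D by apply/card_gt0P; lia.
have E := setD1K vD; have cD := cardsD1 v D; rewrite vD in cD.
case: (ltnP 1 #|D :\ v|) => l.
  have pf' : p4_free r (D :\ v) by apply: p4_sub pf; apply: subD1set.
  have nv : v \notin D :\ v by rewrite !inE eqxx.
  have lt' : #|D :\ v| < n by lia.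
  have pf1 : p4_free r (v |: D :\ v) by rewrite E.
  have [h|h] := IH _ lt' pf' l; first by have := rsplit_add sr nv pf1 h; rewrite E.
  have pf2 : p4_free (compl r) (v |: D :\ v) by rewrite E; apply: p4_compl.
  have := rsplit_add (compl_sym sr) nv pf2 h; rewrite E => -[h'|h']; first by right.
  by left; apply: rsplit_ext h'; apply: complK.
have [w Ew] : exists w, D :\ v = [set w] by apply/cards1P; rewrite eqn_leq l; lia.
have nvw : v != w.
  have : w \in D :\ v by rewrite Ew inE.
  by rewrite !inE eq_sym => /andP[].
have p : parts D [set v] [set w].
  split; try (by apply/set0Pn; eexists; rewrite inE).
    by rewrite disjoints1 inE.
  by rewrite -Ew.
case: (boolP (r v w)) => vw; [right | left]; exists [set v], [set w]; split=> // x y;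
  rewrite !inE => /eqP-> /eqP-> //.
by rewrite /compl vw andbF.
Qed.

End Seinsche.

(** The vertices of [X] cut the path into at most one segment more than their number, and [f] is
    constant on each segment. *)
Lemma label_path (T U : finType) (f : T -> U) (X : {set T}) (r : rel T) x p :
  path r x p -> {in x :: p &, forall y z, r y z -> y \notin X -> z \notin X -> f y = f z} ->
  #|f @: [set y in x :: p | y \notin X]| <= (count [in X] p).+1.
Proof.
elim: p x => [|y p IH] x.
  move=> _ _; apply: leq_trans (leq_imset_card _ _) _; rewrite -(cards1 x).
  by apply: subset_leq_card; apply/subsetP => z; rewrite !inE => /andP[].
rewrite [path _ _ _]/= => /andP[rxy yp] h.
have {}IH : #|f @: [set z in y :: p | z \notin X]| <= (count [in X] p).+1.
  by apply: IH yp _ => u v uin vin; apply: h; rewrite in_cons ?uin ?vin orbT.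
have E : [set z in x :: y :: p | z \notin X] =
    (if x \in X then set0 else [set x]) :|: [set z in y :: p | z \notin X].
  apply/setP => z; rewrite !inE; case: (boolP (x \in X)) => xX; rewrite ?inE.
    by case: eqVneq => [->|] //=; rewrite xX !andbF.
  by case: eqVneq => [->|].
rewrite E imsetU /=; case: (boolP (x \in X)) => xX; first by rewrite imset0 set0U; apply: leq_trans IH _; rewrite ltnS leq_addl.
rewrite imset_set1; case: (boolP (y \in X)) => yX.
  by apply: leq_trans (cardsU_le _ _) _; rewrite cards1 /= !add1n ltnS.
have -> : [set f x] :|: f @: [set z in y :: p | z \notin X] = f @: [set z in y :: p | z \notin X].
  apply/setUidPr; rewrite sub1set; apply/imsetP; exists y; first by rewrite !inE eqxx yX.
  by apply: h; rewrite ?inE ?eqxx ?orbT.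
by apply: leq_trans IH _; rewrite ltnS leq_addl.
Qed.

Lemma count_card (T : finType) (X : {set T}) (s : seq T) : uniq s -> count [in X] s <= #|X|.
Proof.
move=> us; rewrite -size_filter -(card_uniqP (filter_uniq _ us)).
by apply: subset_leq_card; apply/subsetP => x; rewrite mem_filter => /andP[].
Qed.

(** * Path cover numbers of P_4-free graphs *)

Section Duality.
Variable G : sgraph.
Implicit Types (A B C D E L M S T W X Y Z : {set G}) (x y z w : G).
Implicit Types (p q : seq G) (ps qs : seq (seq G)).

Definition p4f D := p4_free (@adj G) D.
Definition splits D A B := parts D A B /\ anti A B.
Definition joins D A B := parts D A B /\ full A B.
Definition splittable D := exists A B, splits D A B.
Definition joinable D := exists A B, joins D A B.

Lemma parts_sym D A B : parts D A B -> parts D B A.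
Proof. by case=> h1 h2 h3 h4; split; rewrite // 1?disjoint_sym // setUC. Qed.

Lemma splits_sym D A B : splits D A B -> splits D B A.
Proof. by case=> /parts_sym h /antiC. Qed.

Lemma joins_sym D A B : joins D A B -> joins D B A.
Proof. by case=> /parts_sym h /fullC. Qed.

Lemma parts_card D A B : parts D A B -> [/\ #|A| + #|B| = #|D|, 0 < #|A| & 0 < #|B|].
Proof.
by case=> h1 h2 d <-; rewrite cardsUd // !card_gt0.
Qed.

Lemma parts_sub D A B : parts D A B -> A \subset D /\ B \subset D.
Proof. by case=> _ _ _ <-; rewrite subsetUl subsetUr. Qed.

Lemma cographP D : p4f D -> 1 < #|D| -> splittable D \/ joinable D.
Proof.
move=> pf D1; case: (seinsche (@adj_sym G) (@adj_irr G) pf D1) => [[A [B [p n]]]|[A [B [p n]]]].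
  by left; exists A, B.
right; exists A, B; split=> // x y xA yB; have := n x y xA yB.
rewrite /compl negb_and !negbK => /orP[/eqP E|//].
by case: p => _ _ /disjointP/(_ x xA) + _; rewrite E => /(_ yB).
Qed.

(** A vertex of [N] in [A] forces [B] into [N]; a vertex of [M], being complete to [N], then fits
    neither into [A] nor into [B]. *)
Lemma split_join D : splittable D -> joinable D -> False.
Proof.
move=> [A [B [[A0 B0 _ EAB] nAB]]] [N [M [[N0 M0 _ ENM] fNM]]].
have key A' B' N' M' n : A' :|: B' = D -> anti A' B' -> N' :|: M' = D -> full N' M' ->
    B' != set0 -> M' != set0 -> n \in N' -> n \in A' -> False.
  move=> EAB' nAB' ENM' fNM' B0' M0' nN nA.
  have BN y : y \in B' -> y \in N'.
    move=> yB; have : y \in D by rewrite -EAB' inE yB orbT.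
    rewrite -ENM' inE => /orP[//|yM]; have := nAB' n y nA yB.
    by rewrite fNM'.
  case/set0Pn: B0' => y yB; case/set0Pn: M0' => m mM.
  have : m \in D by rewrite -ENM' inE mM orbT.
  rewrite -EAB' inE => /orP[mA|mB].
    by have := nAB' m y mA yB; rewrite adj_sym fNM' // BN.
  by have := nAB' n m nA mB; rewrite fNM'.
case/set0Pn: N0 => n nN; have : n \in D by rewrite -ENM inE nN.
rewrite -EAB inE => /orP[nA|nB]; first exact: key EAB nAB ENM fNM B0 M0 nN nA.
by apply: (key B A N M n) => //; [rewrite setUC | apply: antiC].
Qed.

Lemma p4f_sub A D : A \subset D -> p4f D -> p4f A.
Proof. exact: p4_sub. Qed.

(* A labelling that is constant on the components of [D - X] and takes at least [k + |X|] values; working with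
   labels avoids counting components. *)
Definition tight D k := exists X (f : G -> G), [/\ X \subset D,
  {in D :\: X, forall x, f x \in D},
  {in D :\: X &, forall x y, adj x y -> f x = f y} & k + #|X| <= #|f @: (D :\: X)| ].

Lemma tight_le D k k' : k' <= k -> tight D k -> tight D k'.
Proof. by move=> l [X [f [h1 h2 h3 h4]]]; exists X, f; split=> //; lia. Qed.

Lemma tight1 D : D != set0 -> tight D 1.
Proof.
case/set0Pn=> d dD; exists set0, (fun=> d); split=> //; first exact: sub0set.
by rewrite cards0 setD0 addn0 card_gt0; apply/set0Pn; exists d; apply/imsetP; exists d.
Qed.

Lemma tight0 D : tight D 0.
Proof.
have [->|D0] := eqVneq D set0; last exact: tight_le (tight1 D0).
by exists set0, id; rewrite cards0; split=> // x; rewrite ?inE.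
Qed.

(* Each of the [k] paths loses at most one label per vertex of [X] on it. *)
Lemma weak_duality D k k' : cov D D k -> tight D k' -> k' <= k.
Proof.
move=> [ps [<- /andP[h u] s c]] [X [f [XD fD fe l]]].
suff : #|f @: (D :\: X)| <= size ps + count [in X] (flatten ps).
  by have := count_card X u; lia.
have -> : D :\: X = [set y in flatten ps | y \notin X].
  by apply/setP => y; rewrite !inE andbC; congr (_ && _); apply/idP/idP => [/c|/s].
have {}s : {subset flatten ps <= D} := s; clear c u l.
elim: ps h s => [|p ps IH] /=.
  have -> : [set y in [::] | y \notin X] = set0 by apply/setP => y; rewrite !inE.
  by rewrite imset0 cards0.
move=> /andP[/andP[p0 sp] aps] s.
have -> : [set y in p ++ flatten ps | y \notin X] =
    [set y in p | y \notin X] :|: [set y in flatten ps | y \notin X].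
  by apply/setP => y; rewrite !inE mem_cat andb_orl.
rewrite imsetU count_cat; apply: leq_trans (cardsU_le _ _) _.
have {}IH : #|f @: [set y in flatten ps | y \notin X]| <= size ps + count [in X] (flatten ps).
  by apply: IH => // y yin; apply: s; rewrite mem_cat yin orbT.
suff : #|f @: [set y in p | y \notin X]| <= (count [in X] p).+1 by lia.
case: p p0 sp s => // x p _ sp s.
apply: leq_trans (label_path (r := @adj G) sp _) _; last by rewrite /=; lia.
move=> y z yin zin yz yX zX; apply: fe => //; rewrite inE ?yX ?zX s // mem_cat ?yin ?zin //.
Qed.

(** Here the clause [f x \in D] of [tight] is used: labels of the two sides are different vertices,
    so their numbers add up. *)
Lemma tight_union D A B a b : splits D A B -> tight A a -> tight B b -> tight D (a + b).
Proof.
move=> [[A0 B0 dAB EAB] nAB] [X [f [XA fA fe la]]] [Y [g [YB gB ge lb]]].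
have dA x : x \in B -> x \notin A by move=> xB; apply/negP => xA; apply: (disjointP _ _ dAB) xA xB.
have dB x : x \in A -> x \notin B by move=> xA; apply/negP => xB; apply: (disjointP _ _ dAB) xA xB.
have dX x : x \in B -> x \notin X by move/dA; apply: contra; apply: (subsetP XA).
have dY x : x \in A -> x \notin Y by move/dB; apply: contra; apply: (subsetP YB).
pose h x := if x \in A then f x else g x.
have E : D :\: (X :|: Y) = (A :\: X) :|: (B :\: Y).
  apply/setP => x; rewrite -EAB !inE; case: (boolP (x \in A)) => xA /=.
    by rewrite (negbTE (dY _ xA)) (negbTE (dB _ xA)) !andbF !orbF !andbT.
  by case: (boolP (x \in B)) => xB; rewrite ?(negbTE (dX _ xB)) ?andbF.
have hA : {in A :\: X, h =1 f} by move=> x; rewrite inE /h => /andP[_ ->].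
have hB : {in B :\: Y, h =1 g} by move=> x; rewrite inE /h => /andP[_ /dA/negbTE->].
exists (X :|: Y), h; rewrite E; split.
- by rewrite -EAB setUSS.
- move=> x; rewrite -EAB !in_setU => /orP[xA|xB]; first by rewrite hA // fA.
  by rewrite hB // gB // orbT.
- have nab x y : x \in A :\: X -> y \in B :\: Y -> ~~ adj x y.
    by rewrite !in_setD => /andP[_ xA] /andP[_ yB]; apply: nAB.
  move=> x y; rewrite !in_setU => /orP[xA|xB] /orP[yA|yB] xy.
  + by rewrite !hA //; apply: fe.
  + by move: (nab x y xA yB); rewrite xy.
  + by move: (nab y x yA xB); rewrite adj_sym xy.
  + by rewrite !hB //; apply: ge.
rewrite imsetU (eq_in_imset hA) (eq_in_imset hB).
have d : [disjoint f @: (A :\: X) & g @: (B :\: Y)].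
  apply/disjointP => z /imsetP[x xA ->] /imsetP[y yB E'].
  by apply: (disjointP _ _ dAB) (fA _ xA) _; rewrite E' gB.
rewrite (cardsUd d).
have l : #|X :|: Y| <= #|X| + #|Y| := cardsU_le X Y.
lia.
Qed.

(* Deleting [B] as well costs [#|B|] vertices and leaves the components of [A]. *)
Lemma tight_join D A B a : parts D A B -> #|B| <= a -> tight A a ->
  tight D (a - #|B|).
Proof.
move=> p lB [X [f [XA fA fe la]]]; have [AD BD] := parts_sub p; case: p => _ _ dAB EAB.
have E : D :\: (X :|: B) = A :\: X.
  apply/setP => x; rewrite -EAB !inE; case: (boolP (x \in B)) => xB; rewrite ?orbT ?orbF //=.
  by apply/esym/negbTE/negP => /andP[_ xA]; apply: (disjointP _ _ dAB) xA xB.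
exists (X :|: B), f; rewrite E; split=> //.
- by rewrite subUset BD (subset_trans XA AD).
- by move=> x xA; rewrite (subsetP AD) // fA.
by have := cardsU_le X B; lia.
Qed.

(** Minimality is certified by the dual obstruction instead of being stated: [weak_duality] makes
    [k] the minimum, and toughness can be applied to the obstruction. *)
Definition path_number D k := cov D D k /\ tight D k.

Lemma path_number_uniq D k k' : path_number D k -> path_number D k' -> k = k'.
Proof. by move=> [c t] [c' t']; apply/eqP; rewrite eqn_leq !(weak_duality (D := D)). Qed.

Lemma hpath_join A S CA CS k : full A S -> [disjoint A & S] -> cov A CA k -> cov S CS k -> 0 < k ->
  exists x y, [/\ x \in A, y \in S & hpath (A :|: S) (CA :|: CS) x y].
Proof.
move=> f d [ps [sp p2 p3 p4]] [qs [sq q2 q3 q4]] k0.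
have n1 : flatten ps != [::] by apply: flatten_neq0; rewrite ?sp.
have n2 : flatten qs != [::] by apply: flatten_neq0; rewrite ?sq.
have [x [s Ex]] : exists x s, flatten ps = x :: s by case: (flatten ps) n1 => // x s; exists x, s.
have [y [t Ey]] : exists y t, flatten qs = rcons t y.
  by case/lastP: (flatten qs) n2 => // t y; exists y, t.
exists x, y; split; first by apply: p3; rewrite Ex mem_head.
  by apply: q3; rewrite Ey mem_rcons mem_head.
apply: (hpath_alt f d p2 q2) => //; rewrite ?sp ?sq ?leqnn ?leqnSn //.
  by rewrite Ex.
by rewrite ltnn Ey last_rcons.
Qed.

Lemma chain_cov A J a : full A J -> [disjoint A & J] -> cov A A a -> #|J| < a ->
  cov (A :|: J) (A :|: J) (a - #|J|).
Proof.
by move=> f d c l; have [qs [h1 h2 h3 h4]] := chain f d c l; exists qs; split=> // x; rewrite h4.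
Qed.

Lemma cov_join1 D A B a b : joins D A B -> cov A A a -> cov B B b -> a <= #|B| -> b <= #|A| ->
  cov D D 1.
Proof.
move=> [p f] ca cb la lb; have [c1 c2 c3] := parts_card p; case: p => A0 B0 d <-.
have [l1 l2] := (cov_size ca, cov_size cb).
have k0 : 0 < maxn 1 (maxn a b) by lia.
have c1' : cov A A (maxn 1 (maxn a b)) by apply: cov_mono ca _; lia.
have c2' : cov B B (maxn 1 (maxn a b)) by apply: cov_mono cb _; lia.
by have [x [y [_ _ /hpath_cov]]] := hpath_join f d c1' c2' k0.
Qed.

Lemma path_number_single D : #|D| = 1 -> path_number D 1.
Proof.
move=> D1; split; last by apply: tight1; rewrite -card_gt0 D1.
by rewrite -D1; apply: cov_singles.
Qed.

Lemma path_number_union D A B a b : splits D A B -> path_number A a -> path_number B b -> path_number D (a + b).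
Proof.
move=> s [ca ta] [cb tb]; split; last exact: tight_union s ta tb.
by case: s => -[_ _ d <-] _; apply: cov_union.
Qed.

Lemma path_number_join D A B a b : joins D A B -> path_number A a -> path_number B b ->
  [\/ #|B| < a /\ path_number D (a - #|B|), #|A| < b /\ path_number D (b - #|A|) |
      [/\ a <= #|B|, b <= #|A| & path_number D 1]].
Proof.
have chain_pcn A' B' a' : joins D A' B' -> #|B'| < a' -> path_number A' a' -> path_number D (a' - #|B'|).
  move=> [p f] l [c t]; split; last by apply: tight_join p _ t; apply: ltnW.
  by case: p => _ _ d <-; apply: chain_cov.
move=> j pa pb; case: (ltnP #|B| a) => la.
  by apply: Or31; split=> //; apply: chain_pcn j la pa.
case: (ltnP #|A| b) => lb.
  by apply: Or32; split=> //; apply: chain_pcn (joins_sym j) lb pb.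
apply: Or33; split=> //; case: pa pb => ca _ [cb _]; split; first exact: cov_join1 j ca cb la lb.
apply: tight1; case: (j) => p _; have [c1 c2 c3] := parts_card p; rewrite -card_gt0; lia.
Qed.

(** Jung's min-max theorem for cographs, by induction along [cographP]: cover and obstruction are
    built together at every split and join. *)
Lemma jung D : p4f D -> exists k, path_number D k.
Proof.
have [n] := ubnP #|D|; elim: n D => // n IH D ltn pf.
case: (ltngtP #|D| 1) => [D0|D1|D1]; last by exists 1; apply: path_number_single.
  have -> : D = set0 by apply/eqP; rewrite -cards_eq0; lia.
  by exists 0; split; [apply: cov_set0 | apply: tight0].
have sub A B : parts D A B -> exists a b, path_number A a /\ path_number B b.
  move=> p; have [c1 c2 c3] := parts_card p; have [AD BD] := parts_sub p.
  have [||a pa] := IH A; [lia | exact: p4f_sub pf |].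
  have [||b pb] := IH B; [lia | exact: p4f_sub pf |].
  by exists a, b.
case: (cographP pf D1) => [[A [B s]]|[A [B j]]].
  have [a [b [pa pb]]] := sub A B s.1; exists (a + b); exact: path_number_union s pa pb.
have [a [b [pa pb]]] := sub A B j.1.
by case: (path_number_join j pa pb) => [[_ p]|[_ p]|[_ _ p]]; [exists (a - #|B|) | exists (b - #|A|) | exists 1].
Qed.

Lemma path_number_gt0 D k : path_number D k -> D != set0 -> 0 < k.
Proof. by move=> [c _] D0; have := weak_duality c (tight1 D0). Qed.

Lemma path_number_le D k : path_number D k -> k <= #|D|.
Proof. by case=> /cov_size. Qed.

End Duality.

Lemma uniqPc (T : eqType) (s : seq T) : reflect (forall x, count_mem x s <= 1) (uniq s).
Proof.
apply: (iffP idP) => [u x|h]; first by rewrite count_uniq_mem //; case: (x \in s).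
apply: count_mem_uniq => x; have := h x; case: (boolP (x \in s)) => [|/count_memPn->//].
by rewrite -has_pred1 has_count => l l'; rewrite /=; lia.
Qed.

(** * Path covers with private links *)

Section Segments.
Variable G : sgraph.
Implicit Types (A B C D E L M S T W X Y Z : {set G}) (x y z w : G).
Implicit Types (p q : seq G) (ps qs : seq (seq G)).

(* A triple [(y, p, z)]: a path [p] together with a private link at each of its two ends. *)
Definition seg := (G * seq G * G)%type.
Implicit Types (t : seg) (ts : seq seg).
Definition mid t := t.1.2.
Definition flat t := t.1.1 :: rcons (mid t) t.2.
Definition segok A M t :=
  [&& t.1.1 \in M, t.2 \in M, ends A (mid t) & path (@adj G) t.1.1 (rcons (mid t) t.2)].
Definition revseg t : seg := (t.2, rev (mid t), t.1.1).

(* [E] is partitioned into [k] paths whose ends lie in [A] and have [2 k] distinct links in [M]. *)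
Definition linked_cover E A M k := exists ts, [/\ size ts = k, all (segok A M) ts,
  uniq (flatten (map flat ts)) & flatten (map mid ts) =i E].

Lemma flat_rev t : flat (revseg t) = rev (flat t).
Proof. by rewrite /flat rev_cons rev_rcons. Qed.

Lemma segok_rev A M t : segok A M (revseg t) = segok A M t.
Proof.
rewrite /segok /= ends_rev andbCA; do 3!congr (_ && _).
by rewrite -[path _ _ _]/(sorted _ (flat (revseg t))) flat_rev sorted_rev_adj.
Qed.

Lemma segok_sub A A' M M' t : A \subset A' -> M \subset M' -> segok A M t -> segok A' M' t.
Proof.
move=> /subsetP sA /subsetP sM /and4P[h1 h2 h3 h4]; rewrite /segok !sM //= h4 andbT.
by case: (mid t) h3 => //= x p /andP[h5 h6]; rewrite !sA.
Qed.

Lemma linked_cover_sub E A A' M M' k : A \subset A' -> M \subset M' -> linked_cover E A M k -> linked_cover E A' M' k.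
Proof.
move=> sA sM [ts [h1 h2 h3 h4]]; exists ts; split=> //.
by apply: sub_all h2 => t; apply: segok_sub.
Qed.

Lemma perm_flat ts : perm_eq (flatten (map flat ts))
  (flatten (map mid ts) ++ (map (fun t => t.1.1) ts ++ map (fun t => t.2) ts)).
Proof.
elim: ts => //= t ts IH; apply/permP => P; move/permP/(_ P): IH.
rewrite !count_cat /= -!cats1 !count_cat /=; nat_lia.
Qed.

Lemma flat_mem A M ts x : all (segok A M) ts -> x \in flatten (map flat ts) ->
  x \in flatten (map mid ts) \/ x \in M.
Proof.
move=> h; rewrite (perm_mem (perm_flat ts)) !mem_cat => /or3P[|/mapP[t tin ->]|/mapP[t tin ->]].
- by left.
- by right; case/and4P: (allP h t tin).
- by right; case/and4P: (allP h t tin).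
Qed.

Lemma count_flat P t ts : count P (flatten (map flat (t :: ts))) =
  P t.1.1 + count P (mid t) + P t.2 + count P (flatten (map flat ts)).
Proof. by rewrite /= count_cat /flat /= -cats1 count_cat /=; nat_lia. Qed.

Lemma perm_mseg ts ts' : perm_eq ts ts' ->
  perm_eq (flatten (map flat ts)) (flatten (map flat ts')) /\
  flatten (map mid ts) =i flatten (map mid ts').
Proof.
move=> h; split; first exact/perm_flatten/perm_map.
exact/perm_mem/perm_flatten/perm_map.
Qed.

Lemma relink E A M m s : linked_cover E A M m.+2 -> s \notin E -> {in A, forall x, adj s x} ->
  exists t1 t2 ts, [/\ size ts = m, all (segok A (s |: M)) [:: t1, t2 & ts],
    uniq (flatten (map flat [:: t1, t2 & ts])), flatten (map mid [:: t1, t2 & ts]) =i E & t1.2 = s].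
Proof.
move=> [ts [ts2 ok un me]] sE sA.
have ok' : all (segok A (s |: M)) ts.
  by apply: sub_all ok => t; apply: segok_sub => //; apply: subsetUr.
case: (boolP (s \in flatten (map flat ts))) => [/flattenP[_ /mapP[t tin ->] st]|sn]; last first.
  case: ts ts2 un me sn ok ok' => [|[[y p] z] [|t2 ts]] // [E1] un me sn ok ok'.
  exists (y, p, s), t2, ts; split=> //.
    move: ok'; rewrite ![all _ (_ :: _)]/= => /andP[/and4P[h1 h2 h3 h4] ->].
    rewrite andbT /segok h1 h3 /= !inE eqxx /=.
    move: h4; rewrite !rcons_path => /andP[-> _] /=; rewrite adj_sym sA //.
    by move: h3; rewrite /= /mid /=; case: (p) => //= u q /andP[].
  apply/uniqPc => x; move/uniqPc/(_ x): un; rewrite !count_flat /mid /=.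
  move/count_memPn: sn; rewrite !count_flat /mid /=.
  by case: (eqVneq s x) => [->|_] /=; nat_lia.
have {}st : s = t.1.1 \/ s = t.2.
  move: st; rewrite /flat inE mem_rcons inE => /or3P[/eqP|/eqP|sm]; [by left|by right|].
  by case/negP: sE; rewrite -me; apply/flattenP; exists (mid t) => //; apply: map_f.
have [ts' pe] : exists ts', perm_eq ts (t :: ts').
  by exists (rem t ts); apply: perm_to_rem.
have [pf pm] := perm_mseg pe.
move: ok'; rewrite (perm_all _ pe) => /andP[okt okts].
rewrite (perm_uniq pf) in un; have {}me : flatten (map mid (t :: ts')) =i E.
  by move=> x; rewrite -pm.
case: ts' {pf pm} pe okts un me => [|t2 ts'] pe okts un me.
  by have := perm_size pe; rewrite ts2.
have st' : size ts' = m by have := perm_size pe; rewrite ts2 => -[->].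
case: st => [E1|E1]; last by exists t, t2, ts'; split=> //; apply/andP.
exists (revseg t), t2, ts'; split=> //.
- by apply/andP; split=> //; rewrite segok_rev.
- apply/uniqPc => x; move/uniqPc/(_ x): un; rewrite !count_flat /mid /= count_rev /mid; nat_lia.
- by move=> x; rewrite -me /= !mem_cat mem_rev.
Qed.

(** The link [s] becomes the inner vertex joining the first two segments. The link of the second
    segment at the junction is given up, and the outer ends still lie in [A]. *)
Lemma linked_cover_step E A M m s : linked_cover E A M m.+2 -> s \notin E -> {in A, forall x, adj s x} ->
  linked_cover (s |: E) A (M :\ s) m.+1.
Proof.
move=> h sE sA; have [[[y1 p1] z1] [[[y2 p2] z2] [ts [st ok un me /= E1]]]] := relink h sE sA.
rewrite {z1}E1 in ok un me.
have ar a b c d e n : a + b + 1 + (c + d + e + n) <= 1 -> n = 0 by lia.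
exists ((y1, p1 ++ s :: p2, z2) :: ts).
(* The right link of the first segment is the only occurrence of [s], so [y1], [z2] and all of [ts]
   avoid it and the remaining links lie in [M :\ s]. *)
have un' := un; move/uniqPc/(_ s): un'; rewrite !count_flat /mid /= eqxx /= => cs.
have y1s : y1 != s by apply/eqP => E1; move: cs; rewrite E1 eqxx /=; nat_lia.
have z2s : z2 != s by apply/eqP => E1; move: cs; rewrite E1 eqxx /=; nat_lia.
move: ok; rewrite ![all _ (_ :: _)]/= => /and3P[/and4P[a1 a2 a3 a4] /and4P[b1 b2 b3 b4] c].
rewrite /= /mid /= in a1 a2 a3 a4 b1 b2 b3 b4.
split.
- by rewrite /= st.
- rewrite [all _ _]/=; apply/andP; split; last first.
    apply/allP => t tin; have := allP c t tin => /and4P[h1 h2 h3 h4].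
    have ct := ar _ _ _ _ _ _ cs.
    have nin v : v \in flat t -> v != s.
      move=> vin; apply/eqP => Ev; move/eqP: ct; rewrite eqn0Ngt -has_count has_pred1.
      by case/negP; apply/flattenP; exists (flat t); [apply: map_f | rewrite -Ev].
    rewrite /segok h3 h4 andbT; move: h1 h2; rewrite !in_setU1 !in_setD1.
    rewrite !nin ?(negbTE (nin _ _)) //= /flat ?inE ?eqxx ?mem_rcons ?inE ?eqxx ?orbT //.
    by move=> -> ->.
  move: a1 b2; rewrite /segok /= !in_setU1 !in_setD1 (negbTE y1s) (negbTE z2s) /= => -> -> /=.
  case: p1 a3 a4 {h un me cs} => //= u p1 /andP[uA lA] /andP[yu pp].
  case: p2 b3 b4 => //= v p2 /andP[vA lvA] /andP[_ pq].
  rewrite last_cat /= uA lvA yu /= rcons_cat cat_path /= pq sA // andbT.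
  by move: pp; rewrite rcons_path andbT.
- change (uniq (flatten (map flat ((y1, p1 ++ s :: p2, z2) :: ts)))).
  apply/uniqPc => x; move/uniqPc/(_ x): un; rewrite !count_flat /mid /= !count_cat /=; nat_lia.
- move=> x; rewrite in_setU1 -me /mid /= !mem_cat inE.
  by case: (x \in p1); case: (x == s); rewrite ?orbT.
Qed.

(** Each vertex of [S] merges two segments, and [#|S| < m] guarantees that two are left whenever a
    vertex is inserted. *)
Lemma linked_cover_join E A M S m : linked_cover E A M m -> full A S -> [disjoint E & S] -> #|S| < m ->
  linked_cover (E :|: S) A (M :\: S) (m - #|S|).
Proof.
have [n] := ubnP #|S|; elim: n S E M m => // n IH S E M m lt h f d l.
have [->|/set0Pn[s sS]] := eqVneq S set0; first by rewrite cards0 setU0 setD0 subn0.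
have cS := cardsD1 s S; rewrite sS in cS.
case: m h l => [|[|m]] h l; [lia | lia |].
have sE : s \notin E by apply/negP => sE; apply: (disjointP _ _ d) sE sS.
have sA : {in A, forall x, adj s x} by move=> x xA; rewrite adj_sym f.
have h1 := linked_cover_step h sE sA.
have -> : m.+2 - #|S| = m.+1 - #|S :\ s| by lia.
have -> : E :|: S = (s |: E) :|: (S :\ s) by rewrite -setUA setUCA setD1K.
have -> : M :\: S = (M :\ s) :\: (S :\ s) by rewrite setDDl setD1K.
apply: IH h1 _ _ _; try lia.
- by move=> x y xA; rewrite inE => /andP[_]; apply: f.
- apply/disjointP => x; rewrite !inE => /orP[/eqP->|xE]; first by rewrite eqxx.
  by case/andP=> _; apply: (disjointP _ _ d) xE.
Qed.

Lemma linked_cover_union E E' A M M' k k' : linked_cover E A M k -> linked_cover E' A M' k' ->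
  [disjoint E :|: M & E' :|: M'] -> linked_cover (E :|: E') A (M :|: M') (k + k').
Proof.
move=> [ts [<- o1 u1 m1]] [us [<- o2 u2 m2]] d; exists (ts ++ us); split.
- by rewrite size_cat.
- rewrite all_cat; apply/andP; split; [apply: sub_all o1 | apply: sub_all o2] => t.
    by apply: segok_sub; rewrite ?subsetUl.
  by apply: segok_sub; rewrite ?subsetUr.
- rewrite map_cat flatten_cat cat_uniq u1 u2 andbT /= -all_predC; apply/allP => x xu.
  apply/negP => xt; have [] := flat_mem o1 xt; have [] := flat_mem o2 xu;
  rewrite ?m1 ?m2 => h1 h2; apply: (disjointP _ _ d x); by rewrite inE ?h1 ?h2 ?orbT.
- by move=> x; rewrite map_cat flatten_cat mem_cat m1 m2 inE.
Qed.

Lemma linked_cover_used E A M k : linked_cover E A M k ->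
  exists M', [/\ M' \subset M, #|M'| <= k.*2 & linked_cover E A M' k].
Proof.
move=> [ts [<- o u m]].
pose l := map (fun t => t.1.1) ts ++ map (fun t => t.2) ts.
exists [set x in l]; split.
- apply/subsetP => x; rewrite inE mem_cat => /orP[] /mapP[t tin ->];
  by case/and4P: (allP o t tin).
- apply: (@leq_trans (size l)); first by rewrite cardsE card_size.
  by rewrite size_cat !size_map addnn.
- exists ts; split=> //; apply/allP => t tin; case/and4P: (allP o t tin) => h1 h2 h3 h4.
  have m1 : t.1.1 \in l by rewrite mem_cat; apply/orP; left; apply/mapP; exists t.
  have m2 : t.2 \in l by rewrite mem_cat; apply/orP; right; apply/mapP; exists t.
  by rewrite /segok h3 h4 !inE m1 m2.
Qed.

Lemma cov_mseg D M k : cov D D k -> full D M -> [disjoint D & M] -> k.*2 <= #|M| -> linked_cover D D M k.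
Proof.
move=> [ps [sp h2 h3 h4]] f d l; rewrite -{}sp in l *.
suff [ts [E1 E2 E3]] : exists ts, [/\ map mid ts = ps, all (segok D M) ts & uniq (flatten (map flat ts))].
  exists ts; split=> //; first by rewrite -E1 size_map.
  by move=> x; rewrite E1; apply/idP/idP => [/h3|/h4].
have /andP[_ up] := h2; have {h2 h4} := pathsys_all h2 h3.
elim: ps M h3 up f d l => [|p ps IH] M h3 up f d l.
  by exists [::].
move=> /andP[/andP[ep sp] aps].
have [y yM] : exists y, y \in M by apply/card_gt0P; move: l => /=; lia.
have cM := cardsD1 y M; rewrite yM in cM.
have [z zM] : exists z, z \in M :\ y by apply/card_gt0P; move: l => /=; lia.
have cM' := cardsD1 z (M :\ y); rewrite zM in cM'.
have [nzy zM'] : z != y /\ z \in M by move: zM; rewrite !inE => /andP[].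
pose M' := M :\ y :\ z.
have sM : {subset M' <= M} by move=> x; rewrite !inE => /and3P[].
have [||||||ts [E1 E2 E3]] := IH M'.
- by move=> x xin; apply: h3; rewrite /= mem_cat xin orbT.
- by move: up; rewrite /= cat_uniq => /and3P[].
- by move=> u v uD /sM vM; apply: f.
- by apply/disjointP => x xD /sM; apply: (disjointP _ _ d).
- by move: l => /=; rewrite /M'; lia.
- by [].
have pD : {subset p <= D} by move=> x xp; apply: h3; rewrite /= mem_cat xp.
exists ((y, p, z) :: ts); split.
- by rewrite /= E1.
- apply/andP; split; last by apply: sub_all E2 => t; apply: segok_sub => //; apply/subsetP.
  rewrite /segok /= yM zM' ep /mid /=.
  case: p ep sp {h3 up aps l} pD => //= x p /andP[xD lD] px.
  by rewrite rcons_path px adj_sym !f.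
- have dn v : v \in M -> v \notin flatten (p :: ps).
    by move=> vM; apply/negP => /h3 vD; apply: (disjointP _ _ d) vD vM.
  have dn' v : v \in M -> v \notin flatten ps.
    by move/dn; apply: contra; rewrite /= mem_cat => ->; rewrite orbT.
  have up' := up.
  apply/uniqPc => x; rewrite count_flat /=.
  have := uniqPc _ E3 x; move/uniqPc/(_ x): up; rewrite /= count_cat => c1 c2.
  have fl v : v \notin M' -> v \notin flatten ps -> count_mem v (flatten (map flat ts)) = 0.
    by move=> v1 v2; apply/count_memPn/negP => /(flat_mem E2); rewrite E1 (negbTE v1) (negbTE v2) => -[].
  have fy : count_mem y (flatten (map flat ts)) = 0.
    by apply: fl; [rewrite !inE eqxx /= andbF | exact: dn'].
  have fz : count_mem z (flatten (map flat ts)) = 0.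
    by apply: fl; [rewrite !inE eqxx | exact: dn'].
  case: (boolP (x \in p)) => xp; last first.
    have -> : count_mem x p = 0 by apply/count_memPn.
    case: (eqVneq y x) => [E'|]; first by rewrite -E' (negbTE nzy) fy.
    by case: (eqVneq z x) => [E'|]; first by rewrite -E' fz.
  have xD := pD x xp.
  have xM : x \notin M by apply/negP => xM; apply: (disjointP _ _ d) xD xM.
  have nx : x \notin flatten ps.
    apply/negP => xps; move: up'; rewrite /= cat_uniq => /and3P[_ + _].
    by rewrite -all_predC => /allP/(_ x xps); rewrite /= xp.
  rewrite fl //; last by apply: contra xM; apply: sM.
  have yx : y != x by apply: contra xM => /eqP<-.
  have zx : z != x by apply: contra xM => /eqP<-.
  rewrite (negbTE yx) (negbTE zx) /= !addn0 add0n; apply: leq_trans c1; exact: leq_addr.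
Qed.

End Segments.

(** * Laminar families from domination *)

Section Core.
Variable G : sgraph.
Implicit Types (A B C D E L M N P Q R S T U W X Y Z : {set G}) (x y z w : G).
Implicit Types (p q : seq G) (ps qs : seq (seq G)).

Hypothesis p4_dom : forall a b c d, p4 (@adj G) a b c d ->
  forall e, [|| adj e a, adj e b, adj e c | adj e d].

Lemma p4_dom_end (a b c d u : G) : adj a b -> adj b c -> adj c d ->
  ~~ adj a c -> ~~ adj b d -> ~~ adj a d ->
  ~~ adj u b -> ~~ adj u c -> ~~ adj u d -> adj u a.
Proof.
move=> h1 h2 h3 h4 h5 h6 n1 n2 n3.
have := p4_dom (a := a) (b := b) (c := c) (d := d); rewrite /p4 h1 h2 h3 h4 h5 h6 => /(_ isT u).
by rewrite (negbTE n1) (negbTE n2) (negbTE n3) !orbF.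
Qed.

Lemma p4_dom_mid (a b c d u : G) : adj a b -> adj b c -> adj c d ->
  ~~ adj a c -> ~~ adj b d -> ~~ adj a d ->
  ~~ adj u a -> ~~ adj u c -> ~~ adj u d -> adj u b.
Proof.
move=> h1 h2 h3 h4 h5 h6 n1 n2 n3.
have := p4_dom (a := a) (b := b) (c := c) (d := d); rewrite /p4 h1 h2 h3 h4 h5 h6 => /(_ isT u).
by rewrite (negbTE n1) (negbTE n2) (negbTE n3) !orbF.
Qed.

Section Partition.
Variables (D L0 : {set G}) (rho : G).
Hypothesis rhoD : {in D, forall x, ~~ adj rho x}.
Hypothesis L0P : {in L0, forall y, (exists2 x, x \in D & adj y x) /\ (D \subset nbr y \/ adj y rho)}.

Let e : rel G := fun x z => [&& adj x z, x \in D & z \in D].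
Let comp x := [set z in D | connect e x z].
(** The union of those components of [D] that [y] does not see completely. *)
Let bad y := [set z in D | [exists x in D, ~~ adj y x && connect e x z]].

Let e_sym : connect_sym e.
Proof. by apply: sym_connect_sym => x y; rewrite /e adj_sym (andbC (x \in D)). Qed.

Let bad_nonadj y z : z \in D -> ~~ adj y z -> z \in bad y.
Proof. by move=> zD n; rewrite inE zD; apply/exists_inP; exists z; rewrite ?n ?connect0. Qed.

Let bad_closed y z z' : z \in bad y -> z' \in D -> connect e z z' -> z' \in bad y.
Proof.
rewrite !inE => /andP[zD /exists_inP[x xD /andP[n c]]] z'D c'; rewrite z'D.
by apply/exists_inP; exists x => //; rewrite n (connect_trans c c').
Qed.

Let bad_edge y z z' : z \in bad y -> z' \in D -> z' \notin bad y -> ~~ adj z z'.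
Proof.
move=> zb z'D; apply: contra => zz'; apply: (bad_closed zb z'D (connect1 _)).
by rewrite /e zz' z'D; move: zb; rewrite inE => /andP[->].
Qed.

Let bad_rho y z : y \in L0 -> z \in bad y -> adj y rho.
Proof.
move=> yL; rewrite inE => /andP[_ /exists_inP[x xD /andP[n _]]].
by case: (L0P yL) => _ [/subsetP/(_ x xD)|//]; rewrite inE (negbTE n).
Qed.

(* [rho - y - a - b] is an induced path, so [y] sees all the other components. *)
Let bad_comp y z : y \in L0 -> z \in bad y -> adj y z -> exists2 x, x \in D & bad y = comp x.
Proof.
move=> yL zb yz; have yr := bad_rho yL zb.
have := zb; rewrite inE => /andP[zD /exists_inP[x xD /andP[n c]]].
have [|b [a [cb /and3P[ba bD aD] nb]]] := connect_cross (P := fun v => ~~ adj y v) c n.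
  by rewrite yz.
move/negPn => ya; exists x => //.
have key w : w \in D -> ~~ connect e x w -> adj y w.
  move=> wD nw; have nwv v : connect e x v -> v \in D -> ~~ adj w v.
    move=> cv vD; apply: contra nw => wv; apply: connect_trans cv (connect1 _).
    by rewrite /e adj_sym wv vD.
  have ca : connect e x a by apply: connect_trans cb (connect1 _); apply/and3P.
  rewrite adj_sym; apply: (p4_dom_mid (a := rho) (b := y) (c := a) (d := b)) => //.
  - by rewrite adj_sym.
  - by rewrite adj_sym.
  - exact: rhoD.
  - exact: rhoD.
  - by rewrite adj_sym rhoD.
  - exact: nwv.
  - exact: nwv.
apply/setP => w; rewrite !inE; case: (boolP (w \in D)) => wD //=.
apply/exists_inP/idP => [[v vD /andP[nv cv]]|cw]; last by exists x; rewrite ?n.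
apply: connect_trans cv; apply: contraR nv; exact: key.
Qed.

Hypothesis sD : splittable D.

(** If [bad y] were all of [D], a neighbour of [y] in it would make it a single component by
    [bad_comp], against [splittable D]. *)
Let bad_proper y : y \in L0 -> bad y != D.
Proof.
move=> yL; apply/eqP => E; have [[z zD yz] _] := L0P yL.
have [|x xD Ex] := bad_comp yL _ yz; first by rewrite E.
have conn w : w \in D -> connect e x w by rewrite -E Ex inE => /andP[].
case: sD => A [B [[A0 B0 dAB EAB] nAB]].
case/set0Pn: A0 => a aA; case/set0Pn: B0 => b bB.
have aD : a \in D by rewrite -EAB inE aA.
have bD : b \in D by rewrite -EAB inE bB orbT.
have ab : connect e a b by apply: connect_trans (conn b bD); rewrite e_sym conn.
have bA : b \notin A by apply/negP => bA; apply: (disjointP _ _ dAB) bA bB.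
have [u [v [_ /and3P[uv uD vD] uA vA]]] := connect_cross (P := [in A]) ab aA bA.
have vB : v \in B by move: vD; rewrite -EAB inE (negbTE vA).
by have := nAB u v uA vB; rewrite uv.
Qed.

(** Suppose [i] lies only in [bad y], [j] only in [bad y'] and [k] in both. Then [y] sees nothing of
    [bad y], since otherwise it would be one component and contained in [bad y']; likewise for [y'].
    So [j y y' i] or, if [y] and [y'] are not adjacent, [j y rho y'] is an induced path that [k]
    does not dominate. *)
Let bad_laminar y y' : y \in L0 -> y' \in L0 ->
  [\/ bad y \subset bad y', bad y' \subset bad y | [disjoint bad y & bad y'] ].
Proof.
move=> yL yL'; case: (boolP (bad y \subset bad y')) => [h|/subsetPn[i iy iy']]; first exact: Or31.
case: (boolP (bad y' \subset bad y)) => [h|/subsetPn[j jy' jy]]; first exact: Or32.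
apply: Or33; apply/disjointP => k ky ky'.
have inD v w : v \in bad w -> v \in D by rewrite inE => /andP[].
have nofull v v' i' w : v \in L0 -> k \in bad v -> k \in bad v' -> i' \in bad v -> i' \notin bad v' ->
    w \in bad v -> ~~ adj v w.
  move=> vL kv kv' iv iv' wv; apply/negP => vw.
  have [x xD Ex] := bad_comp vL wv vw; case/negP: iv'; apply: bad_closed kv' (inD _ _ iv) _.
  move: iv kv; rewrite Ex !inE => /andP[_ ci] /andP[_ ck].
  by apply: connect_trans ci; rewrite e_sym.
have yi := nofull y y' i i yL ky ky' iy iy' iy; have yk := nofull y y' i k yL ky ky' iy iy' ky.
have yj' := nofull y' y j j yL' ky' ky jy' jy jy'; have yk' := nofull y' y j k yL' ky' ky jy' jy ky'.
have yj : adj y j by apply: contraR jy => h; apply: bad_nonadj h; apply: inD jy'.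
have yi' : adj y' i by apply: contraR iy' => h; apply: bad_nonadj h; apply: inD iy.
have iD := inD _ _ iy; have jD := inD _ _ jy'; have kD := inD _ _ ky.
have ij := bad_edge iy jD jy; have kj := bad_edge ky jD jy; have ki := bad_edge ky' iD iy'.
have yr := bad_rho yL iy; have yr' := bad_rho yL' jy'.
have kr : ~~ adj k rho by rewrite adj_sym rhoD.
case: (boolP (adj y y')) => yy'.
  by case/negP: kj; apply: (p4_dom_end (b := y) (c := y') (d := i));
    rewrite // 1?adj_sym // 1?adj_sym.
by case/negP: kj; apply: (p4_dom_end (b := y) (c := rho) (d := y'));
  rewrite // 1?adj_sym // rhoD.
Qed.

(** Take [C = bad y] of maximum size. By laminarity every other [bad z] lies inside [C] or is
    disjoint from it, so [z] is complete to [D :\: C] or to [C]. *)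
Lemma laminar_split : exists C N, splits D C N /\
  {in L0, forall y, C \subset nbr y \/ N \subset nbr y}.
Proof.
case: (boolP [exists y in L0, bad y != set0]) => [/exists_inP[y0 y0L b0]|]; last first.
  rewrite negb_exists => /forallP h; case: sD => A [B s]; exists A, B; split=> // y yL.
  left; apply/subsetP => x xA; rewrite inE; have [AD _] := parts_sub s.1.
  have := h y; rewrite yL /= negbK => /eqP b; apply: contraFT (in_set0 x) => n.
  by rewrite -b bad_nonadj // (subsetP AD).
have [y yL ymax] := @arg_maxnP _ y0 [in L0] (fun y => #|bad y|) y0L.
have by0 : bad y != set0.
  by rewrite -card_gt0; apply: leq_trans (ymax y0 y0L); rewrite card_gt0.
have sub : bad y \subset D by apply/subsetP => x; rewrite inE => /andP[].
exists (bad y), (D :\: bad y); split.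
  split; last by move=> x z xb; rewrite inE => /andP[zb zD]; apply: bad_edge xb zD zb.
  split=> //.
  - rewrite setD_eq0; apply: contra (bad_proper yL) => h; by rewrite eqEsubset sub.
  - by apply/disjointP => x xb; rewrite inE xb.
  - by rewrite -{2}(setID D (bad y)) (setIidPr sub).
move=> z zL; have out C : {in C, forall x, x \in D} -> {in C, forall x, x \notin bad z} -> C \subset nbr z.
  by move=> h1 h2; apply/subsetP => x xC; rewrite inE; apply: contraR (h2 x xC); apply: bad_nonadj; apply: h1.
case: (bad_laminar yL zL) => h.
- right; apply: out => x; rewrite inE => /andP[xb xD] //.
  have : bad y == bad z by rewrite eqEcard h; apply: ymax.
  by move/eqP <-.
- right; apply: out => x; rewrite inE => /andP[xb xD] //.
  by apply: contra xb; apply: (subsetP h).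
- left; apply: out => x xb; first exact: (subsetP sub).
  by apply/negP => xz; apply: (disjointP _ _ h) xb xz.
Qed.

End Partition.
End Core.

(** * Local toughness and private links *)

Section CoreLemma.
Variable G : sgraph.
Implicit Types (A B C D E L M N P Q R S T U W X Y Z : {set G}) (x y z w : G).
Implicit Types (p q : seq G) (ps qs : seq (seq G)).

Definition links L U := [set y in L | [exists x in U, adj y x]].

Lemma linksP L U y : reflect (y \in L /\ exists2 x, x \in U & adj y x) (y \in links L U).
Proof.
rewrite inE; apply: (iffP andP) => [[yL /exists_inP[x xU yx]]|[yL [x xU yx]]].
  by split=> //; exists x.
by split=> //; apply/exists_inP; exists x.
Qed.

Lemma links_sub L U U' : U \subset U' -> links L U \subset links L U'.
Proof.
by move=> /subsetP s; apply/subsetP => y /linksP[yL [x /s xU yx]]; apply/linksP; split=> //; exists x.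
Qed.

(* What toughness 9/2 says about the cut [X u N_L(U)], which separates [U] from [D \ (U u X)] and from at least one
   further component (hence the successor). *)
Definition locally_tough D L := forall U X (f : G -> G), U \subset D -> X \subset D -> U != set0 ->
  [disjoint U & X] -> {in U & D, forall x y, adj x y -> y \in U :|: X} ->
  {in U &, forall x y, adj x y -> f x = f y} ->
  9 * (#|f @: U|).+1 <= 2 * (#|X| + #|links L U|).

Lemma locally_tough_split D C N L : splits D C N -> locally_tough D L -> locally_tough C L.
Proof.
move=> [p n] t U X f UC XC; have [CD _] := parts_sub p.
move=> U0 d h; apply: t; rewrite ?(subset_trans _ CD) //.
move=> x y xU yD xy; case: (boolP (y \in C)) => [yC|yC]; first exact: (h x y).
have yN : y \in N by case: p yD => _ _ _ <-; rewrite inE (negbTE yC).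
by have := n x y (subsetP UC x xU) yN; rewrite xy.
Qed.

Lemma links_full A B L U : full A B -> U \subset A -> U != set0 ->
  links (B :|: L) U = B :|: links L U.
Proof.
move=> f UA /set0Pn[u uU]; apply/setP => y; rewrite in_setU; apply/linksP/orP.
  by rewrite inE => -[/orP[yB|yL] [x xU yx]]; [left | right; apply/linksP; split=> //; exists x].
case=> [yB|/linksP[yL [x xU yx]]].
  by split; [rewrite inE yB | exists u; rewrite // adj_sym f // (subsetP UA)].
by split; [rewrite inE yL orbT | exists x].
Qed.

(** In the cut for [D] the set [B] is deleted together with [X]; for [A] it is counted among the
    links instead, being complete to [A]. The total is at least as large. *)
Lemma locally_tough_join D A B L : joins D A B -> [disjoint B & L] -> locally_tough D L -> locally_tough A (B :|: L).
Proof.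
move=> [p f] dBL t U X g UA XA U0 d h hg; have [AD BD] := parts_sub p.
have {}t := t U (X :|: B) g (subset_trans UA AD).
rewrite (links_full L f UA U0) cardsUd; last first.
  by apply/disjointP => x xB /linksP[xL _]; apply: (disjointP _ _ dBL) xB xL.
rewrite addnA; apply: leq_trans (t _ _ _ _ _) _ => //.
- by rewrite subUset BD (subset_trans XA AD).
- case: p => _ _ dAB _; apply/disjointP => x xU; rewrite inE => /orP[xX|xB].
    exact: (disjointP _ _ d) xU xX.
  exact: (disjointP _ _ dAB) (subsetP UA x xU) xB.
- move=> x y xU yD xy; rewrite setUA inE; case: p yD => _ _ _ <-.
  by rewrite inE => /orP[yA|->]; rewrite ?orbT // (h x y).
- by have := cardsU_le X B; lia.
Qed.

(** The cut deletes the set [X] of the obstruction. Its labels exceed [k] by at least [#|X|], which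
    more than outweighs the contribution of [X] on the right. *)
Lemma locally_tough_tight D L k : tight D k -> 0 < k -> locally_tough D L -> 9 * k.+1 <= 2 * #|links L D|.
Proof.
move=> [X [f [XD fD fe l]]] k0 t.
have U0 : D :\: X != set0.
  by apply: contraTneq l => ->; rewrite imset0 cards0 -ltnNge; lia.
have d : [disjoint D :\: X & X] by apply/disjointP => x; rewrite inE => /andP[/negP].
have := t (D :\: X) X f (subsetDl _ _) XD U0 d _ fe.
have s : #|links L (D :\: X)| <= #|links L D| by apply/subset_leq_card/links_sub/subsetDl.
move=> {}t; suff : 9 * #|f @: (D :\: X)|.+1 <= 2 * (#|X| + #|links L (D :\: X)|) by lia.
by apply: t => x y xU yD _; rewrite in_setU in_setD yD andbT orNb.
Qed.

(** Supplies a second link at an end other than [w], distinct from a given first link. The cut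
    deletes [w] as well, which costs at most one label. *)
Lemma locally_tough_tightD1 A S L a w : tight A a -> 0 < a -> full A S -> [disjoint S & L] ->
  locally_tough A (S :|: L) -> #|S| <= a -> w \in A -> 1 < #|A| -> 1 < #|links L (A :\ w)|.
Proof.
move=> ta a0 f d t lS wA A1.
have key U X (g : G -> G) : U \subset A :\ w -> X \subset A -> U != set0 -> U = A :\ w :\: X ->
    {in U &, forall x y, adj x y -> g x = g y} ->
    9 * (#|g @: U|).+1 <= 2 * (#|X|.+1 + (#|S| + #|links L (A :\ w)|)).
  move=> UA XA U0 EU ge; have UA' := subset_trans UA (subsetDl A [set w]).
  have dU : [disjoint S & links L U].
    by apply/disjointP => x xS /linksP[xL _]; apply: (disjointP _ _ d) xS xL.
  have := t U (w |: X) g UA' _ U0 _ _ ge; rewrite (links_full L f UA' U0) (cardsUd dU).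
  have := subset_leq_card (links_sub L UA); have := cardsU_le [set w] X; rewrite cards1.
  move=> l1 l2 {}t; suff : 9 * #|g @: U|.+1 <= 2 * (#|w |: X| + (#|S| + #|links L U|)) by lia.
  apply: t; first by rewrite subUset sub1set wA.
    apply/disjointP => x; rewrite EU !inE => /andP[/negbTE-> /andP[/negbTE->]] //.
  by move=> x y _ yA _; rewrite EU !inE yA; case: (y == w); case: (y \in X).
case: (ltnP 1 a) => la.
  have [X [g [XA gA ge l]]] := ta.
  have E : #|g @: (A :\: X)| <= #|g @: (A :\ w :\: X)|.+1.
    have sg : g @: (A :\: X) \subset g w |: g @: (A :\ w :\: X).
      apply/subsetP => v /imsetP[x]; rewrite inE => /andP[xX xA] {v}->.
      have [->|xw] := eqVneq x w; first by rewrite !inE eqxx.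
      by rewrite inE; apply/orP; right; apply: imset_f; rewrite !inE xX xA xw.
    by apply: leq_trans (subset_leq_card sg) (leq_trans (cardsU_le _ _) _); rewrite cards1.
  have U0 : A :\ w :\: X != set0.
    by apply: contraTneq E => ->; rewrite imset0 cards0 -ltnNge; lia.
  have := key _ X g (subsetDl _ _) XA U0 erefl _.
  suff h : {in A :\ w :\: X &, forall x y, adj x y -> g x = g y} by move/(_ h); lia.
  move=> x y xin yin; apply: ge; first by move: xin; rewrite !inE => /and3P[-> _ ->].
  by move: yin; rewrite !inE => /and3P[-> _ ->].
(* For [a = 1] the obstruction may vanish with [w], so the constant labelling of [A :\ w] is
   used. *)
have U0 : A :\ w != set0 by rewrite -card_gt0; have := cardsD1 w A; rewrite wA; lia.
have := key (A :\ w) set0 (fun=> w) (subxx _) (sub0set _) U0 _ _.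
rewrite setD0 cards0 => /(_ erefl (fun _ _ _ _ _ => erefl)).
have : 0 < #|(fun=> w) @: (A :\ w)|.
  by case/set0Pn: U0 => x xA; apply/card_gt0P; exists w; apply/imsetP; exists x.
by lia.
Qed.

Lemma hpath_mseg W C A L x1 x2 y1 y2 : hpath W C x1 x2 -> [disjoint W & L] ->
  y1 \in L -> y2 \in L -> y1 != y2 -> adj y1 x1 -> adj y2 x2 -> x1 \in A -> x2 \in A ->
  exists E, [/\ C \subset E, E \subset W & linked_cover E A L 1].
Proof.
move=> [t [t1 t2 t3 t4 t5]] d yL1 yL2 n12 a1 a2 xA1 xA2.
exists [set x in x1 :: t]; split.
- by apply/subsetP => x /t4; rewrite inE.
- by apply/subsetP => x; rewrite inE => /t3.
have nin y : y \in L -> y \notin x1 :: t.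
  by move=> yL; apply/negP => /t3 yW; apply: (disjointP _ _ d) yW yL.
exists [:: (y1, x1 :: t, y2)]; split=> //.
- by rewrite /= /segok /mid /= yL1 yL2 xA1 t5 xA2 a1 rcons_path t1 t5 adj_sym a2.
- rewrite /= /flat /mid cats0 /= -[x1 :: rcons t y2]rcons_cons mem_rcons rcons_uniq in_cons negb_or n12.
  have := nin _ yL1; have := nin _ yL2; move: t2; rewrite /= !(mem_rcons,rcons_uniq,inE) !negb_or.
  by rewrite [y2 == x1]eq_sym => /andP[-> ->] /andP[-> ->] /andP[-> ->].
- by move=> x; rewrite /= cats0 !inE.
Qed.

Lemma segs_pathsys A M ts : all (segok A M) ts -> uniq (flatten (map (@flat G) ts)) ->
  pathsys (map (@mid G) ts).
Proof.
move=> o u; apply/andP; split; last by move: u; rewrite (perm_uniq (perm_flat ts)) cat_uniq => /and3P[].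
apply/allP => p /mapP[t tin ->]; case/and4P: (allP o t tin) => _ _ h3 h4.
by case: (mid t) h3 h4 => //= x q _ /andP[_]; rewrite rcons_path; case/andP.
Qed.

(** The [a] segments have [2a] distinct links, more than fit into [S], so some link lies in [L]; its
    segment is moved to the front. *)
Lemma linked_cover_link A S L a : linked_cover A A (S :|: L) a -> #|S| < a.*2 ->
  exists w y, [/\ y \in L, adj y w, w \in A & ecov1 A A w a].
Proof.
move=> [ts [<- o u m]] l.
have [/hasP[t tin tL]|nh] := boolP (has (fun t => (t.1.1 \in L) || (t.2 \in L)) ts).
  have [t' [ok' L' pt pm]] : exists t' : seg G, [/\ segok A (S :|: L) t',
      t'.1.1 \in L, perm_eq (flat t') (flat t) & perm_eq (mid t') (mid t)].
    case/orP: tL => h; first by exists t; rewrite (allP o).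
    by exists (revseg t); rewrite segok_rev flat_rev !(perm_rev, perm_refl) (allP o).
  have [s1 [s2 E]] := mem_split tin.
  have pp : perm_eq (flatten (map (@flat G) (t' :: s1 ++ s2))) (flatten (map (@flat G) ts)).
    rewrite E; move/permP: pt => pt; apply/permP => P; have := pt P.
    by rewrite !(map_cons, map_cat) !(flatten_cons, flatten_cat) !count_cat; nat_lia.
  have o' : all (segok A (S :|: L)) (t' :: s1 ++ s2).
    by move: o; rewrite E /= !all_cat /= ok' => /and3P[-> _ ->].
  have u' : uniq (flatten (map (@flat G) (t' :: s1 ++ s2))) by rewrite (perm_uniq pp).
  have ps' := segs_pathsys o' u'.
  have mE : flatten (map (@mid G) (t' :: s1 ++ s2)) =i A.
    have pq : perm_eq (flatten (map (@mid G) (t' :: s1 ++ s2))) (flatten (map (@mid G) ts)).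
      rewrite E; move/permP: pm => pm; apply/permP => P; have := pm P.
      by rewrite !(map_cons, map_cat) !(flatten_cons, flatten_cat) !count_cat; nat_lia.
    by move=> x; rewrite (perm_mem pq) m.
  case: t' ok' L' pt {pm} pp o' u' ps' mE => [[y p] z] /= ok' yL _ _ _ _ ps' mE.
  case/and4P: ok'; rewrite /= rcons_path; case: p ps' mE => // w p ps' mE _ _ /andP[wA _] /andP[/andP[aw _] _].
  exists w, y; split=> //; exists (map (@mid G) ((y, w :: p, z) :: s1 ++ s2)); split=> //.
  - rewrite E !size_map /= !size_cat /=; nat_lia.
  - by move=> x; rewrite mE.
  - by move=> x; rewrite mE.
  - by split=> //; rewrite E size_cat /=; nat_lia.
exfalso; have hS : {subset map (fun t => t.1.1) ts ++ map (fun t => t.2) ts <= S}.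
  move=> x; rewrite mem_cat => /orP[] /mapP[t tin ->]; have /and4P[i1 i2 _ _] := allP o t tin;
  move/hasPn/(_ t tin): nh; rewrite negb_or => /andP[n1 n2].
    by move: i1; rewrite inE (negbTE n1) orbF.
  by move: i2; rewrite inE (negbTE n2) orbF.
have us : uniq (map (fun t => t.1.1) ts ++ map (fun t => t.2) ts).
  by move: u; rewrite (perm_uniq (perm_flat ts)) cat_uniq => /and3P[].
have := uniq_leq_size us (s2 := enum S) _; rewrite -cardE size_cat !size_map => h.
suff : size ts + size ts <= #|S| by move: l; clear; lia.
by apply: h => x /hS; rewrite mem_enum.
Qed.

Lemma locally_tough_links A S L : A != set0 -> full A S -> [disjoint S & L] ->
  locally_tough A (S :|: L) -> 18 <= 2 * (#|S| + #|links L A|).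
Proof.
move=> A0 f d t; have dU : [disjoint S & links L A].
  by apply/disjointP => x xS /linksP[xL _]; apply: (disjointP _ _ d) xS xL.
have [w wA] := set0Pn _ A0.
have := t A set0 (fun=> w) (subxx _) (sub0set _) A0 _ _ _.
rewrite cards0 add0n (links_full L f (subxx _) A0) (cardsUd dU) => h.
have l : 0 < #|(fun=> w) @: A| by apply/card_gt0P; exists w; apply/imsetP; exists w.
apply: leq_trans (h _ _ _) => //; first by move: l; clear; lia.
- by apply/disjointP => x _; rewrite inE.
- by move=> x y _ yA _; rewrite inE yA.
Qed.

(** For [#|S| < a] all of [S] is inserted. For [#|S| = a] a single path must remain, both of whose
    links lie in [L]: one comes from [linked_cover_link], the other from [locally_tough_tightD1].
    Fixing the second end may require one more path in [A], so only the part [B] of [S] is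
    guaranteed to be covered. *)
Lemma segjoin A S B L a s : full A S -> [disjoint A & S] -> [disjoint A :|: S & L] ->
  B \subset S -> locally_tough A (S :|: L) -> linked_cover A A (S :|: L) a -> tight A a -> 0 < a ->
  #|S| <= a -> cov S B s -> s < #|A| ->
  exists E, [/\ A :|: B \subset E, E \subset A :|: S & linked_cover E A L (maxn 1 (a - #|S|))].
Proof.
move=> f d dL BS t ms ta a0 lS cB ls.
have dSL : [disjoint S & L].
  by apply/disjointP => x xS xL; apply: (disjointP _ _ dL) xL; rewrite inE xS orbT.
have dAL : [disjoint A & L].
  by apply/disjointP => x xA xL; apply: (disjointP _ _ dL) xL; rewrite inE xA.
case: (ltnP #|S| a) => la.
  exists (A :|: S); split=> //; first by rewrite setUS.
  have -> : maxn 1 (a - #|S|) = a - #|S| by move: la; clear; lia.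
  apply: linked_cover_sub (linked_cover_join ms f d la) => //.
  by apply/subsetP => x; rewrite !inE => /andP[/negbTE->].
have {la}ES : #|S| = a by apply/eqP; rewrite eqn_leq lS.
have -> : maxn 1 (a - #|S|) = 1 by rewrite ES subnn.
have [|w1 [y1 [y1L a1 w1A e1]]] := linked_cover_link ms _; first by rewrite ES; lia.
have lD : 1 < #|A| -> 1 < #|links L (A :\ w1)|.
  by move=> A1; apply: (locally_tough_tightD1 ta a0 f dSL t).
have la : a <= #|A| by have [ps [sp p1 p2 _ _]] := e1; rewrite -sp; apply: pathsys_size p1 p2.
(* A single vertex of [A] is both ends of the path; [s < #|A|] then makes [B] empty. *)
case: (ltnP 1 #|A|) => A1; last first.
  have EA : A = [set w1].
    by apply/esym/eqP; rewrite eqEcard sub1set w1A cards1.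
  have B0 : B = set0.
    have [ps [sp p1 p2 p3]] := cB; case: ps sp p1 p2 p3 => [_ _ _ p3|]; last by move=> ? ? /=; lia.
    by apply/setP => x; rewrite inE; apply/negP => /p3.
  have A0 : A != set0 by apply/set0Pn; exists w1.
  have := locally_tough_links A0 f dSL t.
  have lA : #|A| = 1 by rewrite EA cards1.
  move=> h; have /card_gt0P[y2] : 0 < #|links L A :\ y1|.
    by have := cardsD1 y1 (links L A); case: (y1 \in _) => h'; lia.
  rewrite in_setD1 => /andP[n12] /linksP[y2L [w wA]]; have {wA}-> : w = w1 by move: wA; rewrite EA inE => /eqP.
  move=> a2.
  exists A; split; [by rewrite B0 setU0 subxx | exact: subsetUl |].
  apply: (linked_cover_sub (A:=A)) => //.
  exists [:: (y1, [:: w1], y2)]; split=> //=.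
  - by rewrite /segok /= y1L y2L w1A a1 adj_sym a2.
  - have nin y : y \in L -> y != w1.
      by move=> yL; apply/eqP => yw; apply: (disjointP _ _ dAL) yL; rewrite yw.
    by rewrite /flat /mid /= !inE !negb_or !nin // eq_sym n12 [w1 == _]eq_sym nin.
  - by move=> x; rewrite EA /= !inE.
have [y2 y2l n12] : exists2 y2, y2 \in links L (A :\ w1) & y1 != y2.
  have := lD A1; rewrite (cardsD1 y1) => h; have /card_gt0P[y2] : 0 < #|links L (A :\ w1) :\ y1|.
    by case: (y1 \in _) h => h; lia.
  by rewrite in_setD1 => /andP[n12 y2l]; exists y2; rewrite 1?eq_sym.
case/linksP: y2l => y2L [w2]; rewrite !inE => /andP[n21 w2A] a2.
have n12' : w1 != w2 by rewrite eq_sym.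
have [k' [k1 k2 e2]] := ecov2_pred e1 n12' w2A.
have {}e2 : ecov2 A A w1 w2 (minn a.+1 #|A|) by apply: ecov2_mono e2 _; rewrite leq_min k1 k2 geq_minr.
have {}cB : cov S B (minn a.+1 #|A|).-1.
  apply: (cov_mono cB); move: (cov_size cB) ls; rewrite ES; clear; lia.
have := hpath_AA f d e2 cB.
move/hpath_mseg/(_ dL y1L y2L n12 a1 a2 w1A w2A) => [E [h1 h2 h3]].
by exists E.
Qed.
End CoreLemma.

Section CoreProof.
Variable G : sgraph.
Implicit Types (A B C D E L M N P Q R S T U W X Y Z : {set G}) (x y z w : G).
Implicit Types (p q : seq G) (ps qs : seq (seq G)).

Hypothesis p4_dom : forall a b c d : G, p4 (@adj G) a b c d ->
  forall e, [|| adj e a, adj e b, adj e c | adj e d].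

Lemma links_other L U y : 1 < #|links L U| -> exists2 y', y' != y & y' \in links L U.
Proof.
move=> h; have /card_gt0P[y'] : 0 < #|links L U :\ y|.
  by have := cardsD1 y (links L U); case: (y \in _) => h'; move: h h'; clear; lia.
by rewrite in_setD1 => /andP[? ?]; exists y'.
Qed.

Lemma hpath_mseg_all W L x1 x2 y1 y2 : hpath W W x1 x2 -> [disjoint W & L] ->
  y1 \in L -> y2 \in L -> y1 != y2 -> adj y1 x1 -> adj y2 x2 -> linked_cover W W L 1.
Proof.
move=> h d h1 h2 h3 h4 h5.
have [x1W x2W] : x1 \in W /\ x2 \in W.
  by case: h => t [_ _ s _ <-]; rewrite !s ?mem_last ?mem_head.
have [E [s1 s2]] := hpath_mseg h d h1 h2 h3 h4 h5 x1W x2W.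
by suff -> : E = W by []; apply/eqP; rewrite eqEsubset s1 s2.
Qed.

Lemma hconn_mseg D L : hconn D D -> 1 < #|D| -> [disjoint D & L] -> locally_tough D L -> linked_cover D D L 1.
Proof.
move=> hc D1 d t; have D0 : D != set0 by rewrite -card_gt0 ltnW.
have /set0Pn[w0 w0D] := D0.
have two w : w \in D -> 1 < #|links L (D :\ w)|.
  move=> wD; apply: (locally_tough_tightD1 (tight1 D0) _ (S := set0)) => //.
  - by move=> x y _; rewrite inE.
  - by apply/disjointP => x; rewrite inE.
  - by rewrite set0U.
  - by rewrite cards0.
have [y1 _ /linksP[y1L [x1 x1D a1]]] := links_other w0 (two _ w0D).
have {}x1D : x1 \in D by move: x1D; rewrite inE => /andP[].
have [y2 n2 /linksP[y2L [x2]]] := links_other y1 (two _ x1D).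
rewrite !inE => /andP[n12 x2D] a2.
apply: (hpath_mseg_all (hc _ _ x2D x1D n12) d y2L y1L) => //.
Qed.

Lemma tight_links A S L a : tight A a -> 0 < a -> A != set0 -> full A S -> [disjoint S & L] ->
  locally_tough A (S :|: L) -> 9 * a.+1 <= 2 * (#|S| + #|links L A|).
Proof.
move=> ta a0 A0 f d t; have := locally_tough_tight ta a0 t.
have dU : [disjoint S & links L A].
  by apply/disjointP => x xS /linksP[xL _]; apply: (disjointP _ _ d) xS xL.
by rewrite (links_full L f (subxx _) A0) (cardsUd dU).
Qed.

(** Both parts are independent, so a spanning path alternates and its two ends lie in different
    parts: one link is sought at [A], the other at [B]. *)
Lemma balanced_mseg D A B L a : joins D A B -> [disjoint D & L] -> locally_tough D L ->
  tight A a -> tight B a -> #|A| = a -> #|B| = a -> linked_cover D D L 1.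
Proof.
move=> jn d t ta tb Ea Eb; have [p f] := jn; have [AD BD] := parts_sub p.
have [_ la lb] := parts_card p.
case: (p) => A0 B0 dAB ED; rewrite Ea in la.
have dA : [disjoint A & L] by apply: disjointWl d.
have dB : [disjoint B & L] by apply: disjointWl d.
have tA := locally_tough_join jn dB t; have tB := locally_tough_join (joins_sym jn) dA t.
have lA := tight_links ta la A0 f dB tA.
have lB := tight_links tb la B0 (fullC f) dA tB.
have /card_gt0P[y1 /linksP[y1L [x1 x1A a1]]] : 0 < #|links L A|.
  by move: lA; rewrite Eb; clear; lia.
have [|y2 n12 /linksP[y2L [x2 x2B a2]]] := @links_other L B y1.
  by move: lB la; rewrite Ea; clear; lia.
have e1 : ecov1 A A x1 a.
  by rewrite -Ea; apply: (ecov1_card (a := #|A|)) => //; [exact: cov_singles | rewrite geq_minr leqnn].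
have e2 : ecov1 B B x2 a.
  by rewrite -Eb; apply: (ecov1_card (a := #|B|)) => //; [exact: cov_singles | rewrite geq_minr leqnn].
have := hpath_AS f dAB e1 e2; rewrite ED => h.
by apply: (hpath_mseg_all h d y1L y2L) => //; rewrite eq_sym.
Qed.

(** [C] may take its links anywhere in [L], but takes at most [2 kc] of them, so [2 kn] vertices of
    [K] stay free for [N]. *)
Lemma split_mseg D C N L K kc kn : splits D C N -> [disjoint D & L] -> linked_cover C C L kc ->
  cov N N kn -> full N K -> K \subset L -> (kc + kn).*2 <= #|K| -> linked_cover D D L (kc + kn).
Proof.
move=> sp d mc cn f KL l; have [p _] := sp; have [CD ND] := parts_sub p.
have [M [ML lM {}mc]] := linked_cover_used mc; have [_ _ dCN ED] := p.
have KM : K :\: M \subset L by apply: subset_trans KL; apply: subsetDl.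
have mn : linked_cover N N (K :\: M) kn.
  apply: cov_mseg => //.
  - by move=> x y xN; rewrite inE => /andP[_ yK]; apply: f.
  - by apply: disjointWl ND _; apply: disjointWr KM d.
  - have := cardsU_le M (K :\: M).
    have : #|K| <= #|M :|: (K :\: M)|.
      by apply/subset_leq_card/subsetP => x xK; rewrite !inE xK andbT orbN.
    by move: lM l; clear; lia.
have {}mc := linked_cover_sub CD (subxx M) mc; have {}mn := linked_cover_sub ND (subxx (K :\: M)) mn.
have := linked_cover_union mc mn; rewrite ED => h.
apply: linked_cover_sub (h _) => //; first by rewrite subUset ML.
apply/disjointP => x; rewrite !inE => /orP[xC|xM] /orP[xN|/andP[xM' xK]].
- exact: (disjointP _ _ dCN) xC xN.
- by apply: (disjointP _ _ d) (subsetP CD x xC) _; apply: (subsetP KL).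
- by apply: (disjointP _ _ d) (subsetP ND x xN) (subsetP ML x xM).
- by rewrite xM in xM'.
Qed.

(** The linked form of [jung]. The pair [L], [rho] is what survives the induction: for a join, the
    other part enters the link set of each part and later becomes inner vertices; for a split, [rho]
    serves as an end of the induced paths in [laminar_split]. *)
Lemma core D L rho : p4f D -> D != set0 -> {in D, forall x, ~~ adj rho x} -> [disjoint D & L] ->
  {in L, forall y, D \subset nbr y \/ adj y rho} -> locally_tough D L ->
  exists k, path_number D k /\ linked_cover D D L k.
Proof.
have [n] := ubnP #|D|; elim: n D L => // n IH D L ln pD D0 rD d LP t.
case: (ltnP 1 #|D|) => D1; last first.
  have E1 : #|D| = 1 by apply/eqP; rewrite eqn_leq D1 card_gt0.
  exists 1; have p1 := path_number_single E1; split=> //.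
  apply: (linked_cover_sub (M := links L D) (subxx D)); first by apply/subsetP => y /linksP[].
  apply: cov_mseg; first by case: p1.
  - move: E1 => /eqP/cards1P[x ->] z y; rewrite inE => /eqP-> /linksP[_ [w]].
    by rewrite inE => /eqP->; rewrite adj_sym.
  - by apply/disjointP => x xD /linksP[xL _]; apply: (disjointP _ _ d) xD xL.
  - by have := locally_tough_tight (tight1 D0) isT t; clear; lia.
have sub C : C \subset D -> {in C, forall x, ~~ adj rho x} by move=> /subsetP s x /s/rD.
have [sD|[A [B jn]]] := cographP pD D1.
  have [|C [N [sp CN]]] := laminar_split p4_dom rD _ sD (L0 := links L D).
    by move=> y /linksP[yL ex]; split=> //; apply: LP.
  have [p an] := sp; have [CD ND] := parts_sub p; have [cD lC lN] := parts_card p.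
  have [C0 N0 dCN ED] := p.
  have half C' N' : splits D C' N' -> #|C'| < n -> exists k, path_number C' k /\ linked_cover C' C' L k.
    move=> sp' l; have [p' _] := sp'; have [CD' _] := parts_sub p'.
    apply: IH => //; first exact: p4f_sub pD.
    - by case: p'.
    - exact: sub.
    - exact: disjointWl d.
    - by move=> y /LP[h|]; [left; apply: subset_trans h | right].
    - exact: locally_tough_split sp' t.
  have [kc [pc mc]] : exists k, path_number C k /\ linked_cover C C L k.
    by apply: (half _ _ sp); move: cD ln lN; clear; lia.
  have [kn [pn mn]] : exists k, path_number N k /\ linked_cover N N L k.
    by apply: (half _ _ (splits_sym sp)); move: cD ln lC; clear; lia.
  have pk := path_number_union sp pc pn; exists (kc + kn); split=> //.
  have kc0 := path_number_gt0 pc C0.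
  have lt : 9 * (kc + kn).+1 <= 2 * #|links L D|.
    by apply: locally_tough_tight t; [case: pk | move: kc0; clear; lia].
  pose F := [set y in links L D | C \subset nbr y]; pose K := links L D :\: F.
  have FL : F \subset L by apply/subsetP => y; rewrite inE => /andP[/linksP[]].
  have KL : K \subset L by apply/subsetP => y; rewrite inE => /andP[_ /linksP[]].
  have cFK : #|links L D| <= #|F| + #|K|.
    apply: leq_trans (cardsU_le _ _); apply/subset_leq_card/subsetP => x xL.
    by rewrite in_setU in_setD xL andbT orbN.
  have fF : full C F.
    by move=> x y xC; rewrite inE => /andP[_ /subsetP/(_ x xC)]; rewrite inE adj_sym.
  have fK : full N K.
    move=> x y xN; rewrite in_setD => /andP[nC yL].
    case: (CN y yL) => /subsetP h; last by have := h x xN; rewrite inE adj_sym.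
    by move/subsetP: h => h; rewrite inE yL h in nC.
  (* By toughness [F] and [K] are not both scarce: if one is too small for its own side, the other
     offers links for both sides. Otherwise each side has its own supply. *)
  case: (ltnP #|F| kc.*2) => [lF|lF].
    by apply: (split_mseg sp d mc _ fK KL); [case: pn | move: lF cFK lt; clear; lia].
  case: (ltnP #|K| kn.*2) => [lK|lK].
    rewrite addnC; apply: (split_mseg (splits_sym sp) d mn _ fF FL); first by case: pc.
    by move: lK cFK lt; clear; lia.
  have [[cc _] [cn _]] := (pc, pn).
  have dC : [disjoint C & F] by apply: disjointWl CD _; apply: disjointWr FL d.
  have dN : [disjoint N & K] by apply: disjointWl ND _; apply: disjointWr KL d.
  have := cov_mseg cc fF dC lF => /(linked_cover_sub CD (subxx _)) m1.
  have := cov_mseg cn fK dN lK => /(linked_cover_sub ND (subxx _)) m2.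
  have := linked_cover_union m1 m2; rewrite ED => h.
  apply: linked_cover_sub (h _) => //; first by rewrite subUset FL.
  apply/disjointP => x; rewrite !in_setU => /orP[xC|xF] /orP[xN|xK].
  - exact: (disjointP _ _ dCN) xC xN.
  - by apply: (disjointP _ _ d) (subsetP CD x xC) (subsetP KL x xK).
  - by apply: (disjointP _ _ d) (subsetP ND x xN) (subsetP FL x xF).
  - by move: xK; rewrite in_setD xF.
have [p f] := jn; have [AD BD] := parts_sub p; have [cD lA lB] := parts_card p.
have [A0 B0 dAB ED] := p.
have dA : [disjoint A & L] by apply: disjointWl d.
have dB : [disjoint B & L] by apply: disjointWl d.
have tA := locally_tough_join jn dB t; have tB := locally_tough_join (joins_sym jn) dA t.
have half A' B' : joins D A' B' -> #|A'| < n -> exists k, path_number A' k /\ linked_cover A' A' (B' :|: L) k.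
  move=> [p' f'] l; have [AD' BD'] := parts_sub p'; have [A0' _ dAB' _] := p'.
  apply: IH => //; first exact: p4f_sub pD.
  - exact: sub.
  - apply/disjointP => x xA; rewrite inE => /orP[xB|xL]; first exact: (disjointP _ _ dAB') xA xB.
    exact: (disjointP _ _ d) (subsetP AD' x xA) xL.
  - move=> y; rewrite inE => /orP[yB|/LP[h|]]; [left | left | by right].
      by apply/subsetP => x xA; rewrite inE adj_sym f'.
    exact: subset_trans h.
  - by apply: locally_tough_join t => //; apply: disjointWl d.
have [a [pa ma]] : exists k, path_number A k /\ linked_cover A A (B :|: L) k.
  by apply: half jn _; move: cD ln lB; clear; lia.
have [b [pb mb]] : exists k, path_number B k /\ linked_cover B B (A :|: L) k.
  by apply: half (joins_sym jn) _; move: cD ln lA; clear; lia.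
have a0 := path_number_gt0 pa A0; have b0 := path_number_gt0 pb B0.
have join1 A' B' a' : joins D A' B' -> #|B'| < a' -> linked_cover A' A' (B' :|: L) a' ->
    linked_cover D D L (a' - #|B'|).
  move=> [p' f'] l m; have [AD' _] := parts_sub p'; have [_ _ dAB' ED'] := p'.
  have := linked_cover_join m f' dAB' l; rewrite ED'; apply: linked_cover_sub => //.
  by apply/subsetP => x; rewrite !inE; case: (x \in B').
have [[ca ta] [cb tb]] := (pa, pb).
have d' := d; rewrite -ED in d'.
case: (path_number_join jn pa pb) => [[l pk]|[l pk]|[l1 l2 pk]].
- by exists (a - #|B|); split=> //; apply: (join1 _ _ _ jn l ma).
- by exists (b - #|A|); split=> //; apply: (join1 _ _ _ (joins_sym jn) l mb).
exists 1; split=> //.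
(* When [a' = #|B'|], inserting [B'] leaves exactly one segment, and all of [B'] is covered. *)
have one A' B' a' b' : joins D A' B' -> linked_cover A' A' (B' :|: L) a' -> tight A' a' -> 0 < a' ->
    locally_tough A' (B' :|: L) -> cov B' B' b' -> a' = #|B'| -> b' < #|A'| -> linked_cover D D L 1.
  move=> [p' f'] m t' a0' tg cb' ea lb'; have [_ _ dAB' ED'] := p'; rewrite -ED' in d.
  have [|E [s1 s2 m1]] := segjoin f' dAB' d (subxx B') tg m t' a0' _ cb' lb'; first by rewrite ea.
  have EE : E = D by apply/eqP; rewrite eqEsubset -ED' s1 s2.
  by have [s3 _] := parts_sub p'; move: m1; rewrite EE -ea subnn; apply: linked_cover_sub.
(* Equality on one side is settled by [one]; on both sides it forces [#|A| = a = #|B|]; two strict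
   inequalities make [D] Hamilton-connected. *)
case: (ltnP a #|B|) => la; last first.
  have {la l1}Ea : a = #|B| by apply/eqP; rewrite eqn_leq l1.
  case: (ltnP b #|A|) => lb; first exact: one jn ma ta a0 tA cb Ea lb.
  apply: (balanced_mseg (a := a) jn d t ta) => //.
    by apply: tight_le tb; move: (path_number_le pa) lb; clear; lia.
  by apply/eqP; rewrite eqn_leq (path_number_le pa) andbT Ea; apply: leq_trans lb (path_number_le pb).
case: (ltnP b #|A|) => lb; last first.
  have {lb l2}Eb : b = #|A| by apply/eqP; rewrite eqn_leq l2.
  exact: one (joins_sym jn) mb tb b0 tB ca Eb la.
have := hconn_join f dAB ca cb la lb; rewrite ED => hc.
exact: hconn_mseg.
Qed.
End CoreProof.

(** * Inserting vertices into cycles *)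

Lemma gap (T : eqType) (a b : pred T) s x : a x ->
  (exists l1 y ys z l2, [/\ x :: s = l1 ++ y :: ys ++ z :: l2, a y, a z &
     all (fun v => ~~ a v && ~~ b v) ys]) \/ count a s <= count b s.
Proof.
have [n] := ubnP (size s); elim: n s x => // n IH s x ln ax.
have [hs|ns] := boolP (has (predU a b) s); last first.
  right; suff -> : count a s = 0 by [].
  by apply/eqP; rewrite -leqn0 leqNgt -has_count; apply: contra ns; apply: sub_has => v /= ->.
pose ys := take (find (predU a b) s) s; pose z := nth x s (find (predU a b) s).
pose s' := drop (find (predU a b) s).+1 s.
have Es : s = ys ++ z :: s' by rewrite -drop_nth -?has_find // cat_take_drop.
have yP : all (fun v => ~~ a v && ~~ b v) ys.
  apply/(all_nthP x) => i; rewrite size_take -has_find hs => li.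
  by rewrite nth_take // -negb_or; apply/negbT; apply: (before_find x li).
have := nth_find x hs; rewrite -/z /= => zP.
have [az|az] := boolP (a z).
  by left; exists [::], x, ys, z, s'; rewrite Es.
rewrite (negbTE az) /= in zP.
have Cs P : count P s = count P ys + (P z + count P s') by rewrite {1}Es count_cat.
rewrite (Cs a) (Cs b) zP (negbTE az).
have c0 : count a ys = 0.
  apply/eqP; rewrite -leqn0 leqNgt -has_count -all_predC.
  by apply: sub_all yP => v /andP[].
have [ha|na] := boolP (has a s'); last first.
  by right; move: na; rewrite has_count c0; clear; lia.
pose ms := take (find a s') s'; pose x' := nth x s' (find a s').
pose s'' := drop (find a s').+1 s'.
have Es' : s' = ms ++ x' :: s'' by rewrite -drop_nth -?has_find // cat_take_drop.
have m0 : count a ms = 0.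
  apply/eqP; rewrite -leqn0 leqNgt -has_count -all_predC; apply/(all_nthP x) => i.
  rewrite size_take -has_find ha => li /=.
  by rewrite nth_take //; apply/negbT; apply: (before_find x li).
have ax' : a x' by apply: nth_find.
have [|[l1 [y [us [v [l2 [E1 h1 h2 h3]]]]]]|h] := IH s'' x' _ ax'.
- by move: ln; rewrite {1}Es {1}Es' !size_cat /= size_cat /=; clear; lia.
- left; exists (x :: ys ++ z :: ms ++ l1), y, us, v, l2; split=> //.
  by rewrite {1}Es {1}Es' E1 /= -!catA /= -!catA.
- have Cs' P : count P s' = count P ms + (P x' + count P s'') by rewrite {1}Es' count_cat.
  by right; rewrite c0 (Cs' a) (Cs' b) ax' m0; move: h; clear; lia.
Qed.

Lemma sorted_cut (T : eqType) (e : rel T) s y t :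
  sorted e (s ++ y :: t) = sorted e (rcons s y) && path e y t.
Proof. by case: s => //= x s; rewrite cat_path rcons_path /= andbA. Qed.

Section Absorb.
Variable G : sgraph.
Implicit Types (A B C D E L M N P Q R S T U W X Y Z : {set G}) (x y z w : G).
Implicit Types (p q c s : seq G) (ps qs : seq (seq G)).

Lemma uniq_size_card A c : {subset A <= c} -> #|A| <= size c.
Proof.
move=> h; rewrite cardE; apply: uniq_leq_size; first exact: enum_uniq.
by move=> x; rewrite mem_enum => /h.
Qed.

(* If [|S| < |A|], then two vertices of [A] are consecutive among the vertices of [A u S] on the cycle, and [b] fits
   between them. *)
Lemma absorb1 A S c b : ucycle (@adj G) c -> {subset A :|: S <= c} -> #|S| < #|A| ->
  b \notin c -> {in A, forall x, adj b x} ->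
  exists c', [/\ ucycle (@adj G) c', {subset A :|: S <= c'} & b \in c'].
Proof.
move=> uc sub l bc bA.
have /card_gt0P[u uA] : 0 < #|A| by apply: leq_ltn_trans l.
have uin : u \in c by apply: sub; rewrite inE uA.
have [i s Es] := rot_to uin.
have {uc} : ucycle (@adj G) (u :: s) by rewrite -Es rot_ucycle.
have mE : c =i u :: s by move=> x; rewrite -Es mem_rot.
have {}bc : b \notin u :: s by rewrite -mE.
have {}sub : {subset A :|: S <= u :: s} by move=> x /sub; rewrite mE.
rewrite /ucycle /= => /andP[pa un].
(* Repeating [u] at the end turns the cycle into a sequence, so that the gap closing the cycle is
   examined too. *)
have [[l1 [y [ys [z [l2 [E1 yA zA yo]]]]]]|h] := gap [in S] (rcons s u) uA; last first.
  have pr : perm_eq (rcons s u) (u :: s) by rewrite perm_rcons.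
  rewrite !(permP pr) in h.
  have h1 : count [in S] (u :: s) <= #|S| by apply: count_card.
  have h2 : #|A| <= count [in A] (u :: s).
    rewrite -size_filter; apply: uniq_size_card => x xA.
    by rewrite mem_filter xA sub // inE xA.
  by move: (leq_trans h2 (leq_trans h h1)); rewrite leqNgt l.
(* The vertices [ys] between [y] and [z] are replaced by [b]; none of them lies in [A :|: S], and
   [u] is still the first and last vertex. *)
have [s1 E2] : exists s1, l1 ++ [:: y, b, z & l2] = u :: rcons s1 u.
  have [l1' E1'] : exists l1', l1 ++ [:: y; b] = u :: l1'.
    by case: (l1) E1 => [|v l0] /= [-> _]; eexists.
  have [l2' E2'] : exists l2', z :: l2 = rcons l2' u.
    exists (belast z l2); rewrite lastI; congr rcons.
    by have := congr1 (last u) E1; rewrite /= last_rcons last_cat /= last_cat.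
  by exists (l1' ++ l2'); rewrite rcons_cat -cat_cons -E1' -E2' -catA.
have pa' : path (@adj G) u (rcons s1 u).
  rewrite -[path _ _ _]/(sorted _ (u :: rcons s1 u)) -E2.
  have : sorted (@adj G) (u :: rcons s u) by [].
  rewrite E1 !sorted_cut => /andP[-> /=]; rewrite cat_path /= => /and3P[_ _ ->].
  by rewrite adj_sym !bA.
exists (u :: s1); split.
- rewrite /ucycle /= pa' andTb -[_ && _]/(uniq (u :: s1)); apply/uniqPc => v.
  have := congr1 (count_mem v) E2; have := congr1 (count_mem v) E1.
  have h1 : count_mem v (u :: s) + (b == v) <= 1.
    have {}un : uniq (u :: s) := un; move/uniqPc/(_ v): un; have [<-|_] := eqVneq b v; last by rewrite addn0.
    by rewrite (count_memPn bc).
  move: h1; rewrite -!cats1; do !rewrite ?count_cat /=; nat_lia.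
- move=> x xAS; have xs := sub x xAS.
  have : x \in u :: rcons s1 u.
    have : x \in u :: rcons s u by rewrite in_cons mem_rcons xs orbT.
    rewrite -E2 E1 !(mem_cat, in_cons) => /orP[->//|/orP[->|/orP[xy|->]]]; rewrite ?orbT //.
    have /andP[/negP n1 /negP n2] := allP yo x xy.
    by move: xAS; rewrite inE => /orP[].
  by rewrite in_cons mem_rcons => /orP[/eqP->|]; rewrite ?mem_head.
- have : b \in u :: rcons s1 u by rewrite -E2 mem_cat !inE eqxx !orbT.
  by rewrite in_cons mem_rcons => /orP[/eqP->|]; rewrite ?mem_head.
Qed.

Lemma absorb A R B : full A B -> #|R| + #|B| < #|A| ->
  has_cycle_through (A :|: R) -> has_cycle_through (A :|: R :|: B).
Proof.
move=> f l [c0 [c03 uc0 sub0]].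
have [B0|/set0Pn[b0 b0B]] := eqVneq B set0; first by exists c0; split=> // x; rewrite B0 setU0; exact: sub0.
suff [c [uc sub]] : exists c, ucycle (@adj G) c /\ {subset A :|: R :|: B <= c}.
  exists c; split=> //.
  have lA : #|A :|: R :|: B| <= size c by apply: uniq_size_card.
  have dAB : [disjoint A & B].
    by apply/disjointP => x xA xB; have := f x x xA xB; rewrite adj_irr.
  have B0 : 0 < #|B| by apply/card_gt0P; exists b0.
  have : #|A :|: B| <= #|A :|: R :|: B| by rewrite subset_leq_card // setSU // subsetUl.
  by rewrite cardsUd //; move: l lA B0; clear; lia.
(* Rerouting may drop vertices outside the protected set, so the vertices of [B] already on the
   cycle are protected along with [R]. *)
have {sub0} : {subset A :|: (R :|: (B :&: [set x in c0])) <= c0}.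
  by move=> x; rewrite !inE => /or3P[xA|xR|/andP[]//]; apply: sub0; rewrite inE ?xA ?xR ?orbT.
have [n] := ubnP #|B :\: [set x in c0]|; elim: n {c03} c0 uc0 => // n IH c uc ln sub.
have [h|/subsetPn[b bB]] := boolP (B \subset [set x in c]).
  exists c; split=> // x; rewrite !inE => /orP[h'|xB]; last by have := subsetP h x xB; rewrite inE.
  by apply: sub; rewrite !inE orbA h'.
rewrite inE => bc; have [||c' [uc' sub' bc']] := absorb1 uc sub _ bc.
- apply: leq_ltn_trans (leq_trans (cardsU_le _ _) _) l; rewrite leq_add2l.
  exact/subset_leq_card/subsetIl.
- by move=> x xA; rewrite adj_sym f.
have incl x : x \in B -> x \in c -> x \in c' by move=> xB xc; apply: sub'; rewrite !inE xB xc !orbT.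
apply: (IH c') => //.
- apply: leq_trans (_ : #|B :\: [set x in c]| <= n) => //.
  apply/proper_card/properP; split.
    by apply/subsetP => x; rewrite !inE => /andP[xc' xB]; rewrite xB andbT; apply: contra xc'; apply: incl.
  by exists b; rewrite !inE ?bc' // bB bc.
- move=> x; rewrite !inE => /or3P[xA|xR|/andP[]//]; apply: sub'; rewrite !inE ?xA ?xR ?orbT //.
Qed.

End Absorb.

(** * Toughness by labellings, and forbidden subgraphs by vertices *)

Definition tough9 (G : sgraph) := forall (T : finType) (X : {set G}) (f : G -> T),
  (forall x y, x \notin X -> y \notin X -> adj x y -> f x = f y) ->
  1 < #|f @: ~: X| -> 9 * #|f @: ~: X| <= 2 * #|X|.

Lemma labels_components (G : sgraph) (T : finType) (X : {set G}) (f : G -> T) :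
  (forall x y, x \notin X -> y \notin X -> adj x y -> f x = f y) ->
  #|f @: ~: X| <= ncomponents (delete X).
Proof.
move=> h; set H := delete X; set e := @adj H.
have cs : connect_sym e by apply: sym_connect_sym; apply: adj_sym.
have fc u v : connect e u v -> f (val u) = f (val v).
  case/connectP => p + ->; elim: p u => //= w p IH u /andP[uw /IH <-].
  by apply: h uw; [have := valP u | have := valP w]; rewrite inE.
apply: leq_trans (leq_imset_card (fun u : H => f (val u)) (predI (roots e) predT)).
apply/subset_leq_card/subsetP => l /imsetP[x xX {l}->].
apply/imsetP; exists (fingraph.root e (Sub x xX)); first by rewrite !inE roots_root.
by rewrite -(fc _ _ (connect_root e _)).
Qed.

Lemma tough_tough9 (R : realType) (G : sgraph) : tough (9%:R / 2%:R : R)%R G -> tough9 G.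
Proof.
move=> t T X f h l; have ln := labels_components h.
set n := ncomponents _ in ln.
have n2 : 1 < n by apply: leq_trans ln.
suff : 9 * n <= 2 * #|X| by move: ln; clear; lia.
have : ((9%:R / 2%:R : R)%:E <= ((#|X|%:R / n%:R)%R)%:E)%E.
  apply: le_trans t _.
  exact: bigmin_le_cond.
have n0 : 0 < n by apply: ltnW.
rewrite lee_fin ler_pdivrMr ?ltr0n // mulrAC ler_pdivlMr ?ltr0n //.
by rewrite -!natrM ler_nat [X in _ <= X]mulnC.
Qed.

Lemma embed_not_free (H G : sgraph) (g : H -> G) : injective g ->
  (forall i j, adj (g i) (g j) = adj i j) -> ~ graph_free H G.
Proof.
move=> gi ga fr; apply: (fr [set x in codom g]).
have mem (u : induced [set x in codom g]) : val u \in codom g.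
  by have := valP u; rewrite inE.
exists (fun u => iinv (mem u)) => [|u v]; last by rewrite -ga !f_iinv.
have mem' i : g i \in [set x in codom g] by rewrite inE codom_f.
exists (fun i => Sub (g i) (mem' i)) => [u|i].
  by apply: val_inj; rewrite /= f_iinv.
by apply: gi; rewrite f_iinv.
Qed.

Lemma p4_uniq (G : sgraph) (a b c d : G) : p4 (@adj G) a b c d -> uniq [:: a; b; c; d].
Proof.
case/and5P=> ab bc cd nac /andP[nbd nad]; rewrite /= !inE !negb_or !andbT.
have ir (x y : G) : adj x y -> x != y by move=> h; apply: contraTneq h => ->; rewrite adj_irr.
rewrite (ir a b ab) (ir b c bc) (ir c d cd) /= ?andbT; apply/andP; split; first apply/andP; first split.
- by apply: contraNneq nad => ->.
- by apply: contraNneq nac => ->; rewrite adj_sym.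
- by apply: contraNneq nad => <-.
Qed.

Lemma p4_free_of (G : sgraph) : graph_free P4 G -> forall a b c d : G, ~~ p4 (@adj G) a b c d.
Proof.
move=> fr a b c d; apply/negP => h; have u := p4_uniq h.
apply: (@embed_not_free P4 G (fun i : 'I_4 => nth a [:: a; b; c; d] i) _ _ fr).
  by move=> i j /eqP; rewrite nth_uniq // => /eqP/val_inj.
case/and5P: h=> ab bc cd nac /andP[nbd nad].
have sy (x y : G) t : adj x y = t -> adj y x = t by rewrite adj_sym.
move/negbTE: nac => nac; move/negbTE: nbd => nbd; move/negbTE: nad => nad.
case=> [[|[|[|[|//]]]] hi] [[|[|[|[|//]]]] hj] //=;
  rewrite ?adj_irr /path_adj //=; apply/sy; assumption.
Qed.

Lemma p4_dom_of (G : sgraph) : graph_free P4_P1 G -> forall a b c d : G, p4 (@adj G) a b c d ->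
  forall e, [|| adj e a, adj e b, adj e c | adj e d].
Proof.
move=> fr a b c d h e; have u := p4_uniq h; apply: contraT; rewrite !negb_or => /and4P[na nb nc nd].
pose g (i : P4_P1) := match i with inl i => nth a [:: a; b; c; d] (i : 'I_4) | inr _ => e end.
case/and5P: h=> ab bc cd nac /andP[nbd nad].
exfalso; apply: (@embed_not_free P4_P1 G g _ _ fr).
  have en : e \notin [:: a; b; c; d].
    rewrite !inE !negb_or; apply/and4P; split.
    - by apply: contraNneq nb => ->.
    - by apply: contraNneq nc => ->.
    - by apply: contraNneq nd => ->.
    - by apply: contraNneq nc => ->; rewrite adj_sym.
  move=> [i|i] [j|j] /=.
  - by move=> /eqP; rewrite nth_uniq // => /eqP/val_inj->.
  - by move=> E; rewrite -E mem_nth in en.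
  - by move=> E; rewrite E mem_nth in en.
  - by rewrite !ord1.
have sy (x y : G) t : adj x y = t -> adj y x = t by rewrite adj_sym.
move/negbTE: nac => nac; move/negbTE: nbd => nbd; move/negbTE: nad => nad.
move/negbTE: na => na; move/negbTE: nb => nb; move/negbTE: nc => nc; move/negbTE: nd => nd.
case=> [[[|[|[|[|//]]]] hi]|[[|//] hi]] [[[|[|[|[|//]]]] hj]|[[|//] hj]] //=;
  rewrite ?adj_irr /path_adj //=; apply/sy; assumption.
Qed.

Lemma crossing (T : eqType) (a b : pred T) s x : a x -> b (last x s) -> {in x :: s, forall z, ~~ (a z && b z)} ->
  exists l1 y ys z l2, [/\ x :: s = l1 ++ y :: ys ++ z :: l2, a y, b z &
     all (fun v => ~~ a v && ~~ b v) ys].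
Proof.
have [n] := ubnP (size s); elim: n s x => // n IH s x ln ax bl ab.
have hs : has (predU a b) s.
  case: s bl ab {ln IH} => [/= bx /(_ x)|z s bl _]; first by rewrite mem_head ax bx => /(_ isT).
  by apply/hasP; exists (last z s); rewrite ?mem_last //=; rewrite /= in bl; rewrite bl orbT.
pose ys := take (find (predU a b) s) s; pose z := nth x s (find (predU a b) s).
pose s' := drop (find (predU a b) s).+1 s.
have Es : s = ys ++ z :: s' by rewrite -drop_nth -?has_find // cat_take_drop.
have yP : all (fun v => ~~ a v && ~~ b v) ys.
  apply/(all_nthP x) => i; rewrite size_take -has_find hs => li.
  by rewrite nth_take // -negb_or; apply/negbT; apply: (before_find x li).
have := nth_find x hs; rewrite -/z /= => zP.
have [bz|nbz] := boolP (b z).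
  by exists [::], x, ys, z, s'; rewrite {1}Es.
rewrite (negbTE nbz) orbF in zP.
have [|||l1 [y [us [v [l2 [E1 h1 h2 h3]]]]]] := IH s' z _ zP.
- by move: ln; rewrite {1}Es size_cat /=; clear; lia.
- by move: bl; rewrite {1}Es last_cat.
- by move=> v vs; apply: ab; rewrite Es in_cons mem_cat vs !orbT.
exists (x :: ys ++ l1), y, us, v, l2; split=> //.
by rewrite {1}Es E1 /= -!catA.
Qed.

(** * Closing cycles *)

Section Links.
Variable G : sgraph.
Implicit Types (A B C D E L M N P Q R S T U W X Y Z : {set G}) (x y z w : G).
Implicit Types (p q c s : seq G) (ps qs : seq (seq G)).

Lemma cyc_two W1 W2 C1 C2 x1 x2 y1 y2 p q : hpath W1 C1 x1 y1 -> hpath W2 C2 x2 y2 ->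
  [disjoint W1 & W2] -> x1 != y1 -> uniq (p ++ q) ->
  {in p ++ q, forall x, x \notin W1 :|: W2} ->
  path (@adj G) x1 (rcons p x2) -> path (@adj G) y1 (rcons q y2) ->
  has_cycle_through (C1 :|: C2).
Proof.
move=> [t1 [p1 u1 s1 c1 l1]] /hpath_sym[t2 [p2 u2 s2 c2 l2]] d n12 upq out pp pq.
exists (x1 :: t1 ++ q ++ y2 :: t2 ++ rev p); split.
(* The ends [x1] and [y1] are different, so the first path has two vertices and the cycle at least
   three. *)
- case: t1 l1 {p1 u1 s1 c1} => [/= e|z t1 _]; first by rewrite e eqxx in n12.
  by rewrite /= !size_cat /=; nat_lia.
- apply/andP; split.
    have pr : path (@adj G) x2 (rcons (rev p) x1).
      have := rev_path (@adj G) x1 (rcons p x2).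
      rewrite last_rcons belast_rcons rev_cons => ->.
      by rewrite (eq_path (e' := @adj G)) // => u v; apply: adj_sym.
    rewrite /= rcons_cat cat_path p1 l1 rcons_cat rcons_cons -cat_rcons cat_path pq /= last_rcons.
    by rewrite rcons_cat cat_path p2 l2 pr.
  apply/uniqPc => v.
  have pr : perm_eq (x1 :: t1 ++ q ++ y2 :: t2 ++ rev p) ((x1 :: t1) ++ (y2 :: t2) ++ (p ++ q)).
    by count_lia.
  rewrite (permP pr); apply/uniqPc; rewrite cat_uniq u1 cat_uniq u2 upq !andTb andbT.
  apply/andP; split; rewrite -all_predC; apply/allP => x.
    rewrite mem_cat => /orP[/s2 xW|/out]; last first.
      by apply: contra => /s1 xW; rewrite inE xW.
    by apply/negP => /s1 xW1; apply: (disjointP _ _ d) xW1 xW.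
  by move=> /out; apply: contra => /s2 xW; rewrite inE xW orbT.
move=> x; rewrite inE => /orP[/c1|/c2] h.
    by rewrite -cat_cons mem_cat h.
  by rewrite -cat_cons mem_cat mem_cat -cat_cons (mem_cat _ _ (rev p)) h !orbT.
Qed.

Hypothesis tG : tough9 G.

(** Reachability from [u] would be a labelling with two values, which requires at least 9 deleted
    vertices. *)
Lemma tough_connected (X : {set G}) u v : #|X| <= 8 -> u \notin X -> v \notin X ->
  connect (fun x y => [&& adj x y, x \notin X & y \notin X]) u v.
Proof.
move=> lX uX vX; set e := fun x y => _; apply: contraT => nc.
have := @tG _ X (connect e u) _ _.
have im b : b \in connect e u @: ~: X.
  by case: b; apply/imsetP; [exists u | exists v]; rewrite ?inE // ?connect0 // (negbTE nc).
have E : #|connect e u @: ~: X| = 2.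
  by rewrite -card_bool; apply: eq_card => b; rewrite im.
rewrite E => /(_ _ isT) h; suff : 9 * 2 <= 2 * #|X| by move: lX; clear; lia.
apply: h => x y xX yX xy; apply/idP/idP => h; apply: connect_trans h _; apply: connect1.
  by rewrite /e xy xX yX.
by rewrite /e adj_sym xy xX yX.
Qed.

(** The edge [u1 u2] is one connection; deleting its ends keeps the graph connected, which yields a
    second, disjoint one. Hamilton-connectedness closes the cycle on both sides. *)
Lemma link W1 W2 C1 C2 u1 u2 : hconn W1 C1 -> hconn W2 C2 -> [disjoint W1 & W2] ->
  1 < #|W1| -> 1 < #|W2| -> u1 \in W1 -> u2 \in W2 -> adj u1 u2 ->
  has_cycle_through (C1 :|: C2).
Proof.
move=> h1 h2 d l1 l2 u1W u2W u12.
have other (W : {set G}) u : u \in W -> 1 < #|W| -> exists2 v, v \in W & v != u.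
  move=> uW lW; have /card_gt0P[v] : 0 < #|W :\ u| by have := cardsD1 u W; rewrite uW; lia.
  by rewrite !inE => /andP[? ?]; exists v.
have [v1 v1W n1] := other _ _ u1W l1; have [v2 v2W n2] := other _ _ u2W l2.
have n12 (x y : G) : x \in W1 -> y \in W2 -> x != y.
  by move=> xW yW; apply: contraTneq yW => <-; apply/negP; apply: (disjointP _ _ d).
have lX : #|[set u1; u2]| <= 8 by rewrite cards2; case: (_ == _).
have vX : v1 \notin [set u1; u2] by rewrite !inE negb_or n1 n12.
have vX' : v2 \notin [set u1; u2] by rewrite !inE negb_or n2 eq_sym n12.
have /connectP[p0 pp0 e0] := tough_connected lX vX vX'.
case/shortenP: pp0 e0 => p pp up _ e0.
have pX : {in v1 :: p, forall x, x \notin [set u1; u2]}.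
  apply/allP; rewrite /= vX; move: (pp); clear; elim: p v1 => //= z p IH v /andP[/and3P[_ _ ->]].
  exact: IH.
have pa : path (@adj G) v1 p by apply: sub_path pp => x y /and3P[].
(* Only a section of the path with its interior outside both sets is used. *)
have [||l1' [y [ys [z [l2' [E1 yW zW yo]]]]]] := @crossing _ [in W1] [in W2] p v1 v1W.
- by rewrite -e0.
- by move=> x _; apply/negP => /andP[]; apply: (disjointP _ _ d).
have {}pa : path (@adj G) y (rcons ys z).
  have : sorted (@adj G) (v1 :: p) by [].
  by rewrite E1 sorted_cut cat_path rcons_path /= => /and4P[_ -> ->].
have uy : u1 != y.
  by have := pX y; rewrite E1 mem_cat mem_head orbT !inE negb_or eq_sym => /(_ isT)/andP[].
have uz : u2 != z.
  have := pX z; rewrite E1 !(mem_cat, in_cons) eqxx !orbT !inE negb_or eq_sym [z == u2]eq_sym.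
  by move=> /(_ isT)/andP[].
apply: (cyc_two (p := [::]) (q := ys) (h1 _ _ u1W yW uy) (h2 _ _ u2W zW uz) d uy).
- by move: up; rewrite E1 cat_uniq => /and3P[_ _]; rewrite cons_uniq cat_uniq => /andP[_ /and3P[]].
- by move=> x /(allP yo) /andP[xW1 xW2]; rewrite inE negb_or xW1.
- by rewrite /= u12.
- by [].
Qed.
End Links.

Section Glue.
Variable G : sgraph.
Implicit Types (A B C D E F J L M N P Q R S U W X Y Z : {set G}) (x y z w : G).
Implicit Types (p q c s : seq G) (ps qs : seq (seq G)).

Lemma card_sub_ex X n : n <= #|X| -> exists2 J : {set G}, J \subset X & #|J| = n.
Proof.
move=> l; exists [set x in take n (enum X)].
  by apply/subsetP => x; rewrite inE => /mem_take; rewrite mem_enum.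
rewrite cardsE (card_uniqP _) ?take_uniq ?enum_uniq //.
by rewrite size_takel // -cardE.
Qed.

Definition rpaths R F C k := exists qs, [/\ size qs = k, pathsys qs, all (ends R) qs,
  {subset flatten qs <= F} & {subset C <= flatten qs}].

Lemma cov_rpaths R C k : cov R C k -> rpaths R R C k.
Proof.
move=> [qs [s h1 h2 h3]]; exists qs; split=> //.
by apply: sub_all (pathsys_all h1 h2) => q /andP[].
Qed.

Lemma chain_rpaths R J r : full R J -> [disjoint R & J] -> cov R R r -> #|J| < r ->
  rpaths R (R :|: J) (R :|: J) (r - #|J|).
Proof.
move=> f d c l; have [qs [h1 h2 h3 h4]] := chain f d c l.
by exists qs; split=> // x; rewrite h4.
Qed.

(** Taken with their links, the segments have ends in [P]; they alternate with equally many paths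
    having ends in [R], and [full P R] supplies every junction. *)
Lemma glue E A P R F C k : linked_cover E A P k -> 0 < k -> rpaths R F C k -> full P R ->
  [disjoint E :|: P & F] -> has_cycle_through (E :|: C).
Proof.
move=> [ts [st ok un mE]] k0 [qs [sq pq eq sF sC]] f d.
have ok1 : all (fun p => ends P p && sorted (@adj G) p) (map (@flat G) ts).
  apply/allP => p /mapP[t tin ->]; have /and4P[h1 h2 h3 h4] := allP ok t tin.
  by rewrite /flat /= h1 last_rcons h2 h4.
have ok2 : all (fun p => ends R p && sorted (@adj G) p) qs.
  apply/allP => p pin; rewrite (allP eq) //=.
  by case/andP: pq => /allP/(_ p pin)/andP[].
have ss : size (map (@flat G) ts) = size qs by rewrite size_map st sq.
have [x0 _] : exists x0 : G, x0 \in flatten (map (@flat G) ts).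
  case: (ts) st k0 => [<-//|t ? _ _]; exists t.1.1; by rewrite /= mem_head.
have [||x [s [E1 E2 E3 E4 [_ E6]]]] := alt_sorted x0 f ok1 ok2; rewrite ?ss ?sq ?leqnn ?leqnSn //.
have mA y : y \in x :: s = (y \in flatten (map (@flat G) ts)) || (y \in flatten qs).
  by rewrite -E1 mem_alt.
have sub1 : {subset E <= flatten (map (@flat G) ts)}.
  by move=> y; rewrite -mE => yin; rewrite (perm_mem (perm_flat ts)) mem_cat yin.
exists (x :: s); split.
- rewrite -E1 (perm_size (perm_alt _ _)) size_cat.
  case: (ts) st ok => [E0|t ts' _ /= /andP[/and4P[_ _ h _] _]]; first by rewrite -E0 in k0.
  by rewrite size_cat size_rcons; case: (mid t) h => //= *; nat_lia.
- apply/andP; split; first by rewrite /= rcons_path E2 /= adj_sym f // E6 // ss.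
  rewrite -E1 (perm_uniq (perm_alt _ _)) cat_uniq un.
  have /andP[_ ->] := pq; rewrite andbT -all_predC; apply/allP => y /sF yF.
  apply/negP => /(flat_mem ok) h; apply: (disjointP _ _ d y) yF; rewrite inE.
  by case: h => [|->]; rewrite ?orbT // mE => ->.
- by move=> y; rewrite inE mA => /orP[/sub1->|/sC->]; rewrite ?orbT.
Qed.

(* The [r - k] paths of [R] in excess are joined through unused vertices of [P]. *)
Lemma glue_cov E A P R r k : linked_cover E A P k -> 0 < k <= #|R| -> cov R R r -> full P R ->
  [disjoint E & P] -> [disjoint E :|: P & R] -> k.*2 + (r - k) <= #|P| ->
  has_cycle_through (E :|: R).
Proof.
move=> m /andP[k0 kR] c f dEP d l.
case: (leqP r k) => rk.
  by apply: (glue m k0 (cov_rpaths (cov_mono c _)) f d); rewrite rk kR.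
have [M [MP lM {}m]] := linked_cover_used m.
have [|J JP cJ] := @card_sub_ex (P :\: M) (r - k).
  by rewrite cardsD (setIidPr MP); move: l lM; clear; lia.
have JP' : J \subset P by apply: subset_trans JP (subsetDl _ _).
have fJ : full R J by move=> x y xR yJ; rewrite adj_sym f // (subsetP JP').
have dRJ : [disjoint R & J].
  by apply/disjointP => x xR xJ; apply: (disjointP _ _ d x) xR; rewrite inE (subsetP JP') ?orbT.
have := chain_rpaths fJ dRJ c _; rewrite cJ (_ : r - (r - k) = k); last by move: rk; clear; lia.
move=> h; have {}h : rpaths R (R :|: J) (R :|: J) k by apply: h; move: rk k0; clear; lia.
have fM : full M R by move=> x y /(subsetP MP) xP; apply: f.
have [c0 [h1 h2 h3]] : has_cycle_through (E :|: (R :|: J)).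
  apply: (glue m k0 h fM); apply/disjointP => x; rewrite !in_setU => /orP[xE|xM] /orP[xR|xJ].
  - by apply: (disjointP _ _ d x) xR; rewrite inE xE.
  - exact: (disjointP _ _ dEP) xE (subsetP JP' x xJ).
  - by apply: (disjointP _ _ d x) xR; rewrite inE (subsetP MP) ?orbT.
  - by have := subsetP JP x xJ; rewrite inE xM.
by exists c0; split=> // x xin; apply: h3; move: xin; rewrite !inE => /orP[]->; rewrite ?orbT.
Qed.

Hypothesis tG : tough9 G.

(** All vertices outside [U] and [S] receive the extra label [None]; [rho] shows that it occurs,
    whence the successor. *)
Lemma tough_side U S (f : G -> G) rho : U != set0 -> [disjoint U & S] ->
  {in U, forall x y, adj x y -> y \in U :|: S} -> rho \notin U :|: S ->
  {in U &, forall x y, adj x y -> f x = f y} -> 9 * (#|f @: U|).+1 <= 2 * #|S|.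
Proof.
move=> U0 d h; rewrite inE negb_or => /andP[rU rS] fe.
pose g x := if x \in U then Some (f x) else None.
have US x : x \in U -> x \notin S by move=> xU; apply/negP; apply: (disjointP _ _ d).
have l : (#|f @: U|).+1 <= #|g @: ~: S|.
  have -> : (#|f @: U|).+1 = #|None |: some @: (f @: U)|.
    have cs : #|some @: (f @: U)| = #|f @: U| by apply: card_imset => ? ? [].
    have nn : None \notin some @: (f @: U) by apply/imsetP => -[].
    by rewrite cardsU1 cs nn.
  apply/subset_leq_card/subsetP => l; rewrite in_setU1 => /orP[/eqP->|/imsetP[k /imsetP[x xU ->] ->]].
    by apply/imsetP; exists rho; rewrite ?inE // /g (negbTE rU).
  by apply/imsetP; exists x; rewrite ?inE ?US // /g xU.
have l0 : 0 < #|f @: U|.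
  by have /set0Pn[x xU] := U0; apply/card_gt0P; exists (f x); apply: imset_f.
have := @tG _ S g _ _.
suff e : forall x y, x \notin S -> y \notin S -> adj x y -> g x = g y.
  by move/(_ e); move: l l0; clear; lia.
move=> x y xS yS xy; rewrite /g.
case: ifP => [xU|xU]; case: ifP => [yU|yU] //; first by rewrite (fe x y).
  by have := h x xU y xy; rewrite inE yU (negbTE yS).
by have := h y yU x; rewrite adj_sym => /(_ xy); rewrite inE xU (negbTE xS).
Qed.

Lemma tough_tgh D L rho : {in D, forall x y, adj x y -> y \in D :|: L} -> [disjoint D & L] ->
  rho \notin D :|: L -> locally_tough D L.
Proof.
move=> h dL; rewrite inE negb_or => /andP[rD rL] U X f UD XD U0 dUX hU fe.
apply: leq_trans (_ : 2 * #|X :|: links L U| <= _); last by rewrite leq_mul2l cardsU_le.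
apply: (tough_side (rho := rho)) fe => //.
- apply/disjointP => x xU; rewrite inE => /orP[xX|/linksP[xL _]]; first exact: (disjointP _ _ dUX) xU xX.
  exact: (disjointP _ _ dL) (subsetP UD x xU) xL.
- move=> x xU y xy; have := h x (subsetP UD x xU) y xy; rewrite inE => /orP[yD|yL].
    by have := hU x y xU yD xy; rewrite !inE => /orP[]->; rewrite ?orbT.
  rewrite !in_setU; apply/orP; right; apply/orP; right; apply/linksP; split=> //.
  by exists x; rewrite // adj_sym.
- rewrite !in_setU !negb_or; apply/and3P; split.
  + by apply: contra rD; apply: (subsetP UD).
  + by apply: contra rD; apply: (subsetP XD).
  + by apply: contra rL => /linksP[].
Qed.

End Glue.

(** * Anticomplete pairs *)

Section Claim.
Variable G : sgraph.
Implicit Types (A B C D E F J K L M N P Q R S U W X Y Z : {set G}) (x y z w : G).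
Implicit Types (p q c s : seq G) (ps qs : seq (seq G)).

Hypothesis p4_dom : forall a b c d : G, p4 (@adj G) a b c d ->
  forall e, [|| adj e a, adj e b, adj e c | adj e d].
Hypothesis tG : tough9 G.

Lemma cycle_sub C C' : C' \subset C -> has_cycle_through C -> has_cycle_through C'.
Proof. by move=> /subsetP s [c [h1 h2 h3]]; exists c; split=> // x /s/h3. Qed.

Lemma disjoint_Ul A B C : [disjoint A & C] -> [disjoint B & C] -> [disjoint A :|: B & C].
Proof.
move=> d1 d2; apply/disjointP => x; rewrite inE => /orP[h1 h2|h1 h2].
  exact: (disjointP _ _ d1) h1 h2.
exact: (disjointP _ _ d2) h1 h2.
Qed.

Lemma disjoint_swap A B : [disjoint A & B] -> [disjoint B & A].
Proof. by rewrite disjoint_sym. Qed.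

Lemma disjoint_Ur A B C : [disjoint C & A] -> [disjoint C & B] -> [disjoint C & A :|: B].
Proof. by move=> d1 d2; apply/disjoint_swap/disjoint_Ul; apply: disjoint_swap. Qed.

Lemma fullU A B C : full A B -> full A C -> full A (B :|: C).
Proof. by move=> f1 f2 x y xA; rewrite inE => /orP[]; [apply: f1 | apply: f2]. Qed.

Lemma antiU A B C : anti A B -> anti A C -> anti A (B :|: C).
Proof. by move=> f1 f2 x y xA; rewrite inE => /orP[]; [apply: f1 | apply: f2]. Qed.

Lemma full_sub A A' B B' : A' \subset A -> B' \subset B -> full A B -> full A' B'.
Proof. by move=> /subsetP s1 /subsetP s2 f x y /s1 xA /s2; apply: f. Qed.

Lemma anti_sub A A' B B' : A' \subset A -> B' \subset B -> anti A B -> anti A' B'.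
Proof. by move=> /subsetP s1 /subsetP s2 f x y /s1 xA /s2; apply: f. Qed.

Lemma hconn_full A S a : full A S -> [disjoint A & S] -> cov A A a -> A != set0 -> a < #|S| ->
  hconn (A :|: S) A.
Proof.
move=> f d c A0 l; have := hconn_join f d c (cov_set0 S) l _; rewrite setU0; apply.
by rewrite card_gt0.
Qed.

(* [D] and [R] are the two sides; the outside neighbours of [D] are either complete to [D] ([Q]) or complete to
   the other side ([P]). *)
Record setting D R Q P := Setting {
  st_p4 : p4f D; st_D0 : D != set0; st_R0 : R != set0;
  st_DR : [disjoint D & R]; st_DQ : [disjoint D & Q]; st_DP : [disjoint D & P];
  st_RQ : [disjoint R & Q]; st_RP : [disjoint R & P]; st_QP : [disjoint Q & P];
  st_anti : anti D R; st_fQ : full D Q; st_fP : full R P;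
  st_nbr : {in D, forall x y, adj x y -> y \in D :|: (Q :|: P)} }.

Lemma setting_tgh D R Q P : setting D R Q P -> locally_tough D (Q :|: P).
Proof.
case=> pD D0 R0 DR DQ DP RQ RP QP an fQ fP nb; have [rho rR] := set0Pn _ R0.
apply: (tough_tgh tG (rho := rho) nb); first exact: disjoint_Ur.
apply/negP; rewrite !in_setU => /or3P[h|h|h].
- exact: (disjointP _ _ DR) h rR.
- exact: (disjointP _ _ RQ) rR h.
- exact: (disjointP _ _ RP) rR h.
Qed.

(** [core] allows links in [Q] as well as in [P]; inserting [Q] by [segjoin] leaves only links in
    [P], which are complete to [R]. A vertex of [R] serves as [rho]. *)
Lemma setting_segs D R Q P B a (s : nat) : setting D R Q P -> path_number D a -> #|Q| <= a ->
  B \subset Q -> cov Q B s -> s < #|D| ->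
  exists E, [/\ D :|: B \subset E, E \subset D :|: Q & linked_cover E D P (maxn 1 (a - #|Q|))].
Proof.
move=> st pa lQ BQ cB ls; have t := setting_tgh st.
case: st => pD D0 R0 DR DQ DP RQ RP QP an fQ fP nb; have [rho rR] := set0Pn _ R0.
have [|||k [pk mk]] := core p4_dom (rho := rho) (L := Q :|: P) pD D0 _ _ _ t.
- by move=> x xD; rewrite adj_sym an.
- exact: disjoint_Ur.
- move=> y; rewrite inE => /orP[yQ|yP]; last by right; rewrite adj_sym fP.
  by left; apply/subsetP => x xD; rewrite inE adj_sym fQ.
move: mk; rewrite (path_number_uniq pk pa) => {k pk} mk.
by apply: (segjoin fQ DQ _ BQ t mk pa.2 (path_number_gt0 pa D0) lQ cB ls); apply: disjoint_Ul.
Qed.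

Lemma setting_disj D R Q P E : setting D R Q P -> E \subset D :|: Q ->
  [disjoint E & P] /\ [disjoint E :|: P & R].
Proof.
case=> pD D0 R0 DR DQ DP RQ RP QP an fQ fP nb s2; split.
  by apply: disjointWl s2 _; apply: disjoint_Ul.
apply: disjoint_Ul; last exact: disjoint_swap.
by apply: disjointWl s2 _; apply: disjoint_Ul => //; apply: disjoint_swap.
Qed.

Lemma claim_balanced D R Q P a r : setting D R Q P -> path_number D a -> #|Q| <= a -> cov R R r ->
  a.*2 + r <= #|P| -> maxn 1 (a - #|Q|) <= #|R| -> has_cycle_through (D :|: R).
Proof.
move=> st pa lQ cr lP lR; have a0 := path_number_gt0 pa (st_D0 st).
have [|E [s1 s2 m]] := setting_segs st pa lQ (sub0set Q) (cov_set0 Q).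
  by rewrite card_gt0 (st_D0 st).
rewrite setU0 in s1; have [EP EPR] := setting_disj st s2.
have fP' : full P R by apply: fullC; apply: st_fP st.
apply: (cycle_sub (C := E :|: R)); first exact: setSU.
apply: (glue_cov m _ cr fP' EP EPR); first by rewrite lR andbT leq_max.
by move: lP a0; clear; lia.
Qed.

(** If [R] is large enough, segments of [D] are glued to paths of [R]. Otherwise [D] is decomposed:
    one part of a join is put into [Q] and absorbed afterwards, and one part of a split is moved to
    the other side, unless both sides can be made Hamilton-connected. *)
Lemma claim D R Q P a r : setting D R Q P -> path_number D a -> #|Q| <= a -> cov R R r ->
  a.*2 + r <= #|P| -> has_cycle_through (D :|: R).
Proof.
have [n] := ubnP #|D|; elim: n D R Q P a r => // n IH D R Q P a r ln st pa lQ cr lP.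
case: (leqP (maxn 1 (a - #|Q|)) #|R|) => [lR|lR]; first exact: (claim_balanced st pa lQ cr).
have t := setting_tgh st; have st' := st.
case: st' => pD D0 R0 DR DQ DP RQ RP QP an fQ fP nb; have [rho rR] := set0Pn _ R0.
have R1 : 0 < #|R| by rewrite card_gt0.
(* [R] has fewer vertices than there are segments, so it cannot be cut into enough paths. *)
have {}lR : #|R| + #|Q| < a by move: lR R1; clear; lia.
have lr := cov_size cr.
have D1 : 1 < #|D| by apply: leq_trans (path_number_le pa); move: lR R1; clear; lia.
have [sD|[A [B jn]]] := cographP pD D1; last first.
  have [p _] := jn; have [cD lA lB] := parts_card p.
  have step A' B' a' : joins D A' B' -> path_number A' a' -> #|B'| < a' -> a = a' - #|B'| ->
    has_cycle_through (D :|: R).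
    move=> [p' f'] pa' lB' Ea; have [cD' lA' _] := parts_card p'; have [AD BD] := parts_sub p'.
    have [A0 B0 dAB ED] := p'.
    have st1 : setting A' R (Q :|: B') P.
      split=> //; [exact: p4f_sub pD|exact: disjointWl DR| |exact: disjointWl DP| | | | |].
      - by apply: disjoint_Ur => //; apply: disjointWl DQ.
      - by apply: disjoint_Ur => //; apply: disjoint_swap; apply: disjointWl DR.
      - by apply: disjoint_Ul => //; apply: disjointWl DP.
      - exact: anti_sub an.
      - by apply: fullU => //; apply: full_sub fQ.
      - move=> x xA y xy; have := nb x (subsetP AD x xA) y xy.
        by rewrite -ED !inE; case: (y \in A'); case: (y \in B'); rewrite ?orbT ?orbF.
    have := locally_tough_tight pa'.2 (leq_ltn_trans (leq0n _) lB') (setting_tgh st1).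
    have lk : #|links (Q :|: B' :|: P) A'| <= #|Q| + #|B'| + #|P|.
      apply: leq_trans (_ : #|Q :|: B' :|: P| <= _).
        by apply/subset_leq_card/subsetP => y /linksP[].
      by apply: leq_trans (cardsU_le _ _) _; rewrite leq_add2r cardsU_le.
    move=> ct; have la' := path_number_le pa'.
    (* Induction gives a cycle through [A'] and [R]; as [A'] outnumbers [R] and [B'] together, [B']
       can be absorbed. *)
    apply: (cycle_sub (C := A' :|: R :|: B')).
      by rewrite -ED; apply/subsetP => x; rewrite !inE; case: (x \in A'); case: (x \in B'); rewrite ?orbT ?orbF //= => ->.
    apply: absorb => //; first by move: lR Ea la' lB'; clear; lia.
    apply: (IH _ _ _ _ a' r _ st1) => //.
    + by move: cD' ln lA'; have := parts_card p' => -[_ _ lB'']; move: lB''; clear; lia.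
    + by apply: leq_trans (cardsU_le _ _) _; move: lQ lB' Ea; clear; lia.
    + by move: ct lk lr lR Ea lB'; clear; lia.
  have [kA pA] := jung (p4f_sub (parts_sub p).1 pD).
  have [kB pB] := jung (p4f_sub (parts_sub p).2 pD).
  case: (path_number_join jn pA pB) => [[l pk]|[l pk]|[l1 l2 pk]].
  - by apply: (step A B kA) => //; apply: path_number_uniq pk.
  - by apply: (step B A kB) => //; [exact: joins_sym | apply: path_number_uniq pk].
  - by have := path_number_uniq pa pk; move: lR R1; clear; lia.
have [||C [N [sp CN]]] := @laminar_split G p4_dom D (links P D) rho _ _ sD.
- by move=> x xD; rewrite adj_sym an.
- by move=> y /linksP[yP ex]; split=> //; right; rewrite adj_sym fP.
pose F := [set y in links P D | C \subset nbr y]; pose K := links P D :\: F.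
have FL : F \subset links P D by apply/subsetP => y; rewrite inE => /andP[].
have KL : K \subset links P D by apply: subsetDl.
have FK : [disjoint F & K] by apply/disjointP => x xF; rewrite inE xF.
have cFK : links P D \subset F :|: K.
  by apply/subsetP => y yl; rewrite in_setU in_setD yl andbT orbN.
have fF : full C F.
  by move=> x y xC; rewrite inE => /andP[_ /subsetP/(_ x xC)]; rewrite inE adj_sym.
have fK : full N K.
  move=> x y xN; rewrite in_setD => /andP[nC yL].
  case: (CN y yL) => /subsetP h; last by have := h x xN; rewrite inE adj_sym.
  by move/subsetP: h => h; rewrite inE yL h in nC.
have [p _] := sp; have [CD ND] := parts_sub p.
have [kC pC] := jung (p4f_sub CD pD); have [kN pN] := jung (p4f_sub ND pD).
have Ea : a = kC + kN by apply: path_number_uniq pa (path_number_union sp pC pN).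
have LP : links P D \subset P by apply/subsetP => y /linksP[].
have ct : 9 * a.+1 <= 2 * (#|Q| + #|F| + #|K|).
  have a0 : 0 < a by move: lR; clear; lia.
  apply: leq_trans (locally_tough_tight pa.2 a0 t) _; rewrite leq_mul2l /= -addnA.
  apply: leq_trans (_ : #|Q :|: (F :|: K)| <= _).
    apply/subset_leq_card/subsetP => y /linksP[]; rewrite !in_setU => /orP[->//|yP] ex.
    by have /(subsetP cFK) : y \in links P D; [apply/linksP | rewrite in_setU => ->; rewrite orbT].
  by apply: leq_trans (cardsU_le _ _) _; rewrite leq_add2l cardsU_le.
(* With few vertices complete to [C'] the induction applies to [C']: [N'] is anticomplete to it and
   joins [R], and [F'] joins [Q]. *)
have small C' N' F' K' kC' kN' : splits D C' N' -> path_number C' kC' -> path_number N' kN' -> a = kC' + kN' ->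
    F' \subset links P D -> K' \subset links P D -> [disjoint F' & K'] ->
    links P D \subset F' :|: K' -> full C' F' -> full N' K' ->
    #|Q| + #|F'| + #|K'| = #|Q| + #|F| + #|K| -> #|F'| + #|Q| <= kC' ->
    has_cycle_through (D :|: R).
  move=> [p' a'] pC' pN' Ea' FL' KL' FK' cFK' fF' fK' cc le.
  have [CD' ND'] := parts_sub p'; have [cD lC lN] := parts_card p'; have [C0 N0 dCN ED] := p'.
  have FP' := subset_trans FL' LP; have KP' := subset_trans KL' LP.
  have NR : [disjoint R & N'] by apply: disjoint_swap; apply: disjointWl DR.
  have st1 : setting C' (R :|: N') (Q :|: F') K'.
    split=> //.
    - exact: p4f_sub pD.
    - by have [x xR] := set0Pn _ R0; apply/set0Pn; exists x; rewrite inE xR.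
    - by apply: disjoint_Ur => //; apply: disjointWl DR.
    - by apply: disjoint_Ur; [apply: disjointWl DQ | apply: disjointWl CD' _; apply: disjointWr DP].
    - by apply: disjointWl CD' _; apply: disjointWr DP.
    - apply: disjoint_Ul; apply: disjoint_Ur => //.
      + by apply: disjointWr RP.
      + by apply: disjointWl DQ.
      + by apply: disjointWl ND' _; apply: disjointWr DP.
    - apply: disjoint_Ul; first by apply: disjointWr RP.
      by apply: disjointWl ND' _; apply: disjointWr DP.
    - by apply: disjoint_Ul => //; apply: disjointWr QP.
    - by apply: antiU => //; apply: anti_sub an.
    - by apply: fullU => //; apply: full_sub fQ.
    - apply: fullC; apply: fullU; last exact: fullC.
      by apply: fullC; apply: full_sub fP.
    - move=> x xC y xy; have := nb x (subsetP CD' x xC) y xy; rewrite -ED !in_setU -!orbA.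
      case/or4P=> [->//|yN|->|yP]; rewrite ?orbT //; first by have := a' x y xC yN; rewrite xy.
      have : y \in links P D.
        by apply/linksP; split=> //; exists x; rewrite 1?adj_sym // (subsetP CD').
      by move/(subsetP cFK'); rewrite in_setU => /orP[]->; rewrite !orbT.
  apply: (cycle_sub (C := C' :|: (R :|: N'))).
    by rewrite -ED; apply/subsetP => x; rewrite !inE orbAC -orbA.
  have cv := cov_union NR cr pN'.1.
  apply: (IH _ _ _ _ kC' (r + kN') _ st1) => //.
  - by move: cD ln lN; clear; lia.
  - by apply: leq_trans (cardsU_le _ _) _; rewrite addnC.
  - by move: ct cc le lr lR Ea'; clear; lia.
(* With enough vertices on both sides, [C'] extended by [F'] and [Q], and the rest extended by [K'],
   are Hamilton-connected and joined by an edge. *)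
have two C' N' F' K' kC' kN' : splits D C' N' -> path_number C' kC' -> path_number N' kN' ->
    F' \subset links P D -> K' \subset links P D -> [disjoint F' & K'] ->
    full C' F' -> full N' K' -> kC' < #|F'| + #|Q| -> kN' + r < #|K'| ->
    has_cycle_through (D :|: R).
  move=> [p' a'] pC' pN' FL' KL' FK' fF' fK' l1 l2.
  have [CD' ND'] := parts_sub p'; have [cD lC lN] := parts_card p'; have [C0 N0 dCN ED] := p'.
  have FP' := subset_trans FL' LP; have KP' := subset_trans KL' LP.
  have dCF : [disjoint C' & F' :|: Q].
    by apply: disjoint_Ur; [apply: disjointWl CD' _; apply: disjointWr DP | apply: disjointWl DQ].
  have h1 : hconn (C' :|: (F' :|: Q)) C'.
    apply: hconn_full pC'.1 _ _ => //; first by apply: fullU => //; apply: full_sub fQ.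
    by rewrite cardsUd // disjoint_sym; apply: disjointWr QP.
  have NR : [disjoint N' & R] by apply: disjointWl DR.
  have dNRK : [disjoint N' :|: R & K'].
    apply: disjoint_Ul; last by apply: disjointWr RP.
    by apply: disjointWl ND' _; apply: disjointWr DP.
  have h2 : hconn (N' :|: R :|: K') (N' :|: R).
    apply: hconn_full (cov_union NR pN'.1 cr) _ _ => //.
    - apply: fullC; apply: fullU; first exact: fullC.
      by apply: fullC; apply: full_sub fP.
    - by have [x xN] := set0Pn _ N0; apply/set0Pn; exists x; rewrite inE xN.
  have d12 : [disjoint C' :|: (F' :|: Q) & N' :|: R :|: K'].
    apply: disjoint_Ul; last apply: disjoint_Ul.
    - apply: disjoint_Ur; [apply: disjoint_Ur => //; exact: disjointWl DR | ].
      by apply: disjointWl CD' _; apply: disjointWr DP.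
    - apply: disjoint_Ur => //; apply: disjoint_swap; apply: disjoint_Ul; last by apply: disjointWr RP.
      by apply: disjointWl ND' _; apply: disjointWr DP.
    - apply: disjoint_Ur; last by apply: disjointWr QP.
      by apply: disjoint_swap; apply: disjoint_Ul => //; apply: disjointWl DQ.
  have c1 : 1 < #|C' :|: (F' :|: Q)|.
    rewrite cardsUd // (cardsUd (A := F')); last by rewrite disjoint_sym; apply: disjointWr QP.
    by move: l1 lC; clear; lia.
  have c2 : 1 < #|N' :|: R :|: K'|.
    by rewrite cardsUd // cardsUd //; move: lN R1; clear; lia.
  suff [u1 [u2 [u1W u2W u12]]] : exists u1 u2, [/\ u1 \in C' :|: (F' :|: Q), u2 \in N' :|: R :|: K' & adj u1 u2].
    apply: (cycle_sub (C := C' :|: (N' :|: R))); first by rewrite -ED setUA.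
    exact: (link tG h1 h2 d12 c1 c2 u1W u2W u12).
  have [F0|/set0Pn[y yF]] := eqVneq F' set0; last first.
    exists y, rho; rewrite !in_setU yF rR !orbT; split=> //.
    by rewrite adj_sym fP // (subsetP FP').
  have /card_gt0P[y yQ] : 0 < #|Q| by move: l1; rewrite F0 cards0; clear; lia.
  have [v vN] := set0Pn _ N0; exists y, v; rewrite !in_setU yQ vN !orbT; split=> //.
  by rewrite adj_sym fQ // (subsetP ND').
have KF : [disjoint K & F] by apply: disjoint_swap.
case: (leqP (#|F| + #|Q|) kC) => lF.
  exact: (small C N F K kC kN).
case: (leqP (#|K| + #|Q|) kN) => lK.
  apply: (small N C K F kN kC) => //; first exact: splits_sym.
  - by rewrite addnC.
  - by rewrite setUC.
  - by rewrite addnAC.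
(* If [K] is too small for [N] and [R] together, the count makes [F] large enough for [C] and [R],
   and the parts exchange roles. *)
case: (ltnP (kN + r) #|K|) => l; first exact: (two C N F K kC kN).
apply: (two N C K F kN kC) => //; first exact: splits_sym.
by move: ct l lr lR Ea; clear; lia.
Qed.
End Claim.

(** * Connected sides *)

Section Shapes.
Variable G : sgraph.
Implicit Types (A B C D E F J K L M N P Q R S U W X Y Z : {set G}) (x y z w : G).

(* Both parts are independent, as [tight A #|A|] forces. *)
Record balanced D A B := Balanced {
  bal_joins : joins D A B; bal_tA : tight A #|A|; bal_tB : tight B #|B|; bal_card : #|A| = #|B| }.

(** [std_A] makes the domination argument apply to [A]; the two inequalities make [B] fit between
    the paths of [A]. For a join refined as far as [std_A], failure of [std_lt] leads to the
    balanced shape. *)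
Record standard D A B a b := Standard {
  std_full : full A B; std_disj : [disjoint A & B]; std_U : A :|: B = D;
  std_A : splittable A \/ #|A| = 1; std_pcn : path_number A a; std_le : #|B| <= a;
  std_cov : cov B B b; std_lt : b < #|A| }.

Definition shaped D := [\/ hconn D D /\ 1 < #|D|, exists A B, balanced D A B |
  exists A B a b, standard D A B a b].

Lemma hconn_clique3 D : #|D| = 3 -> {in D &, forall x y, x != y -> adj x y} -> hconn D D.
Proof.
move=> D3 cl x y xD yD xy; set A := [set x; y]; set S := D :\: A.
have AD : A \subset D by apply/subsetP => z; rewrite !inE => /orP[]/eqP->.
have ED : A :|: S = D.
  by apply/setP => z; have := subsetP AD z; rewrite in_setU in_setD; case: (z \in A) => // ->.
have cA : #|A| = 2 by rewrite cards2 xy.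
have cS : #|S| = 1 by rewrite cardsD (setIidPr AD) D3 cA.
have f : full A S.
  move=> u v uA; rewrite inE => /andP[vA vD]; apply: cl => //; first exact: (subsetP AD).
  by apply: contraNneq vA => <-.
have d : [disjoint A & S] by apply/disjointP => u uA; rewrite inE uA.
have := @hpath_AA _ A S A S x y 2 f d; rewrite ED -[X in hpath _ X]ED; apply.
  apply: (ecov2_card (cov_singles (subxx A))) => //; rewrite ?inE ?eqxx ?orbT //.
  by rewrite cA.
by rewrite -cS; apply: cov_singles.
Qed.

Lemma join_clique D A B : joins D A B -> {in A &, forall x y, x != y -> adj x y} ->
  {in B &, forall x y, x != y -> adj x y} -> {in D &, forall x y, x != y -> adj x y}.
Proof.
move=> [[_ _ _ <-] f] cA cB x y; rewrite !inE => /orP[xA|xB] /orP[yA|yB] xy.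
- exact: cA.
- exact: f.
- by rewrite adj_sym f.
- exact: cB.
Qed.

Lemma card1_clique A : #|A| = 1 -> {in A &, forall x y, x != y -> adj x y}.
Proof. by move=> /eqP/cards1P[a ->] x y /set1P-> /set1P->; rewrite eqxx. Qed.

Lemma joins_assoc D A B A1 A2 : joins D A B -> joins A A1 A2 -> joins D A1 (A2 :|: B).
Proof.
move=> [[A0 B0 dAB ED] f] [[A10 A20 d12 EA] f12]; rewrite -{A}EA in A0 dAB ED f.
split; last by apply: fullU => //; apply: full_sub f; rewrite ?subsetUl.
split=> //; last by rewrite setUA.
- by have [x xA] := set0Pn _ A20; apply/set0Pn; exists x; rewrite inE xA.
- by apply: disjoint_Ur => //; apply: disjointWl dAB; rewrite subsetUl.
Qed.

(** Moving the single vertex of [B] to [A2] turns the inequality [a1 <= #|A2|] into a strict one, as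
    [hconn_join] requires. *)
Lemma hconn_join_pt D A B A1 A2 : joins D A B -> joins A A1 A2 -> #|B| = 1 ->
  forall a1 a2, cov A1 A1 a1 -> cov A2 A2 a2 -> a1 <= #|A2| -> a2 <= #|A1| -> 1 < #|A1| ->
  hconn D D.
Proof.
move=> j1 j2 B1 a1 a2 c1 c2 l1 l2 lA.
have j := joins_assoc j1 j2; have [[A10 _ d ED] f] := j.
have [[_ _ dAB EA] fAB] := j1; have [[_ A20 _ EA'] _] := j2.
have dB : [disjoint A2 & B] by apply: disjointWl dAB; rewrite -EA' subsetUr.
have fB : full A2 B by apply: full_sub fAB; rewrite -?EA' ?subsetUr.
have [s cs ls] : exists2 s, cov (A2 :|: B) (A2 :|: B) s & s < #|A1|.
  case: (ltnP 1 a2) => l.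
    exists (a2 - #|B|); first by apply: chain_cov; rewrite ?B1.
    by rewrite B1; move: l2 l; clear; lia.
  exists 1 => //; apply: (@cov_join1 _ _ A2 B a2 1); rewrite ?B1 //; last by rewrite card_gt0.
    by split=> //; split=> //; rewrite -card_gt0 B1.
  by rewrite -B1; apply: cov_singles.
have := hconn_join f d c1 cs _ ls; rewrite ED; apply.
by rewrite cardsUd // B1; move: l1; clear; lia.
Qed.

(** While [A] is itself a join with an excess of paths in one part, the other part is moved into
    [B], preserving the inequality with the path number. The refinement stops at a disconnected set,
    a single vertex, or path number 1, where [B] is a single vertex. *)
Lemma shaped_join D A B a : p4f D -> joins D A B -> path_number A a -> #|B| <= a -> shaped D.
Proof.
have [n] := ubnP #|A|; elim: n A B a => // n IH A B a ln pD jn pa lB.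
have [p f] := jn; have [cD lA lB0] := parts_card p; have [A0 B0 dAB ED] := p.
have pA : p4f A by apply: p4f_sub pD; case: (parts_sub p).
have pB : p4f B by apply: p4f_sub pD; case: (parts_sub p).
have la := path_number_le pa; have [b pb] := jung pB; have lb := path_number_le pb.
have bal : #|A| <= b -> shaped D.
  move=> l; have Eb : b = #|B| by move: l lb la lB; clear; lia.
  have Ea : a = #|A| by move: l lb la lB; clear; lia.
  have EAB : #|A| = #|B| by move: l lb la lB; clear; lia.
  apply: Or32; exists A, B; split=> //; first by rewrite -Ea; case: pa.
  by rewrite -Eb; case: pb.
have std : splittable A \/ #|A| = 1 -> shaped D.
  move=> sA; case: (leqP #|A| b) => [/bal//|l].
  by apply: Or33; exists A, B, a, b; split=> //; case: pb.
case: (ltnP 1 #|A|) => A1; last by apply: std; right; move: A1 lA; clear; lia.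
have [sA|[A1' [A2' j]]] := cographP pA A1; first by apply: std; left.
have [p' f'] := j; have [cA l1 l2] := parts_card p'.
have [a1 pa1] := jung (p4f_sub (parts_sub p').1 pA).
have [a2 pa2] := jung (p4f_sub (parts_sub p').2 pA).
have rec C1 C2 c1 : joins A C1 C2 -> path_number C1 c1 -> #|C2| < c1 -> a = c1 - #|C2| -> shaped D.
  move=> j' pc l Ea; have [q _] := j'; have [cq _ lq] := parts_card q.
  apply: (IH C1 (C2 :|: B) c1) => //; [by move: cq ln lq; clear; lia | exact: joins_assoc j' |].
  by apply: leq_trans (cardsU_le _ _) _; move: l Ea lB; clear; lia.
case: (path_number_join j pa1 pa2) => [[l pk]|[l pk]|[h1 h2 pk]].
- by apply: (rec _ _ _ j pa1 l); apply: path_number_uniq pk.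
- by apply: (rec _ _ _ (joins_sym j) pa2 l); apply: path_number_uniq pk.
have a1E := path_number_uniq pa pk; have B1 : #|B| = 1 by move: lB lB0; rewrite a1E; clear; lia.
have D1 : 1 < #|D| by move: cD lA lB0; clear; lia.
case: (ltnP 1 #|A1'|) => n1.
  by apply: Or31; split=> //; apply: (hconn_join_pt jn j B1 pa1.1 pa2.1).
case: (ltnP 1 #|A2'|) => n2.
  by apply: Or31; split=> //; apply: (hconn_join_pt jn (joins_sym j) B1 pa2.1 pa1.1).
apply: Or31; split=> //; apply: hconn_clique3; first by move: cD cA l1 l2 n1 n2 B1; clear; lia.
have E1 : #|A1'| = 1 by move: l1 n1; clear; lia.
have E2 : #|A2'| = 1 by move: l2 n2; clear; lia.
apply: (join_clique jn); last exact: card1_clique.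
by apply: (join_clique j); apply: card1_clique.
Qed.

Lemma unsplittable_shaped D : p4f D -> D != set0 -> ~ splittable D -> shaped D.
Proof.
move=> pD D0 ns; case: (ltnP 1 #|D|) => D1; last first.
  have E1 : #|D| = 1 by apply/eqP; rewrite eqn_leq D1 card_gt0.
  apply: Or33; exists D, set0, 1, 0; split=> //.
  - by move=> x y _; rewrite inE.
  - by apply/disjointP => x _; rewrite inE.
  - by rewrite setU0.
  - by right.
  - exact: path_number_single.
  - by rewrite cards0.
  - exact: cov_set0.
  - by rewrite E1.
have [//|[A [B jn]]] := cographP pD D1.
have [p f] := jn; have [_ _ d ED] := p.
have [a pa] := jung (p4f_sub (parts_sub p).1 pD).
have [b pb] := jung (p4f_sub (parts_sub p).2 pD).
case: (leqP #|B| a) => la; first exact: shaped_join pD jn pa la.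
case: (leqP #|A| b) => lb; first exact: shaped_join pD (joins_sym jn) pb lb.
by apply: Or31; split=> //; have := hconn_join f d pa.1 pb.1 la lb; rewrite ED.
Qed.

End Shapes.

Section Sides.
Variable G : sgraph.
Implicit Types (A B C D E F J K L M N P Q R S U W X Y Z : {set G}) (x y z w : G).

(* A vertex [y] outside [D] serves as a link to [D] ending in [x]; if [y] was already used to enlarge [D] to [W],
   then [y] itself is the end. *)
Definition at_end D W y x := if y \in W then x == y else (x \in D) && adj y x.

(* The colour records which pairs of vertices are joined by a path through [D]: colours are the vertices themselves
   when all pairs are, and the two parts when [D] is a balanced complete bipartite graph. *)
Record side Q D W (col : G -> G) := Side {
  sd_sub : D \subset W;
  sd_path : {in W &, forall x y, col x != col y -> hpath W D x y};
  sd_alt : forall i y, exists y' x, [/\ y' \in Q, y' != y, at_end D W y' x & col x != i] }.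

Lemma at_endW D W y x : D \subset W -> at_end D W y x -> x \in W.
Proof.
move=> /subsetP s; rewrite /at_end; case: ifP => [yW /eqP->//|_ /andP[/s //]].
Qed.

Lemma at_end_path D1 W1 D2 W2 y x z : [disjoint W1 & W2] -> at_end D1 W1 y x -> at_end D2 W2 y z ->
  exists p, [/\ path (@adj G) x (rcons p z), {subset p <= [:: y]}, uniq p &
    {in p, forall u, u \notin W1 :|: W2}].
Proof.
move=> d; rewrite /at_end; case: ifP => [y1|n1]; case: ifP => [y2|n2].
- by case: (disjointP _ _ d y y1 y2).
- by move=> /eqP-> /andP[_ yz]; exists [::]; rewrite /= yz.
- by move=> /andP[_ yx] /eqP->; exists [::]; rewrite /= adj_sym yx.
move=> /andP[_ yx] /andP[_ yz]; exists [:: y]; split=> //=.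
- by rewrite adj_sym yx yz.
- by move=> u /[!inE] /eqP->; rewrite n1 n2.
Qed.

(* Two links with different colours on one side either differ on the other side as well, or a third link that does
   can replace one of them. *)
Lemma two_sides Q D1 D2 W1 W2 c1 c2 : side Q D1 W1 c1 -> side Q D2 W2 c2 ->
  [disjoint W1 & W2] -> Q != set0 -> {in Q, forall y, exists2 x, x \in D1 & adj y x} ->
  {in Q, forall y, exists2 x, x \in D2 & adj y x} -> has_cycle_through (D1 :|: D2).
Proof.
move=> [s1 p1 alt1] [s2 p2 alt2] d /set0Pn[y1 y1Q] m1 m2.
have ex (D W : {set G}) (y : G) : (exists2 u, u \in D & adj y u) -> exists x, at_end D W y x.
  move=> [x xD yx]; have [yW|yW] := boolP (y \in W); [exists y | exists x].
    by rewrite /at_end yW.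
  by rewrite /at_end (negbTE yW) xD.
have fin y y' x x' z z' : y != y' -> at_end D1 W1 y x -> at_end D1 W1 y' x' ->
    at_end D2 W2 y z -> at_end D2 W2 y' z' -> c1 x != c1 x' -> c2 z != c2 z' ->
    has_cycle_through (D1 :|: D2).
  move=> ny e1 e2 e3 e4 n1 n2.
  have [p [pp ps pu po]] := at_end_path d e1 e3; have [q [qp qs qu qo]] := at_end_path d e2 e4.
  have h1 := p1 _ _ (at_endW s1 e1) (at_endW s1 e2) n1.
  have h2 := p2 _ _ (at_endW s2 e3) (at_endW s2 e4) n2.
  apply: (cyc_two h1 h2 d _ _ _ pp qp).
  - by apply: contraNneq n1 => ->.
  - rewrite cat_uniq pu qu andbT /= -all_predC; apply/allP => u /qs /[!inE] /eqP->.
    by apply/negP => /ps /[!inE] /eqP E; rewrite E eqxx in ny.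
  - by move=> u; rewrite mem_cat => /orP[/po|/qo].
have [x1 e1] := ex _ W1 _ (m1 _ y1Q); have [z1 f1] := ex _ W2 _ (m2 _ y1Q).
have [y2 [x2 [y2Q n21 e2 c21]]] := alt1 (c1 x1) y1.
have n12 : y1 != y2 by rewrite eq_sym.
have c12 : c1 x1 != c1 x2 by rewrite eq_sym.
have [z2 f2] := ex _ W2 _ (m2 _ y2Q).
have [E|ne] := eqVneq (c2 z1) (c2 z2); last exact: fin n12 e1 e2 f1 f2 c12 ne.
have [y3 [z3 [y3Q n31 f3 c31]]] := alt2 (c2 z1) y1.
have c13 : c2 z1 != c2 z3 by rewrite eq_sym.
have [E3|n32] := eqVneq y3 y2.
  by rewrite E3 in f3; apply: fin n12 e1 e2 f1 f3 c12 c13.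
have [x3 e3] := ex _ W1 _ (m1 _ y3Q).
have [E1|ne] := eqVneq (c1 x1) (c1 x3).
  apply: (fin y2 y3 x2 x3 z2 z3 _ e2 e3 f2 f3); first by rewrite eq_sym.
    by rewrite -E1 eq_sym.
  by rewrite -E.
by apply: (fin y1 y3 x1 x3 z1 z3 _ e1 e3 f1 f3 ne c13); rewrite eq_sym.
Qed.

Lemma links_disj_end D W Q U y : [disjoint W & Q] -> U \subset D -> y \in links Q U ->
  exists x, x \in U /\ at_end D W y x.
Proof.
move=> d /subsetP UD /linksP[yQ [x xU yx]]; exists x; split=> //.
rewrite /at_end UD // yx; case: ifP => // yW; by case: (disjointP _ _ d y yW yQ).
Qed.

Lemma links_del D Q w : [disjoint D & Q] -> locally_tough D Q -> 1 < #|D| -> 1 < #|links Q (D :\ w)|.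
Proof.
move=> d t D1; have D0 : D != set0 by rewrite -card_gt0 ltnW.
have key v : v \in D -> 1 < #|links Q (D :\ v)|.
  move=> vD; apply: (locally_tough_tightD1 (tight1 D0) _ (S := set0)) => //.
  - by move=> x y _; rewrite inE.
  - by apply/disjointP => x; rewrite inE.
  - by rewrite set0U.
  - by rewrite cards0.
have [wD|wD] := boolP (w \in D); first exact: key.
have [v vD] := set0Pn _ D0; apply: leq_trans (key v vD) _.
apply/subset_leq_card/links_sub/subsetP => x /[!inE] /andP[_ xD]; rewrite xD andbT.
by apply: contraNneq wD => <-.
Qed.

Lemma side_hconn Q D : [disjoint D & Q] -> locally_tough D Q -> 1 < #|D| -> hconn D D -> side Q D D id.
Proof.
move=> d t D1 hc; split=> // i y.
have [y' ny y'l] := links_other y (links_del i d t D1).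
have [x [xU xe]] := links_disj_end d (subsetDl D [set i]) y'l.
exists y', x; split=> //; first by case/linksP: y'l.
by move: xU; rewrite !inE => /andP[].
Qed.

Lemma balanced_path D A B : joins D A B -> #|A| = #|B| -> {in A & B, forall x y, hpath D D x y}.
Proof.
move=> [[A0 B0 d ED] f] E x y xA yB.
have e1 : ecov1 A A x #|A|.
  by apply: (ecov1_card (a := #|A|)) => //; [exact: cov_singles | rewrite geq_minr leqnn].
have e2 : ecov1 B B y #|A|.
  by rewrite E; apply: (ecov1_card (a := #|B|)) => //; [exact: cov_singles | rewrite geq_minr leqnn].
by have := hpath_AS f d e1 e2; rewrite ED.
Qed.

Lemma side_balanced Q D A B : [disjoint D & Q] -> locally_tough D Q -> balanced D A B ->
  exists c, side Q D D c.
Proof.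
move=> d t [jn tA tB E]; have [p f] := jn; have [A0 B0 dAB ED] := p.
have [AD BD] := parts_sub p; have [_ lA lB] := parts_card p.
have dA : [disjoint A & Q] by apply: disjointWl d.
have dB : [disjoint B & Q] by apply: disjointWl d.
have [a0 a0A] := set0Pn _ A0; have [b0 b0B] := set0Pn _ B0.
have nab : a0 != b0 by apply: contraTneq b0B => <-; apply/negP; apply: (disjointP _ _ dAB).
have hA : 1 < #|links Q A|.
  have := tight_links tA lA A0 f dB (locally_tough_join jn dB t).
  by move: E lA; clear; lia.
have hB : 1 < #|links Q B|.
  have := tight_links tB lB B0 (fullC f) dA (locally_tough_join (joins_sym jn) dA t).
  by move: E lA; clear; lia.
have inB x : x \in D -> x \notin A -> x \in B by rewrite -ED inE => /orP[->|].
(* Colours must be vertices, so each part is represented by one of its own. *)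
exists (fun x => if x \in A then a0 else b0); split=> //.
  move=> x y xD yD; case: (boolP (x \in A)) => xA; case: (boolP (y \in A)) => yA; rewrite ?eqxx // => _.
    exact: balanced_path jn E x y xA (inB _ yD yA).
  by apply: hpath_sym; apply: balanced_path jn E y x yA (inB _ xD xA).
move=> i y; have [->|ni] := eqVneq i a0.
  have [y' ny y'l] := links_other y hB; have [x [xU xe]] := links_disj_end d BD y'l.
  exists y', x; split=> //; first by case/linksP: y'l.
  by case: ifP => [xA|_]; [case: (disjointP _ _ dAB x xA xU) | rewrite eq_sym].
have [y' ny y'l] := links_other y hA; have [x [xU xe]] := links_disj_end d AD y'l.
exists y', x; split=> //; first by case/linksP: y'l.
by rewrite xU eq_sym.
Qed.

(** With this size of [F] the set [B :|: F] has [a + 1] vertices, the least number for which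
    [hconn_join] applies. *)
Lemma side_standard Q D A B F a b : [disjoint D & Q] -> locally_tough D Q -> standard D A B a b ->
  F \subset Q -> full A F -> #|F| = (a - #|B|).+1 -> side Q D (D :|: F) id.
Proof.
move=> d t [f dAB ED sA pA lB cB lb] FQ fF cF.
have DF : [disjoint D & F] by apply: disjointWr FQ d.
have BF : [disjoint B & F] by apply: disjointWl DF; rewrite -ED subsetUr.
have A0 : 0 < #|A| by apply: leq_ltn_trans lb.
have D0 : 0 < #|D| by rewrite -ED cardsUd // addn_gt0 A0.
have hc : hconn (D :|: F) D.
  rewrite -ED -setUA; apply: (hconn_join (a := a) (s := b)) => //.
  - exact: fullU.
  - apply: disjoint_Ur => //; apply: disjointWl DF; by rewrite -ED subsetUl.
  - by case: pA.
  - by apply: cov_sub cB; rewrite ?subsetUl.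
  - by rewrite cardsUd // cF; move: lB; clear; lia.
split; [exact: subsetUl | exact: hc |] => i y.
have choose y' x : y' \in Q -> y' != y -> (y' \in F -> y' != i) -> x \in D -> adj y' x -> x != i ->
    exists y' x, [/\ y' \in Q, y' != y, at_end D (D :|: F) y' x & x != i].
  move=> y'Q ny nF xD yx nx; have [yF|yF] := boolP (y' \in F).
    by exists y', y'; rewrite /at_end inE yF orbT eqxx; split=> //; apply: nF.
  exists y', x; rewrite /at_end inE (negbTE yF) orbF xD yx; split=> //.
  by case: ifP => // yD; case: (disjointP _ _ d _ yD y'Q).
(* A colour outside [D] can only be met by a link used as its own end, so it suffices to avoid both
   [y] and [i] among at least nine links. *)
have [iD|iD] := boolP (i \in D); last first.
  have l9 : 9 * 2 <= 2 * #|links Q D|.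
    by apply: locally_tough_tight t => //; apply: tight1; rewrite -card_gt0.
  have /card_gt0P[y'] : 0 < #|links Q D :\: [set y; i]|.
    have := cardsD (links Q D) [set y; i]; have := subset_leq_card (subsetIr (links Q D) [set y; i]).
    have : #|[set y; i]| <= 2 by rewrite cards2; case: (_ == _).
    by move: l9; clear; lia.
  rewrite !in_setD !inE negb_or => /andP[/andP[ny ni]] /andP[yQ /exists_inP[x xD yx]].
  by apply: (choose y' x) => //; apply: contraNneq iD => <-.
have iF z : z \in F -> z != i.
  by move=> zF; apply: contraTneq iD => <-; apply/negP => zD; apply: (disjointP _ _ DF) zD zF.
case: (ltnP 1 #|D|) => D1.
  have [y' ny /linksP[yQ [x]]] := links_other y (links_del i d t D1).
  rewrite !inE => /andP[ni xD] yx; exact: (choose y' x yQ ny (iF y') xD yx ni).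
have cD : #|A| + #|B| = #|D| by rewrite -ED cardsUd.
have la := path_number_le pA.
have B0 : #|B| = 0 by move: cD D1 A0; clear; lia.
have a1 : 0 < a by apply: path_number_gt0 pA _; rewrite -card_gt0.
have /card_gt0P[y'] : 0 < #|F :\ y|.
  by have := cardsD1 y F; rewrite cF B0; case: (_ \in _); move: a1; clear; lia.
rewrite !inE => /andP[ny yF]; exists y', y'; rewrite /at_end inE yF orbT eqxx; split=> //.
- exact: (subsetP FQ).
- exact: iF.
Qed.
End Sides.

(** * Maximal disconnected sets *)

Section Top.
Variable G : sgraph.
Implicit Types (A B C D E F J K L M N P Q R S U W X Y Z : {set G}) (x y z w u v : G).

Hypothesis p4_dom : forall a b c d : G, p4 (@adj G) a b c d ->
  forall e, [|| adj e a, adj e b, adj e c | adj e d].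
Hypothesis tG : tough9 G.

Definition splittableb Z := [exists A : {set G}, [exists B : {set G}, [&& A != set0, B != set0,
  [disjoint A & B], A :|: B == Z & [forall x in A, forall y in B, ~~ adj x y]]]].

Lemma splittableP Z : reflect (splittable Z) (splittableb Z).
Proof.
apply: (iffP existsP) => [[A /existsP[B /and5P[A0 B0 d /eqP E /forall_inP h]]]|[A [B [[A0 B0 d E] h]]]].
  by exists A, B; split=> // x y xA yB; apply: (forall_inP (h x xA)).
exists A; apply/existsP; exists B; rewrite A0 B0 d E eqxx /=.
by apply/forall_inP => x xA; apply/forall_inP => y yB; apply: h.
Qed.

(* For a disconnected [Z] this says that [Z :|: [set y]] is connected for every outside vertex [y]. *)
Definition maximal Z := forall A B, splits Z A B -> {in ~: Z, forall y, exists2 x, x \in A & adj y x}.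

Lemma maximal_exists Z : splittable Z -> exists Z', [/\ Z \subset Z', splittable Z' & maximal Z'].
Proof.
move=> /splittableP/maxset_exists[Z' /maxsetP[/splittableP sp mx] ZZ']; exists Z'; split=> //.
move=> A B [[A0 B0 d E] an] y; rewrite inE => yZ.
have [/exists_inP//|/exists_inPn na] := boolP [exists x in A, adj y x].
suff sp' : splittableb (y |: Z').
  by move: yZ; rewrite -(mx _ sp' (subsetUr _ _)) !inE eqxx.
apply/splittableP; exists A, (y |: B); split; last first.
  move=> x z xA; rewrite !inE => /orP[/eqP->|zB]; last exact: an.
  by rewrite adj_sym na.
split=> //; [by apply/set0Pn; exists y; rewrite !inE eqxx | | by rewrite -E setUCA].
apply/disjointP => x xA; rewrite !inE => /orP[/eqP xy|xB]; last exact: (disjointP _ _ d) xA xB.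
by move: yZ; rewrite -xy -E inE xA.
Qed.

Lemma anti_p4f D R : anti D R -> R != set0 -> p4f D.
Proof.
move=> an /set0Pn[e eR] a b c d aD bD cD dD; apply/negP => /p4_dom/(_ e).
by rewrite !(adj_sym e) !(negbTE (an _ _ _ eR)).
Qed.

Lemma mixed_edge D y : ~ splittable D -> (exists2 x, x \in D & adj y x) -> ~~ (D \subset nbr y) ->
  exists u v, [/\ u \in D, v \in D, adj u v, adj y u & ~~ adj y v].
Proof.
move=> ns [x xD yx] /subsetPn[z zD]; rewrite inE => yz.
have [/exists_inP[u uD /exists_inP[v vD /and3P[h1 h2 h3]]]|/exists_inPn na] :=
  boolP [exists u in D, exists v in D, [&& adj u v, adj y u & ~~ adj y v]].
  by exists u, v.
case: ns; exists (D :&: nbr y), (D :\: nbr y); split; last first.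
  move=> u v; rewrite !inE => /andP[uD yu] /andP[yv vD].
  by have /exists_inPn/(_ v vD) := na u uD; rewrite yu yv !andbT.
split.
- by apply/set0Pn; exists x; rewrite !inE xD.
- by apply/set0Pn; exists z; rewrite !inE zD andbT.
- by apply/disjointP => u /[!inE] /andP[_ yu]; rewrite yu.
- exact: setID.
Qed.

(* [v - u - y - w] is an induced path for every neighbour [w] of [y] in [A], so by domination [A] would be a join. *)
Lemma mixed_full D A u v y : anti D A -> u \in D -> v \in D -> adj u v -> adj y u -> ~~ adj y v ->
  splittable A -> (exists2 x, x \in A & adj y x) -> A \subset nbr y.
Proof.
move=> an uD vD uv yu yv sA [x xA yx]; apply: contraT => /subsetPn[z zA]; rewrite inE => yz.
exfalso; apply: (split_join sA); exists (A :&: nbr y), (A :\: nbr y); split; last first.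
  move=> w w'; rewrite !inE => /andP[wA yw] /andP[yw' wA'].
  have := @p4_dom v u y w _ w'; rewrite !(adj_sym w').
  rewrite (negbTE (an _ _ vD wA')) (negbTE (an _ _ uD wA')) (negbTE yw') /=; apply.
  by rewrite /p4 (adj_sym v) uv (adj_sym u) yu yw (adj_sym v) yv !an.
split.
- by apply/set0Pn; exists x; rewrite !inE xA.
- by apply/set0Pn; exists z; rewrite !inE zA andbT.
- by apply/disjointP => w /[!inE] /andP[_ yw]; rewrite yw.
- exact: setID.
Qed.

Lemma splits_nbr Z D R : splits Z D R -> {in D, forall x y, adj x y -> y \in D :|: ~: Z}.
Proof.
move=> [[_ _ _ <-] an] x xD y xy; rewrite !inE negb_or; case: (y \in D) => //=.
by apply/negP => yR; have := an x y xD yR; rewrite xy.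
Qed.

Lemma splits_disjC Z D R : splits Z D R -> [disjoint D & ~: Z].
Proof.
by move=> [p _]; have [s _] := parts_sub p; apply/disjointP => x /(subsetP s) xZ /[!inE]; rewrite xZ.
Qed.

Lemma splits_tgh Z D R : splits Z D R -> locally_tough D (~: Z).
Proof.
move=> sp; have [[D0 R0 d E] an] := sp; have [rho rR] := set0Pn _ R0.
apply: (tough_tgh tG (splits_nbr sp) (splits_disjC sp) (rho := rho)).
rewrite !inE negb_or -E inE rR orbT andbT; apply/negP => h; exact: (disjointP _ _ d) h rR.
Qed.

Lemma setting_of Z D R Q P : splits Z D R -> [disjoint Q & P] -> Q :|: P = ~: Z ->
  full D Q -> full R P -> setting D R Q P.
Proof.
move=> sp d E f1 f2; have [[D0 R0 dDR EZ] an] := sp.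
have dD := splits_disjC sp; have dR := splits_disjC (splits_sym sp).
have [QZ PZ] : Q \subset ~: Z /\ P \subset ~: Z by rewrite -E subsetUl subsetUr.
split=> //; try by [apply: disjointWr dD | apply: disjointWr dR].
- exact: anti_p4f an R0.
- by rewrite E; apply: splits_nbr sp.
Qed.

(** If [y] misses a vertex of [D1] but no edge of [D1] is mixed for [y], then [D1 :\: nbr y] splits
    off from [Z] without a neighbour of [y], against maximality. A mixed edge makes [y] complete to
    [D2] by [mixed_full]. *)
Lemma complete_one Z D1 D2 : maximal Z -> splits Z D1 D2 -> splittable D2 ->
  {in ~: Z, forall y, D1 \subset nbr y \/ D2 \subset nbr y}.
Proof.
move=> mx sp s2 y yZ; have [[A0 B0 d E] an] := sp.
have m1 := mx _ _ sp y yZ; have m2 := mx _ _ (splits_sym sp) y yZ.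
have [h|nh] := boolP (D1 \subset nbr y); [by left | right].
have [/exists_inP[u uD /exists_inP[v vD /and3P[h1 h2 h3]]]|/exists_inPn na] :=
  boolP [exists u in D1, exists v in D1, [&& adj u v, adj y u & ~~ adj y v]].
  exact: (mixed_full an uD vD h1 h2 h3 s2 m2).
have sp' : splits Z (D1 :\: nbr y) (D1 :&: nbr y :|: D2).
  split; last first.
    move=> v u; rewrite !inE => /andP[yv vD] /orP[/andP[uD yu]|uD2]; last exact: an.
    by have /exists_inPn/(_ v vD) := na u uD; rewrite yu yv !andbT adj_sym.
  split.
  - by have /subsetPn[z zD zy] := nh; apply/set0Pn; exists z; rewrite inE zy.
  - by have [z zB] := set0Pn _ B0; apply/set0Pn; exists z; rewrite in_setU zB orbT.
  - apply/disjointP => u /[!inE] /andP[yu uD]; rewrite uD (negbTE yu) /= => uD2.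
    exact: (disjointP _ _ d) uD uD2.
  - by rewrite setUA [_ :|: (_ :&: _)]setUC setID.
by have [z] := mx _ _ sp' y yZ; rewrite !inE => /andP[/negbTE->].
Qed.

(** If one side has too few complete vertices, toughness leaves enough for the other, and [claim]
    applies; otherwise both sides become Hamilton-connected and [link] closes the cycle. *)
Lemma case_splittable Z D1 D2 : maximal Z -> splits Z D1 D2 -> splittable D2 -> has_cycle_through Z.
Proof.
move=> mx sp s2; have co := complete_one mx sp s2; have sp' := splits_sym sp.
have [[D10 D20 d E] an] := sp.
pose Q1 := [set y in ~: Z | D1 \subset nbr y]; pose Q2 := ~: Z :\: Q1.
have Q1Z : Q1 \subset ~: Z by apply/subsetP => y; rewrite inE => /andP[].
have dQ : [disjoint Q1 & Q2] by apply/disjointP => x xQ; rewrite in_setD xQ.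
have EQ : Q1 :|: Q2 = ~: Z by rewrite -{1}(setIidPr Q1Z) setID.
have f1 : full D1 Q1.
  by move=> x y xD; rewrite inE => /andP[_ /subsetP/(_ x xD)]; rewrite inE adj_sym.
have f2 : full D2 Q2.
  move=> x y xD; rewrite in_setD => /andP[nQ yZ]; case: (co y yZ) => /subsetP h.
    by move/subsetP: h => h; rewrite inE yZ h in nQ.
  by have := h x xD; rewrite inE adj_sym.
have [a1 p1] := jung (anti_p4f an D20); have [a2 p2] := jung (anti_p4f (antiC an) D10).
have cQ : #|Q1| + #|Q2| = #|~: Z| by rewrite -EQ cardsUd.
have ct A B a : splits Z A B -> path_number A a -> 9 * a.+1 <= 2 * #|~: Z|.
  move=> s p; have [[A0 _ _ _] _] := s.
  apply: leq_trans (locally_tough_tight p.2 (path_number_gt0 p A0) (splits_tgh s)) _; rewrite leq_mul2l /=.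
  by apply/subset_leq_card/subsetP => y /linksP[].
have c1 := ct _ _ _ sp p1; have c2 := ct _ _ _ sp' p2.
have EZ : Z = D2 :|: D1 by rewrite setUC.
case: (leqP #|Q1| a1) => l1.
  rewrite -E; apply: (claim p4_dom tG (setting_of sp dQ EQ f1 f2) p1 l1 p2.1).
  by move: c1 c2 cQ l1; clear; lia.
case: (leqP #|Q2| a2) => l2.
  rewrite EZ; apply: (claim p4_dom tG (setting_of sp' _ _ f2 f1) p2 l2 p1.1).
  - exact: disjoint_swap.
  - by rewrite setUC.
  - by move: c1 c2 cQ l2; clear; lia.
have dD1 := splits_disjC sp; have dD2 := splits_disjC sp'.
have Q2Z : Q2 \subset ~: Z by apply: subsetDl.
have d1 : [disjoint D1 & Q1] by apply: disjointWr dD1.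
have d2 : [disjoint D2 & Q2] by apply: disjointWr dD2.
have h1 := hconn_full f1 d1 p1.1 D10 l1; have h2 := hconn_full f2 d2 p2.1 D20 l2.
have d12 : [disjoint D1 :|: Q1 & D2 :|: Q2].
  apply: disjoint_Ul; apply: disjoint_Ur => //; first by apply: disjointWr dD1.
  by apply: disjoint_swap; apply: disjointWr dD2.
have two A Q a : [disjoint A & Q] -> A != set0 -> a < #|Q| -> 1 < #|A :|: Q|.
  by move=> dAQ; rewrite -card_gt0 cardsUd // => *; lia.
have /card_gt0P[y yQ] : 0 < #|Q1| by apply: leq_ltn_trans l1.
have [x xD yx] := mx _ _ sp' y (subsetP Q1Z y yQ).
rewrite -E; apply: (link tG h1 h2 d12 (two _ _ _ d1 D10 l1) (two _ _ _ d2 D20 l2) (u1 := y) (u2 := x)) => //.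
  by rewrite in_setU yQ orbT.
by rewrite in_setU xD.
Qed.

End Top.

(** * Two connected sides *)

Section Unsplittable.
Variable G : sgraph.
Implicit Types (A B C D E F J K L M N P Q R S U W X Y Z : {set G}) (x y z w u v : G).

Hypothesis p4_dom : forall a b c d : G, p4 (@adj G) a b c d ->
  forall e, [|| adj e a, adj e b, adj e c | adj e d].
Hypothesis tG : tough9 G.

Definition complete_to Z A := [set y in ~: Z | A \subset nbr y].

Lemma complete_to_full Z A : full A (complete_to Z A).
Proof. by move=> x y xD; rewrite inE => /andP[_ /subsetP/(_ x xD)]; rewrite inE adj_sym. Qed.

Lemma complete_to_sub Z A : complete_to Z A \subset ~: Z.
Proof. by apply/subsetP => y; rewrite inE => /andP[]. Qed.

Lemma std_neq0 D A B a b : standard D A B a b -> A != set0.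
Proof. by move=> st; rewrite -card_gt0; apply: leq_ltn_trans (std_lt st). Qed.

Lemma std_gt0 D A B a b : standard D A B a b -> 0 < a.
Proof. by move=> st; apply: path_number_gt0 (std_pcn st) (std_neq0 st). Qed.

Lemma standard_or Z D1 D2 A B a b : maximal Z -> splits Z D1 D2 -> ~ splittable D2 ->
  standard D1 A B a b -> {in ~: Z, forall y, (exists2 x, x \in A & adj y x) ->
    A \subset nbr y \/ D2 \subset nbr y}.
Proof.
move=> mx sp ns st y yZ [x xA yx]; have [[D10 D20 d E] an] := sp.
case: (std_A st) => [sA|/eqP/cards1P[w EA]]; last first.
  by left; apply/subsetP => z; move: xA; rewrite EA !inE => /eqP<- /eqP->.
have [h|nh] := boolP (D2 \subset nbr y); [by right | left].
have [u [v [uD vD h1 h2 h3]]] := mixed_edge ns (mx _ _ (splits_sym sp) y yZ) nh.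
have AD : A \subset D1 by rewrite -(std_U st) subsetUl.
apply: (mixed_full p4_dom _ uD vD h1 h2 h3 sA); last by exists x.
by apply: anti_sub (antiC an).
Qed.

Lemma standard_count Z D1 D2 A B a b : splits Z D1 D2 -> standard D1 A B a b ->
  9 * a.+1 <= 2 * (#|B| + #|links (~: Z) A|).
Proof.
move=> sp st; have [[D10 D20 d E] an] := sp; have [rho rR] := set0Pn _ D20.
have dD := splits_disjC sp; have ED := std_U st.
have AD : A \subset D1 by rewrite -ED subsetUl.
have BD : B \subset D1 by rewrite -ED subsetUr.
have dB : [disjoint B & ~: Z] by apply: disjointWl dD.
apply: (tight_links (std_pcn st).2 (std_gt0 st) (std_neq0 st) (std_full st) dB).
apply: (tough_tgh tG (rho := rho)).
- move=> x xA y xy; have := splits_nbr sp (subsetP AD x xA) xy; rewrite -ED.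
  by rewrite !in_setU orbA.
- by apply: disjoint_Ur; [exact: std_disj st | apply: disjointWl dD].
- rewrite setUA ED !inE negb_or -E inE rR orbT andbT; apply/negP => h.
  exact: (disjointP _ _ d) h rR.
Qed.

Lemma hconn_cov D : hconn D D -> 1 < #|D| -> cov D D 1.
Proof.
move=> hc /card_gt1P[x [y [xD yD xy]]]; exact: hpath_cov (hc x y xD yD xy).
Qed.

Lemma standard_cov D A B a b : standard D A B a b -> cov D D (maxn 1 (a - #|B|)).
Proof.
move=> st; have ED := std_U st; have la := std_le st; have pa := std_pcn st.
case: (ltnP #|B| a) => l.
  rewrite (_ : maxn 1 _ = a - #|B|); last by move: l; clear; lia.
  by rewrite -ED; apply: chain_cov pa.1 l; [exact: std_full st | exact: std_disj st].
have Ea : a = #|B| by move: la l; clear; lia.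
rewrite Ea subnn /=; apply: (@cov_join1 _ D A B a b) => //.
- split; last exact: std_full st.
  split=> //; [exact: std_neq0 st | | exact: std_disj st].
  by rewrite -card_gt0 -Ea; apply: std_gt0 st.
- by case: pa.
- exact: std_cov st.
- exact: ltnW (std_lt st).
Qed.

Lemma shaped_cov D : shaped D -> cov D D 1 \/ exists A B a b, standard D A B a b.
Proof.
case=> [[hc D1]|[A [B [jn _ _ E]]]|h]; [left; exact: hconn_cov | left | by right].
have [[A0 B0 _ _] _] := jn; have [[x xA] [y yB]] := (set0Pn _ A0, set0Pn _ B0).
exact: hpath_cov (balanced_path jn E xA yB).
Qed.

(** Most links of [A] are not complete to [A], hence complete to [D2] by [standard_or], so [A] and
    [D2] form a [setting] with [B :|: F] as inner vertices. The resulting [k] segments are glued to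
    [k] paths through [D2]. *)
Lemma unsaturated Z D1 D2 A B a b : maximal Z -> splits Z D1 D2 -> ~ splittable D2 ->
  shaped D2 -> ~ splittable D1 -> standard D1 A B a b -> #|B| + #|complete_to Z A| <= a -> has_cycle_through Z.
Proof.
move=> mx sp ns sh2 ns1 st lF; have sp' := splits_sym sp; have [[D10 D20 d E] an] := sp.
have ED := std_U st; have dA := std_disj st; have fB := std_full st.
have AD : A \subset D1 by rewrite -ED subsetUl.
have BD : B \subset D1 by rewrite -ED subsetUr.
set F := complete_to Z A in lF; pose P := links (~: Z) A :\: F.
have FZ : F \subset ~: Z := complete_to_sub Z A.
have PZ : P \subset ~: Z by apply/subsetP => y; rewrite inE => /andP[_ /linksP[]].
have dD1 := splits_disjC sp; have dD2 := splits_disjC sp'.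
have fP : full D2 P.
  move=> x y xD; rewrite in_setD => /andP[yF /linksP[yZ ex]].
  case: (standard_or mx sp ns st yZ ex) => /subsetP h; last by have := h x xD; rewrite inE adj_sym.
  by move/subsetP: h => h; rewrite inE yZ h in yF.
have A0 := std_neq0 st; have pa := std_pcn st; have a0 := std_gt0 st.
have setg : setting A D2 (B :|: F) P.
  split=> //.
  - exact: p4f_sub AD (anti_p4f p4_dom an D20).
  - exact: disjointWl AD d.
  - by apply: disjoint_Ur => //; apply: disjointWl AD _; apply: disjointWr FZ dD1.
  - by apply: disjointWl AD _; apply: disjointWr PZ dD1.
  - apply: disjoint_Ur; last by apply: disjointWr FZ dD2.
    by apply: disjoint_swap; apply: disjointWl BD d.
  - by apply: disjointWr PZ dD2.
  - apply: disjoint_Ul; first by apply: disjointWl BD _; apply: disjointWr PZ dD1.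
    by apply/disjointP => x xF; rewrite in_setD xF.
  - by apply: anti_sub an.
  - by apply: fullU => //; apply: complete_to_full.
  - move=> x xA y xy; have := splits_nbr sp (subsetP AD x xA) xy.
    rewrite -ED !in_setU => /orP[/orP[->//|->]|yZ]; rewrite ?orbT //.
    have yl : y \in links (~: Z) A by apply/linksP; split=> //; exists x; rewrite // adj_sym.
    by rewrite in_setD yl andbT; case: (y \in F); rewrite ?orbT.
have dBF : [disjoint B & F] by apply: disjointWl BD _; apply: disjointWr FZ dD1.
have cBF : #|B :|: F| = #|B| + #|F| by rewrite cardsUd.
have lBF : #|B :|: F| <= a by rewrite cBF.
have ct : 9 * a.+1 <= 2 * (#|B| + #|F| + #|P|).
  apply: leq_trans (standard_count sp st) _; rewrite leq_mul2l /= -addnA leq_add2l.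
  apply: leq_trans (cardsU_le _ _); apply/subset_leq_card/subsetP => y yl.
  by rewrite in_setU in_setD yl andbT orbN.
have [r pr] := jung (anti_p4f p4_dom (antiC an) D10).
have lr := path_number_le pr; have r0 := path_number_gt0 pr D20.
pose k := maxn 1 (a - #|B :|: F|).
(* If [D2] cannot be cut into [k] paths it is so small that [B] can be absorbed into a cycle through
   [A] and [D2]. *)
case: (leqP k #|D2|) => lk; last first.
  have lab : #|D2| + #|B| < #|A|.
    by apply: leq_trans (path_number_le pa); move: lk lr r0; rewrite /k cBF; clear; lia.
  apply: (cycle_sub (C := A :|: D2 :|: B)); first by rewrite -E -ED setUAC.
  apply: absorb => //; apply: (claim p4_dom tG setg pa lBF pr.1).
  by move: ct lF lr lk r0; rewrite /k cBF; clear; lia.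
have [|E' [s1 s2 m]] := setting_segs p4_dom tG setg pa lBF (subsetUl B F) _ (std_lt st).
  by apply: cov_sub (std_cov st); rewrite ?subsetUl.
rewrite ED in s1; rewrite -/k in m; have [EP EPR] := setting_disj setg s2.
have k0 : 0 < k by rewrite leq_max.
have short r' : cov D2 D2 r' -> r' <= k -> has_cycle_through Z.
  move=> c l; apply: (cycle_sub (C := E' :|: D2)); first by rewrite -E setSU.
  apply: (glue m k0 (cov_rpaths (cov_mono c _)) (fullC fP) EPR).
  by rewrite l lk.
case: (shaped_cov sh2) => [c|[A2 [B2 [a2 [b2 st2]]]]]; first exact: short c k0.
case: (leqP (maxn 1 (a2 - #|B2|)) k) => l2; first exact: short (standard_cov st2) l2.
have {}l2 : k + #|B2| < a2 by move: l2 k0; clear; lia.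
have [M [MP lM {}m]] := linked_cover_used m.
set F2 := complete_to Z A2.
have ED2 := std_U st2.
have AD2 : A2 \subset D2 by rewrite -ED2 subsetUl.
have BD2 : B2 \subset D2 by rewrite -ED2 subsetUr.
have ct2 := standard_count sp' st2; have ct1 := standard_count sp st.
have lks A' : links (~: Z) A' \subset F :|: F2 -> #|links (~: Z) A'| <= #|F| + #|F2 :\: (F :|: M)| + #|M|.
  move=> s; apply: leq_trans (subset_leq_card s) _.
  apply: leq_trans (_ : #|F :|: F2 :\: (F :|: M) :|: M| <= _).
    apply/subset_leq_card/subsetP => x; rewrite !(in_setU, in_setD).
    by case: (x \in F); case: (x \in M); rewrite ?orbT ?orbF.
  by apply: leq_trans (cardsU_le _ _) _; rewrite leq_add2r cardsU_le.
have inF A' y : y \in ~: Z -> A' \subset nbr y -> y \in complete_to Z A' by move=> h1 h2; rewrite inE h1.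
have l1 : links (~: Z) A \subset F :|: F2.
  apply/subsetP => y /linksP[yZ ex]; rewrite in_setU.
  case: (standard_or mx sp ns st yZ ex) => h; first by rewrite (inF A).
  by rewrite (inF A2) ?orbT // (subset_trans AD2 h).
have l2' : links (~: Z) A2 \subset F :|: F2.
  apply/subsetP => y /linksP[yZ ex]; rewrite in_setU.
  case: (standard_or mx sp' ns1 st2 yZ ex) => h; first by rewrite (inF A2) ?orbT.
  by rewrite (inF A) // (subset_trans AD h).
have {}l1 := lks _ l1; have {}l2' := lks _ l2'.
have [|J JF cJ] := @card_sub_ex _ (F2 :\: (F :|: M)) (a2 - #|B2| - k).
  by move: l1 l2' ct1 ct2 lM lF l2 a0; rewrite /k cBF; clear; lia.
have F2Z : F2 \subset ~: Z := complete_to_sub Z A2.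
have JF2 : J \subset F2 by apply: subset_trans JF (subsetDl _ _).
have JZ := subset_trans JF2 F2Z.
have dBJ : [disjoint B2 & J] by apply: disjointWl BD2 _; apply: disjointWr JZ dD2.
have cBJ : #|B2 :|: J| = a2 - k by rewrite cardsUd // cJ; move: l2; clear; lia.
have := @chain_rpaths _ A2 (B2 :|: J) a2 _ _ (std_pcn st2).1 _; rewrite cBJ.
rewrite (_ : a2 - (a2 - k) = k); last by move: l2; clear; lia.
have fJ : full A2 (B2 :|: J).
  by apply: fullU; [exact: std_full st2 | apply: full_sub (@complete_to_full Z A2)].
have dJ : [disjoint A2 & B2 :|: J].
  apply: disjoint_Ur; first exact: std_disj st2.
  by apply: disjointWl AD2 _; apply: disjointWr JZ dD2.
move/(_ fJ dJ) => rp; have {}rp : rpaths A2 (A2 :|: (B2 :|: J)) (A2 :|: (B2 :|: J)) k.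
  by apply: rp; move: l2 k0; clear; lia.
have fM : full M A2 by apply: full_sub (fullC fP).
apply: (cycle_sub (C := E' :|: (A2 :|: (B2 :|: J)))).
  by rewrite (setUA A2) ED2 -E setUSS // subsetUl.
apply: (glue m k0 rp fM); rewrite setUA ED2; apply: disjoint_Ur.
  by apply: disjointWl EPR; rewrite setUS.
apply/disjointP => x xEM xJ; have := subsetP JF x xJ; rewrite in_setD in_setU negb_or.
case/andP=> /andP[xF xM] _; move: xEM; rewrite in_setU (negbTE xM) orbF => /(subsetP s2).
rewrite setUA ED in_setU (negbTE xF) orbF => xD.
exact: (disjointP _ _ dD1) xD (subsetP JZ x xJ).
Qed.

End Unsplittable.

(** * Cycles through P_4-free sets *)

Section Final.
Variable G : sgraph.
Implicit Types (A B C D E F J K L M N P Q R S U W X Y Z : {set G}) (x y z w u v : G).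

Hypothesis p4_dom : forall a b c d : G, p4 (@adj G) a b c d ->
  forall e, [|| adj e a, adj e b, adj e c | adj e d].
Hypothesis tG : tough9 G.

(** Hall's condition for two demands: [X'] takes vertices outside [Y] first. *)
Lemma disjoint_subsets X Y m n : m <= #|X| -> n <= #|Y| -> m + n <= #|X :|: Y| ->
  exists X' Y', [/\ X' \subset X, Y' \subset Y, #|X'| = m, #|Y'| = n & [disjoint X' & Y']].
Proof.
move=> lX lY lXY.
have cX := cardsID Y X.
have cXY : #|X :|: Y| = #|X :\: Y| + #|Y|.
  by have := cardsUI X Y; move: cX; clear; lia.
case: (leqP m #|X :\: Y|) => lm.
  have [X' X'X cX'] := card_sub_ex lm; have [Y' Y'Y cY'] := card_sub_ex lY.
  exists X', Y'; split=> //; first by apply: subset_trans X'X (subsetDl _ _).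
  apply/disjointP => x /(subsetP X'X) /[!inE] /andP[xY _] /(subsetP Y'Y) xY'.
  by rewrite xY' in xY.
have [|T TXY cT] := @card_sub_ex _ (X :&: Y) (m - #|X :\: Y|).
  by move: cX lX; clear; lia.
have /andP[TX TY] : (T \subset X) && (T \subset Y) by rewrite -subsetI.
have [|Y' Y'Y cY'] := @card_sub_ex _ (Y :\: T) n.
  rewrite cardsD (setIidPr TY) cT; move: lXY cXY lm; clear; lia.
have dT : [disjoint X :\: Y & T].
  by apply/disjointP => x /[!inE] /andP[xY _] /(subsetP TY) xT; rewrite xT in xY.
exists (X :\: Y :|: T), Y'; split=> //.
- by rewrite subUset subsetDl.
- by apply: subset_trans Y'Y (subsetDl _ _).
- by rewrite cardsUd // cT; move: lm; clear; lia.
- apply/disjointP => x xXT /(subsetP Y'Y); move: xXT; rewrite !inE.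
  by case: (x \in T); case: (x \in Y); rewrite ?andbF.
Qed.

Lemma shaped_side Z D R : splits Z D R -> shaped D ->
  (exists c, side (~: Z) D D c) \/ exists A B a b, standard D A B a b.
Proof.
move=> sp; have t := splits_tgh tG sp; have d := splits_disjC sp.
case=> [[hc D1]|[A [B bal]]|h]; last by right.
  by left; exists id; apply: side_hconn.
by left; apply: side_balanced bal.
Qed.

Lemma standard_side Z D R A B F a b : splits Z D R -> standard D A B a b ->
  F \subset complete_to Z A -> #|F| = (a - #|B|).+1 -> side (~: Z) D (D :|: F) id.
Proof.
move=> sp st FA cF; apply: (side_standard (splits_disjC sp) (splits_tgh tG sp) st) => //.
  exact: subset_trans FA (complete_to_sub Z A).
exact: full_sub (complete_to_full (Z := Z) (A := A)).
Qed.

Lemma case_unsplittable Z D1 D2 : maximal Z -> splits Z D1 D2 -> ~ splittable D1 ->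
  ~ splittable D2 -> has_cycle_through Z.
Proof.
move=> mx sp n1 n2; have sp' := splits_sym sp; have [[D10 D20 d E] an] := sp.
have sh1 := unsplittable_shaped (anti_p4f p4_dom an D20) D10 n1.
have sh2 := unsplittable_shaped (anti_p4f p4_dom (antiC an) D10) D20 n2.
have dD1 := splits_disjC sp; have dD2 := splits_disjC sp'.
have Q0 : ~: Z != set0.
  rewrite -card_gt0; have := locally_tough_tight (tight1 D10) isT (splits_tgh tG sp).
  have : #|links (~: Z) D1| <= #|~: Z| by apply/subset_leq_card/subsetP => y /linksP[].
  by clear; lia.
have m1 := mx _ _ sp; have m2 := mx _ _ sp'.
have fin W1 W2 c1 c2 : side (~: Z) D1 W1 c1 -> side (~: Z) D2 W2 c2 -> [disjoint W1 & W2] ->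
    has_cycle_through Z.
  by move=> s1 s2 dW; rewrite -E; apply: two_sides s1 s2 dW Q0 m1 m2.
have mixed C1 C2 c A B a b : splits Z C1 C2 -> ~ splittable C1 -> ~ splittable C2 -> shaped C2 ->
    standard C1 A B a b -> side (~: Z) C2 C2 c ->
    has_cycle_through Z.
  move=> s ns1 ns2 sh st sd; have [[C10 C20 dC EC] anC] := s.
  case: (leqP (#|B| + #|complete_to Z A|) a) => l; first exact: (unsaturated p4_dom tG mx s ns2 sh ns1 st l).
  have [|F FA cF] := @card_sub_ex _ (complete_to Z A) (a - #|B|).+1.
    by move: (std_le st) l; clear; lia.
  rewrite -EC; apply: (two_sides (standard_side s st FA cF) sd) => //.
  - apply: disjoint_Ul => //; apply: disjoint_swap; apply: disjointWr (splits_disjC (splits_sym s)).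
    exact: subset_trans FA (complete_to_sub Z A).
  - exact: mx s.
  - exact: mx (splits_sym s).
case: (shaped_side sp sh1) => [[c1 s1]|[A1 [B1 [a1 [b1 st1]]]]].
  case: (shaped_side sp' sh2) => [[c2 s2]|[A2 [B2 [a2 [b2 st2]]]]]; first exact: fin s1 s2 d.
  exact: (mixed D2 D1 c1 A2 B2 a2 b2).
case: (shaped_side sp' sh2) => [[c2 s2]|[A2 [B2 [a2 [b2 st2]]]]].
  exact: (mixed D1 D2 c2 A1 B1 a1 b1).
case: (leqP (#|B1| + #|complete_to Z A1|) a1) => l1; first exact: (unsaturated p4_dom tG mx sp n2 sh2 n1 st1 l1).
case: (leqP (#|B2| + #|complete_to Z A2|) a2) => l2; first exact: (unsaturated p4_dom tG mx sp' n1 sh1 n2 st2 l2).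
have inF A' y : y \in ~: Z -> A' \subset nbr y -> y \in complete_to Z A' by move=> h1 h2; rewrite inE h1.
have AD1 : A1 \subset D1 by rewrite -(std_U st1) subsetUl.
have AD2 : A2 \subset D2 by rewrite -(std_U st2) subsetUl.
have k1 : #|links (~: Z) A1| <= #|complete_to Z A1 :|: complete_to Z A2|.
  apply/subset_leq_card/subsetP => y /linksP[yZ ex]; rewrite in_setU.
  case: (standard_or p4_dom mx sp n2 st1 yZ ex) => h; first by rewrite (inF A1).
  by rewrite (inF A2) ?orbT // (subset_trans AD2 h).
have k2 : #|links (~: Z) A2| <= #|complete_to Z A1 :|: complete_to Z A2|.
  apply/subset_leq_card/subsetP => y /linksP[yZ ex]; rewrite in_setU.
  case: (standard_or p4_dom mx sp' n1 st2 yZ ex) => h; first by rewrite (inF A2) ?orbT.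
  by rewrite (inF A1) // (subset_trans AD1 h).
(* One vertex may be complete to both [A1] and [A2], so disjoint extensions need a bound on the
   union; every link of either set lies in it, and toughness bounds its size from below. *)
have [|||F1 [F2 [s1 s2 cF1 cF2 dF]]] :=
  @disjoint_subsets (complete_to Z A1) (complete_to Z A2) (a1 - #|B1|).+1 (a2 - #|B2|).+1.
- by move: (std_le st1) l1; clear; lia.
- by move: (std_le st2) l2; clear; lia.
- have := standard_count tG sp st1; have := standard_count tG sp' st2.
  by move: (std_le st1) (std_le st2) k1 k2; clear; lia.
apply: (fin _ _ _ _ (standard_side sp st1 s1 cF1) (standard_side sp' st2 s2 cF2)).
have F1Z := subset_trans s1 (complete_to_sub Z A1); have F2Z := subset_trans s2 (complete_to_sub Z A2).
apply: disjoint_Ul; apply: disjoint_Ur => //; first by apply: disjointWr F2Z dD1.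
by apply: disjoint_swap; apply: disjointWr F1Z dD2.
Qed.

Lemma cycle_splittable Z : splittable Z -> has_cycle_through Z.
Proof.
move=> /maximal_exists[Z' [ZZ [D1 [D2 sp]] mx]]; apply: cycle_sub ZZ _.
case: (splittableP D2) => s2; first exact: (case_splittable p4_dom tG mx sp).
case: (splittableP D1) => s1; first exact: (case_splittable p4_dom tG mx (splits_sym sp)).
exact: case_unsplittable mx sp s1 s2.
Qed.

Lemma cycle_balanced Z A B : joins Z A B -> #|A| = #|B| -> 1 < #|A| -> has_cycle_through Z.
Proof.
move=> jn E lA; have [[A0 B0 d EZ] f] := jn; have [[x xA] [y yB]] := (set0Pn _ A0, set0Pn _ B0).
have [t [p u s c l]] := balanced_path jn E xA yB.
exists (x :: t); split=> //.
  have : #|Z| <= size (x :: t) by apply: uniq_size_card.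
  by apply: leq_trans; rewrite -EZ cardsUd // -E; move: lA; clear; lia.
by apply/andP; split; rewrite //= rcons_path p l adj_sym f.
Qed.

(** In an unbalanced join the smaller part is absorbed into a cycle through the larger one, which
    exists by induction or, if that part is disconnected, by [cycle_splittable]. *)
Lemma cycle_large Z : p4f Z -> 2 < #|Z| -> has_cycle_through Z.
Proof.
have [n] := ubnP #|Z|; elim: n Z => // n IH Z ln pZ Z3.
have [sZ|[A0 [B0 jn0]]] := cographP pZ (ltnW Z3); first exact: cycle_splittable.
suff key A B : joins Z A B -> #|B| <= #|A| -> has_cycle_through Z.
  by case/orP: (leq_total #|A0| #|B0|) => l; [apply: key (joins_sym jn0) l | apply: key jn0 l].
move=> jn; rewrite leq_eqVlt => /orP[/eqP E|lt].
  apply: (cycle_balanced jn); first by rewrite E.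
  by have [p _] := jn; have [c _ _] := parts_card p; move: c E Z3; clear; lia.
have [p f] := jn; have [c lA lB] := parts_card p; have [_ _ d EZ] := p.
have A2 : 1 < #|A| by move: lt lB; clear; lia.
have pA : p4f A := p4f_sub (parts_sub p).1 pZ.
have up : has_cycle_through A -> has_cycle_through Z.
  move=> h; have := @absorb _ A set0 B f; rewrite !setU0 EZ cards0; exact.
have [sA|[A1 [A1' j1]]] := cographP pA A2; first exact/up/cycle_splittable.
case: (ltnP 2 #|A|) => A3; first by apply: up; apply: IH => //; move: ln c lB; clear; lia.
(* Here [A] is an edge and [B] a single vertex, so [Z] is a triangle. *)
have [p1 f1] := j1; have [c1 l1 l1'] := parts_card p1; have [A10 A10' d1 EA] := p1.
have [[x xA] [y yA]] := (set0Pn _ A10, set0Pn _ A10'); have [z zB] := card_gt0P lB.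
have xy := f1 x y xA yA.
have xz : adj x z by apply: f; rewrite // -EA inE xA.
have yz : adj y z by apply: f; rewrite // -EA inE yA orbT.
have ne (u v : G) : adj u v -> u != v by apply: contraTneq => ->; rewrite adj_irr.
have un : uniq [:: x; y; z] by rewrite /= !inE negb_or !ne.
exists [:: x; y; z]; split=> //; first by rewrite /ucycle un andbT /= xy yz adj_sym xz.
have s : [set u in [:: x; y; z]] \subset Z.
  apply/subsetP => u; rewrite !inE -EZ -EA !inE => /or3P[] /eqP->; rewrite ?xA ?yA ?zB ?orbT //.
have cs : #|[set u in [:: x; y; z]]| = 3 by rewrite cardsE (card_uniqP un).
have /eqP ES : [set u in [:: x; y; z]] == Z.
  by rewrite eqEcard s cs; move: c lt A3 lB; clear; lia.
by move=> u; rewrite -ES inE.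
Qed.

(** A smaller [Z] is enlarged to three vertices, which is harmless because an induced path [P_4]
    needs four. *)
Lemma cycle_p4f Z : 2 < #|G| -> p4f Z -> has_cycle_through Z.
Proof.
move=> lG pZ; case: (ltnP 2 #|Z|) => l; first exact: cycle_large.
have [|J JZ cJ] := @card_sub_ex _ (~: Z) (3 - #|Z|).
  by rewrite -(leq_add2l #|Z|) cardsC; move: l lG; clear; lia.
have dZJ : [disjoint Z & J].
  by apply/disjointP => x xZ /(subsetP JZ); rewrite inE xZ.
have c3 : #|Z :|: J| = 3 by rewrite cardsUd // cJ; move: l; clear; lia.
apply: (cycle_sub (subsetUl Z J)); apply: cycle_large; last by rewrite c3.
move=> a b c d aD bD cD dD; apply/negP => /p4_uniq u.
have : #|[set x in [:: a; b; c; d]]| <= #|Z :|: J|.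
  by apply/subset_leq_card/subsetP => x; rewrite inE !in_cons orbF => /or4P[] /eqP->.
by rewrite cardsE (card_uniqP u) c3.
Qed.

End Final.

Theorem lemma3p2 (R : realType) (G : sgraph) (Z : {set G}) :
  2 < #|G| ->
  tough (9%:R / 2%:R : R)%R G ->
  graph_free P4_P1 G ->
  graph_free P4 (induced Z) ->
  has_cycle_through Z.
Proof.
move=> lG t f1 f2; apply: (cycle_p4f (p4_dom_of f1) (tough_tough9 t) lG).
move=> a b c d aZ bZ cZ dZ.
exact: (p4_free_of f2 (Sub a aZ) (Sub b bZ) (Sub c cZ) (Sub d dZ)).
Qed.
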